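(* Let $X$ be a complex Banach space and let $f:\mathbb{R}_+\to X$ be a bounded continuous asymptotically regular function such that $\sup_{t\ge0}\left\|\int_0^t f(s)\,\mathrm{d}s\right\|<\infty$. Suppose that $\widehat{f}$ admits a boundary function $F\in L^1_{\mathrm{loc}}(\mathbb{R}\setminus\{0\};X)$, i.e. $$\lim_{\alpha\to0+}\int_\mathbb{R}\widehat{f}(\alpha+\mathrm{i}s)\psi(s)\,\mathrm{d}s=\int_\mathbb{R}F(s)\psi(s)\,\mathrm{d}s\quad\text{for all }\psi\in C_\mathrm{c}(\mathbb{R}\setminus\{0\}).$$ Then $f\in C_0(\mathbb{R}_+;X)$. Moreover, let $m:(0,1]\to[1,\infty)$ be a continuous non-increasing function. Then: (a) If $k\ge1$ is an integer, $F\in C^k(\mathbb{R}\setminus\{0\};X)$ and there is $C>0$ such that $\|F^{(j)}(s)\|\le C|s|^{k-j}m(|s|)^{k+1}$ for all $0<|s|\le1$ and $0\le j\le k$, then for every $c>0$, $$\|f(t)\|=O\left(m_k^{-1}(ct)+\frac1t\right),\quad t\to\infty,$$ where $m_k^{-1}$ is the inverse of $m_k:(0,1]\to(0,\infty)$, $m_k(r)=m(r)\left(\frac{m(r)}{r}\right)^{1/k}$. (b) If $F\in C^\infty(\mathbb{R}\setminus\{0\};X)$ and there is $C>0$ such that $\|F^{(j)}(s)\|\le C\,j!\,|s|\,m(|s|)^{j+1}$ for all $0<|s|\le1$ and all integers $j\ge0$, then for every $c\in(0,1)$, $$\|f(t)\|=O\left(m_{\log}^{-1}(ct)+\frac1t\right),\quad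 t\to\infty,$$ where $m_{\log}^{-1}$ is the inverse of $m_{\log}:(0,1]\to(0,\infty)$, $m_{\log}(r)=m(r)\log\left(1+\frac{m(r)}{r}\right)$.
   Context: The Laplace transform is $\widehat{f}(\lambda)=\int_0^\infty \mathrm{e}^{-\lambda t}f(t)\,\mathrm{d}t$ for $\operatorname{Re}\lambda>0$; the Fourier transform is $(\mathcal{F}\phi)(s)=\int_\mathbb{R}\mathrm{e}^{-\mathrm{i}st}\phi(t)\,\mathrm{d}t$; the convolution is $f*\phi(t)=\int_0^\infty f(s)\phi(t-s)\,\mathrm{d}s$. A bounded continuous $f:\mathbb{R}_+\to X$ is called asymptotically regular if there exist $C>0$ and some $\phi\in L^1(\mathbb{R})$ with $\mathcal{F}\phi\in W^{1,1}(\mathbb{R})\cap C_\mathrm{c}(\mathbb{R})$ and $\mathcal{F}\phi\equiv1$ near $0$, such that $\|f(t)-f*\phi(t)\|\le C/t$ for all $t>0$. The functions $m_k$, $m_{\log}$ are strictly decreasing, and their inverses are defined on their ranges, which contain $ct$ for all sufficiently large $t$. *)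

(* Defs.v *)
From HB Require Import structures.
From mathcomp Require Import all_boot all_order all_algebra.
From mathcomp Require Import all_classical all_reals all_analysis.
From mathcomp Require Import complex.

Set Implicit Arguments.
Unset Strict Implicit.
Unset Printing Implicit Defensive.

Import Order.TTheory GRing.Theory Num.Theory.
Import numFieldNormedType.Exports.
Local Open Scope ring_scope.
Local Open Scope classical_set_scope.

Section Defs.
Context {R : realType}.
Local Notation mu := (@lebesgue_measure R).
Local Notation C := R[i].

Definition cexp (z : C) : C :=
  ((expR (complex.Re z) * cos (complex.Im z)) +i* (expR (complex.Re z) * sin (complex.Im z)))%C.

Definition cintegrable (D : set R) (g : R -> C) : Prop :=
  mu.-integrable D (fun x => (complex.Re (g x))%:E) /\
  mu.-integrable D (fun x => (complex.Im (g x))%:E).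

Definition cint (D : set R) (g : R -> C) : C :=
  ((fine (\int[mu]_(x in D) (complex.Re (g x))%:E)%E) +i*
   (fine (\int[mu]_(x in D) (complex.Im (g x))%:E)%E))%C.

Definition ccontinuous (g : R -> C) : Prop :=
  continuous (fun x => complex.Re (g x)) /\ continuous (fun x => complex.Im (g x)).

Definition csupport (g : R -> C) : set R := closure [set x | g x != 0].

Definition fourier (phi : R -> C) (s : R) : C :=
  cint setT (fun t => cexp (- (0 +i* (s * t)))%C * phi t).

Definition smooth (psi : R -> R) : Prop :=
  forall (n : nat) (x : R), derivable (iter n (fun g : R -> R => derive1 g) psi) x 1.

Definition test_function (psi : R -> R) : Prop :=
  smooth psi /\ compact (closure [set x | psi x != 0]).

Definition W11 (g : R -> C) : Prop :=
  cintegrable setT g /\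
  exists h : R -> C, cintegrable setT h /\
    forall psi : R -> R, test_function psi ->
      cint setT (fun x => g x * ((derive1 psi x)%:C)%C) =
      - cint setT (fun x => h x * ((psi x)%:C)%C).

Context {X : completeNormedModType C}.

Definition nrm (x : X) : R := complex.Re `|x|.

Record simple_fun := SimpleFun {
  sf_n : nat ;
  sf_coef : nat -> X ;
  sf_set : nat -> set R }.

Definition sf_eval (s : simple_fun) (x : R) : X :=
  \sum_(i < sf_n s) ((x \in sf_set s i)%:R : C) *: sf_coef s i.

Definition sf_int (s : simple_fun) : X :=
  \sum_(i < sf_n s) ((fine (mu (sf_set s i)))%:C)%C *: sf_coef s i.

Definition sf_on (D : set R) (s : simple_fun) : Prop :=
  forall i, (i < sf_n s)%N ->
    [/\ measurable (sf_set s i), sf_set s i `<=` D & (mu (sf_set s i) < +oo)%E].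

(* v is the Bochner integral of g over D: there are integrable simple
   functions s_n with \int_D ||g - s_n|| -> 0 (upper integral, dominated a.e.
   by measurable h_n) and \int s_n -> v. *)
Definition is_bochner_integral (D : set R) (g : R -> X) (v : X) : Prop :=
  measurable D /\
  exists (s : nat -> simple_fun) (h : nat -> R -> R),
    (forall n, sf_on D (s n)) /\
    (forall n, measurable_fun D (h n)) /\
    (forall n, {ae mu, forall x, D x -> nrm (g x - sf_eval (s n) x) <= h n x}) /\
    ((fun n => (\int[mu]_(x in D) (h n x)%:E)%E) @ \oo --> 0%E) /\
    (sf_int (s n) @[n --> \oo] --> v).

Definition bochner_integrable (D : set R) (g : R -> X) : Prop :=
  exists v, is_bochner_integral D g v.

(* the Bochner integral (0 if g is not Bochner integrable on D) *)
Definition Bint (D : set R) (g : R -> X) : X :=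
  xget 0 [set v | is_bochner_integral D g v].

Definition laplace (f : R -> X) (z : C) : X :=
  Bint `[0, +oo[%classic (fun t => cexp (- (z * (t%:C)%C)) *: f t).

Definition conv (f : R -> X) (phi : R -> C) (t : R) : X :=
  Bint `[0, +oo[%classic (fun s => phi (t - s) *: f s).

Definition asymp_regular (f : R -> X) : Prop :=
  exists (C0 : R) (phi : R -> C),
    [/\ 0 < C0, cintegrable setT phi,
        W11 (fourier phi) /\ ccontinuous (fourier phi) /\
        compact (csupport (fourier phi)),
        (\forall s \near (0 : R), fourier phi s = 1) &
        forall t : R, 0 < t -> nrm (f t - conv f phi t) <= C0 / t].

Definition L1loc_punctured (F : R -> X) : Prop :=
  forall K : set R, compact K -> ~ K 0 -> bochner_integrable K F.

Definition boundary_function (f F : R -> X) : Prop :=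
  forall psi : R -> C, ccontinuous psi -> compact (csupport psi) ->
    ~ csupport psi 0 ->
    (fun a : R => Bint setT (fun s => psi s *: laplace f (a +i* s)%C))
      @ 0^'+ --> Bint setT (fun s => psi s *: F s).

Definition has_deriv_at (G : R -> X) (s : R) (d : X) : Prop :=
  (fun h : R => ((h^-1)%:C)%C *: (G (s + h) - G s)) @ 0^' --> d.

Definition Ck_punctured (k : nat) (F : R -> X) (Fd : nat -> R -> X) : Prop :=
  [/\ forall s, s != 0 -> Fd 0%N s = F s,
      forall j, (j < k)%N -> forall s, s != 0 -> has_deriv_at (Fd j) s (Fd j.+1 s)
    & forall s, s != 0 -> {for s, continuous (Fd k)}].

Definition Cinf_punctured (F : R -> X) (Fd : nat -> R -> X) : Prop :=
  (forall s, s != 0 -> Fd 0%N s = F s) /\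
  (forall j s, s != 0 -> has_deriv_at (Fd j) s (Fd j.+1 s)).

End Defs.

Section Rates.
Context {R : realType}.
Definition m_k (m : R -> R) (k : nat) (r : R) : R :=
  m r * (m r / r) `^ (k%:R^-1).
Definition m_log (m : R -> R) (r : R) : R :=
  m r * ln (1 + m r / r).
End Rates.

(* Main.v *)
(* Vector-valued integrals are tested against norming functionals, with bounds
   uniform in the functional. Let Phi be the Fourier transform of phi and chi_r
   a smooth cutoff equal to 1 on [-r, r]. Fourier inversion on the line
   Re z = alpha and alpha -> 0 express f * phi (t), up to the factor 2 pi, as the
   limit of the integral of e^{ist} chi_r(s) f^(alpha + is) plus the integral of
   e^{ist} (Phi(s) - chi_r(s)) F(s). The first is O(r), because f^(z) = z P^(z)
   for the bounded primitive P of f; the second tends to 0 as t -> oo by the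
   Riemann-Lebesgue lemma. For the rates, Phi - chi_r is the sum of
   Phi - chi_{1/2}, which contributes O(1/t) since Phi is W^{1,1}, and of
   chi_{1/2} - chi_r, whose contribution is integrated by parts k times in (a)
   and about t / m(r) times in (b). *)

(* The functional is chosen after [t] and [r], since it norms the convolution at [t]. Constants must
   therefore be uniform over functionals, and [F] and its derivatives are bounded in norm before a
   functional is applied. Fubini, dominated convergence and integration by parts are then used for
   scalar functions only.

   Three obstacles shape the estimates. [F] may be singular at 0, so it occurs only multiplied by
   functions that vanish near 0. [Phi] has a single weak derivative, which yields 1/t and no more;
   repeated integration by parts is reserved for the frequencies where [Phi] has been replaced by
   explicit smooth cutoffs. In (b) the number N of integrations grows with t, so a factor 2^N or N
   derivatives of a cutoff would ruin the bound; there every new derivative is sent to [F].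

   The rates come from balancing the last remainder against r. In (a) the relation m_k(r) = c t says
   m(r)^(k+1) / t^k = c^k r. In (b) the optimal remainder is a polynomial in x = t / m(r) times m(r)
   exp(-x); exp(-c x) turns m(r) into r, and exp(-(1-c) x) absorbs the polynomial, hence c < 1. *)
Require Import Defs.
From HB Require Import structures.
From mathcomp Require Import all_boot all_order all_algebra.
From mathcomp Require Import all_classical all_reals all_analysis.
From mathcomp Require Import measurable_realfun.
From mathcomp Require Import complex.
From mathcomp Require Import ring lra.
Import Order.TTheory GRing.Theory Num.Theory.
Import numFieldNormedType.Exports.
Set Implicit Arguments.
Unset Strict Implicit.
Unset Printing Implicit Defensive.
Local Open Scope ring_scope.
Local Open Scope classical_set_scope.

(** * Complex-valued Lebesgue integrals *)

Lemma norm_le_cvg0 {R : realType} {T : Type} (G : set_system T) {FG : Filter G}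
    (v u : T -> R) :
  (forall n, `|u n| <= v n) -> v @ G --> (0 : R) -> u @ G --> (0 : R).
Proof.
move=> uv /cvgr0Pnorm_le v0; apply/cvgr0Pnorm_le => e e0.
apply: filterS (v0 _ e0) => n; apply: le_trans.
by rewrite (le_trans (uv n))// ler_norm.
Qed.

Lemma cvg0_cstM {R : realType} {T : Type} (G : set_system T) {FG : Filter G}
    (c : R) (v : T -> R) :
  v @ G --> (0 : R) -> (fun t => c * v t) @ G --> (0 : R).
Proof.
move=> v0; have := cvgMl_tmp (a := c) v0; rewrite mulr0; exact.
Qed.

Lemma cvg0_cst {R : realType} {T : Type} (G : set_system T) {FG : ProperFilter G}
    (c : R) : (fun _ : T => c) @ G --> (0 : R) -> c = 0.
Proof. by move=> h; apply: (cvg_unique _ _ h) => //; exact: cvg_cst. Qed.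

Section ComplexModulus.
Context {R : realType}.
Implicit Types (z w : R[i]) (x y : R).
Local Notation Re := complex.Re.
Local Notation Im := complex.Im.

(** The norm of [R[i]] takes values in [R[i]]; this is the same modulus as a real number, ready for
    real integrals. *)
Definition cn z : R := Re `|z|.

Lemma cnE z : cn z = Num.sqrt (Re z ^+ 2 + Im z ^+ 2).
Proof. by rewrite /cn normc_def. Qed.

Lemma cn_complex z : (cn z)%:C%C = `|z|.
Proof. by rewrite cnE normc_def. Qed.

Lemma cn_ge0 z : 0 <= cn z.
Proof. by rewrite cnE sqrtr_ge0. Qed.

Lemma cnM z w : cn (z * w) = cn z * cn w.
Proof. by apply: complexI; rewrite rmorphM/= !cn_complex normrM. Qed.

Lemma cnD z w : cn (z + w) <= cn z + cn w.
Proof. by rewrite -lecR rmorphD/= !cn_complex ler_normD. Qed.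

Lemma cnN z : cn (- z) = cn z.
Proof. by rewrite /cn normrN. Qed.

Lemma cnB z w : cn (z - w) <= cn z + cn w.
Proof. by rewrite (le_trans (cnD _ _))// cnN. Qed.

Lemma cn0 : cn 0 = 0.
Proof. by rewrite /cn normr0. Qed.

Lemma cn_eq0 z : cn z = 0 -> z = 0.
Proof. by move=> z0; apply/eqP; rewrite -normr_eq0 -cn_complex z0. Qed.

Lemma cn_real x : cn (x%:C)%C = `|x|.
Proof. by rewrite cnE/= expr0n/= addr0 sqrtr_sqr. Qed.

Lemma Re_le_cn z : `|Re z| <= cn z.
Proof.
by rewrite cnE -sqrtr_sqr ler_sqrt ?lerDl ?sqr_ge0// addr_ge0 ?sqr_ge0.
Qed.

Lemma Im_le_cn z : `|Im z| <= cn z.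
Proof.
by rewrite cnE -sqrtr_sqr ler_sqrt ?lerDr ?sqr_ge0// addr_ge0 ?sqr_ge0.
Qed.

Lemma cn_le z : cn z <= `|Re z| + `|Im z|.
Proof.
rewrite cnE -[leRHS]ger0_norm ?addr_ge0// -sqrtr_sqr ler_sqrt ?sqr_ge0//.
rewrite sqrrD -[`|Re z| ^+ 2]normrX -[`|Im z| ^+ 2]normrX.
rewrite [`|_ ^+ 2|]ger0_norm ?sqr_ge0// [`|Im z ^+ 2|]ger0_norm ?sqr_ge0//.
by rewrite -addrA lerD2l lerDr mulrn_wge0// mulr_ge0.
Qed.

Lemma cReD z w : Re (z + w) = Re z + Re w. Proof. by case: z w => ? ? []. Qed.
Lemma cImD z w : Im (z + w) = Im z + Im w. Proof. by case: z w => ? ? []. Qed.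
Lemma cReN z : Re (- z) = - Re z. Proof. by case: z. Qed.
Lemma cImN z : Im (- z) = - Im z. Proof. by case: z. Qed.
Lemma cReB z w : Re (z - w) = Re z - Re w. Proof. by rewrite cReD cReN. Qed.
Lemma cImB z w : Im (z - w) = Im z - Im w. Proof. by rewrite cImD cImN. Qed.
Lemma cReM z w : Re (z * w) = Re z * Re w - Im z * Im w.
Proof. by case: z w => ? ? []. Qed.
Lemma cImM z w : Im (z * w) = Re z * Im w + Im z * Re w.
Proof. by case: z w => ? ? []. Qed.

Lemma complexP z w : Re z = Re w -> Im z = Im w -> z = w.
Proof. by case: z w => ? ? [? ?] /= -> ->. Qed.

Lemma cReZ x z : Re (x%:C%C * z) = x * Re z.
Proof. by rewrite cReM/= mul0r subr0. Qed.
Lemma cImZ x z : Im (x%:C%C * z) = x * Im z.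
Proof. by rewrite cImM/= mul0r addr0. Qed.

Lemma cexpD z w : cexp (z + w) = cexp z * cexp w.
Proof.
by apply: complexP; rewrite ?cReM ?cImM /cexp /= !(cReD, cImD) expRD ?cosD ?sinD; ring.
Qed.

Lemma cn_cexp z : cn (cexp z) = expR (Re z).
Proof.
by rewrite cnE/= !exprMn -mulrDr cos2Dsin2 mulr1 sqrtr_sqr ger0_norm.
Qed.

Definition cis x : R[i] := cexp (0 +i* x)%C.

Lemma cisE x : cis x = (cos x +i* sin x)%C.
Proof. by rewrite /cis /cexp/= expR0 !mul1r. Qed.

Lemma cn_cis x : cn (cis x) = 1.
Proof. by rewrite cn_cexp expR0. Qed.

Lemma cisD x y : cis (x + y) = cis x * cis y.
Proof. by rewrite /cis -cexpD; congr cexp; apply: complexP => /=; rewrite ?addr0. Qed.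

Lemma cis0 : cis 0 = 1.
Proof. by rewrite cisE cos0 sin0. Qed.

Lemma cisNpi x : cis (x + pi) = - cis x.
Proof. by rewrite !cisE cosDpi sinDpi. Qed.

End ComplexModulus.

Section ComplexMeasurable.
Context {d : measure_display} {T : measurableType d} {R : realType}.
Implicit Types (D : set T) (g h : T -> R[i]).
Local Notation Re := complex.Re.
Local Notation Im := complex.Im.

Definition cmeas D g :=
  measurable_fun D (fun x => Re (g x)) /\ measurable_fun D (fun x => Im (g x)).

Lemma cmeasD D g h : cmeas D g -> cmeas D h -> cmeas D (fun x => g x + h x).
Proof.
move=> [g1 g2] [h1 h2]; split.
- by under eq_fun do rewrite cReD; exact: measurable_funD.
- by under eq_fun do rewrite cImD; exact: measurable_funD.
Qed.

Lemma cmeasN D g : cmeas D g -> cmeas D (fun x => - g x).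
Proof.
move=> [g1 g2]; split.
- by under eq_fun do rewrite cReN; exact: measurableT_comp.
- by under eq_fun do rewrite cImN; exact: measurableT_comp.
Qed.

Lemma cmeasB D g h : cmeas D g -> cmeas D h -> cmeas D (fun x => g x - h x).
Proof. by move=> mg mh; apply: cmeasD => //; exact: cmeasN. Qed.

Lemma cmeasM D g h : cmeas D g -> cmeas D h -> cmeas D (fun x => g x * h x).
Proof.
move=> [g1 g2] [h1 h2]; split.
- under eq_fun do rewrite cReM.
  by apply: measurable_funB; exact: measurable_funM.
- under eq_fun do rewrite cImM.
  by apply: measurable_funD; exact: measurable_funM.
Qed.

Lemma cmeas_cst D (z : R[i]) : cmeas D (fun=> z).
Proof. by split; exact: measurable_cst. Qed.

Lemma cmeas_real D (u : T -> R) :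
  measurable_fun D u -> cmeas D (fun x => (u x)%:C%C).
Proof. by move=> mu; split => //=; exact: measurable_cst. Qed.

Lemma cmeas_cn D g : cmeas D g -> measurable_fun D (fun x => cn (g x)).
Proof.
move=> [g1 g2]; under eq_fun do rewrite cnE.
apply: (@measurableT_comp _ _ _ _ _ _ (@Num.sqrt R)).
  by apply: continuous_measurable_fun; exact: sqrt_continuous.
by apply: measurable_funD; exact: measurable_funX.
Qed.

Lemma cmeas_cexp D g : cmeas D g -> cmeas D (fun x => cexp (g x)).
Proof.
move=> [g1 g2]; split => /=; apply: measurable_funM;
  apply: measurableT_comp => //.
- by apply: continuous_measurable_fun; exact: continuous_cos.
- by apply: continuous_measurable_fun; exact: continuous_sin.
Qed.

Lemma cmeas_cis D (u : T -> R) : measurable_fun D u -> cmeas D (fun x => cis (u x)).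
Proof.
by move=> mu; apply: cmeas_cexp; split => //=; exact: measurable_cst.
Qed.

End ComplexMeasurable.

Lemma cmeas_comp {d1 d2 : measure_display} {T1 : measurableType d1}
    {T2 : measurableType d2} {R : realType} (D : set T1) (u : T1 -> T2)
    (g : T2 -> R[i]) :
  cmeas setT g -> measurable_fun D u -> cmeas D (fun x => g (u x)).
Proof.
move=> [g1 g2] mu; split.
- exact: (measurableT_comp g1 mu).
- exact: (measurableT_comp g2 mu).
Qed.

Section ComplexIntegral.
Context {R : realType}.
Local Notation mu := (@lebesgue_measure R).
Local Notation Re := complex.Re.
Local Notation Im := complex.Im.
Local Notation TR := (measurableTypeR R).
Implicit Types (D : set TR) (g h : TR -> R[i]) (u : TR -> R).

Lemma Rintegrable_le D (u v : TR -> R) : measurable D -> measurable_fun D u ->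
  mu.-integrable D (EFin \o v) -> (forall x, D x -> `|u x| <= v x) ->
  mu.-integrable D (EFin \o u).
Proof.
move=> mD mU iv uv; apply: (le_integrable mD _ _ iv).
- exact/measurable_EFinP.
- by move=> x Dx; rewrite /= lee_fin (le_trans (uv _ Dx))// ler_norm.
Qed.

Lemma Rintegrable_support (u : TR -> R) (a b C : R) :
  measurable_fun setT u -> (forall x, `|u x| <= C) ->
  (forall x, ~~ (a <= x <= b) -> u x = 0) -> mu.-integrable setT (EFin \o u).
Proof.
move=> mU uC u0.
apply: (@Rintegrable_le _ _ (fun x => C * \1_(`[a, b]%classic) x)) => //.
- have ii : mu.-integrable setT (EFin \o (\1_(`[a, b]%classic) : TR -> R)).
    apply/integrableP; split; first exact/measurable_EFinP.
    under eq_integral do rewrite gee0_abs ?lee_fin//.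
    rewrite integral_indic// setIT.
    by have := @lebesgue_measure_itv R `[a, b]%R => /= ->; case: ifP => _; rewrite ?ltry.
  have := integrableZl measurableT C ii.
  by apply: eq_integrable => // x _ /=; rewrite EFinM.
- move=> x _; rewrite indicE.
  have [xab|xab] := boolP (a <= x <= b).
    by rewrite mem_set ?mulr1//= in_itv.
  by rewrite u0// normr0 mulr_ge0// (le_trans (normr_ge0 (u 0)))//.
Qed.

Lemma cintegrable_meas D g : cintegrable D g -> cmeas D g.
Proof.
by move=> [/measurable_int/measurable_EFinP ? /measurable_int/measurable_EFinP ?].
Qed.

Lemma cintegrable_le D g u : measurable D -> cmeas D g ->
  mu.-integrable D (EFin \o u) -> (forall x, D x -> cn (g x) <= u x) ->
  cintegrable D g.
Proof.
move=> mD [m1 m2] iu gu; split; apply: (le_integrable mD _ _ iu).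
- exact/measurable_EFinP.
- move=> x Dx; rewrite /= lee_fin (le_trans (Re_le_cn _))//.
  by rewrite (le_trans (gu _ Dx))// ler_norm.
- exact/measurable_EFinP.
- move=> x Dx; rewrite /= lee_fin (le_trans (Im_le_cn _))//.
  by rewrite (le_trans (gu _ Dx))// ler_norm.
Qed.

Lemma cintegrable_cn D g : measurable D -> cintegrable D g ->
  mu.-integrable D (EFin \o (fun x => cn (g x))).
Proof.
move=> mD ig; have mg := cintegrable_meas ig; case: ig => i1 i2.
apply: (le_integrable mD _ _ (integrableD mD (integrable_abse i1) (integrable_abse i2))) => //.
- by apply/measurable_EFinP; exact: cmeas_cn.
- move=> x Dx /=; rewrite lee_fin ger0_norm ?cn_ge0//.
  by rewrite (le_trans (cn_le _))// ler_norm.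
Qed.

Lemma cint_Re D g : Re (cint D g) = (\int[mu]_(x in D) Re (g x))%R.
Proof. by []. Qed.

Lemma cint_Im D g : Im (cint D g) = (\int[mu]_(x in D) Im (g x))%R.
Proof. by []. Qed.

Lemma eq_cint D g h : (forall x, D x -> g x = h x) -> cint D g = cint D h.
Proof.
move=> gh; apply: complexP; rewrite ?cint_Re ?cint_Im; apply: eq_Rintegral => x;
  by rewrite inE => /gh ->.
Qed.

Lemma eq_cintegrable D g h : measurable D -> (forall x, D x -> g x = h x) ->
  cintegrable D g -> cintegrable D h.
Proof.
move=> mD gh [i1 i2]; split.
- by apply: eq_integrable i1 => // x; rewrite inE => /gh ->.
- by apply: eq_integrable i2 => // x; rewrite inE => /gh ->.
Qed.

Lemma cintegrableD D g h : measurable D -> cintegrable D g -> cintegrable D h ->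
  cintegrable D (fun x => g x + h x).
Proof.
move=> mD [g1 g2] [h1 h2]; split.
- by under eq_fun do rewrite cReD EFinD; exact: integrableD.
- by under eq_fun do rewrite cImD EFinD; exact: integrableD.
Qed.

Lemma cintD D g h : measurable D -> cintegrable D g -> cintegrable D h ->
  cint D (fun x => g x + h x) = cint D g + cint D h.
Proof.
move=> mD [g1 g2] [h1 h2]; apply: complexP; rewrite ?cReD ?cImD ?cint_Re ?cint_Im.
- by rewrite -RintegralD//; apply: eq_Rintegral => x _; rewrite cReD.
- by rewrite -RintegralD//; apply: eq_Rintegral => x _; rewrite cImD.
Qed.

Lemma cintegrable_bndM D g (b : TR -> R[i]) (M : R) : measurable D ->
  cintegrable D g -> cmeas D b -> (forall x, D x -> cn (b x) <= M) ->
  cintegrable D (fun x => b x * g x).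
Proof.
move=> mD ig mb bM; apply: (@cintegrable_le _ _ (fun x => M * cn (g x))) => //.
- by apply: cmeasM => //; exact: cintegrable_meas.
- have := integrableZl mD M (cintegrable_cn mD ig).
  by apply: eq_integrable => // x _ /=; rewrite EFinM.
- by move=> x Dx; rewrite cnM ler_wpM2r ?cn_ge0// bM.
Qed.

Lemma cintegrableZ D g (c : R[i]) : measurable D -> cintegrable D g ->
  cintegrable D (fun x => c * g x).
Proof.
by move=> mD ig; apply: (@cintegrable_bndM _ _ _ (cn c)) => //; exact: cmeas_cst.
Qed.

Lemma RintegralZl_le D (u : TR -> R) (c : R) : measurable D ->
  mu.-integrable D (EFin \o u) ->
  mu.-integrable D (EFin \o (fun x => c * u x)).
Proof.
move=> mD iu; have := integrableZl mD c iu.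
by apply: eq_integrable => // x _ /=; rewrite EFinM.
Qed.

Lemma cintZ D g (c : R[i]) : measurable D -> cintegrable D g ->
  cint D (fun x => c * g x) = c * cint D g.
Proof.
move=> mD [g1 g2]; apply: complexP; rewrite ?cReM ?cImM ?cint_Re ?cint_Im.
- rewrite -!RintegralZl// -RintegralB//; try exact: RintegralZl_le.
  by apply: eq_Rintegral => x _; rewrite cReM.
- rewrite -!RintegralZl// -RintegralD//; try exact: RintegralZl_le.
  by apply: eq_Rintegral => x _; rewrite cImM.
Qed.

Lemma cintN D g : measurable D -> cintegrable D g ->
  cint D (fun x => - g x) = - cint D g.
Proof.
move=> mD ig; rewrite -mulN1r -cintZ//; apply: eq_cint => x _.
by rewrite mulN1r.
Qed.

Lemma cintegrableN D g : measurable D -> cintegrable D g ->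
  cintegrable D (fun x => - g x).
Proof.
move=> mD ig; apply: (@eq_cintegrable _ (fun x => -1 * g x)) => //.
  by move=> x _; rewrite mulN1r.
exact: cintegrableZ.
Qed.

Lemma cintegrableB D g h : measurable D -> cintegrable D g -> cintegrable D h ->
  cintegrable D (fun x => g x - h x).
Proof. by move=> mD ig ih; apply: cintegrableD => //; exact: cintegrableN. Qed.

Lemma cintB D g h : measurable D -> cintegrable D g -> cintegrable D h ->
  cint D (fun x => g x - h x) = cint D g - cint D h.
Proof.
by move=> mD ig ih; rewrite cintD ?cintN//; exact: cintegrableN.
Qed.

(* The factor 2 comes from bounding real and imaginary parts separately. *)
Lemma cn_cint_le D g u : measurable D -> cmeas D g ->
  mu.-integrable D (EFin \o u) -> (forall x, D x -> cn (g x) <= u x) ->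
  cn (cint D g) <= 2 * (\int[mu]_(x in D) u x)%R.
Proof.
move=> mD mg iu gu; have [i1 i2] := cintegrable_le mD mg iu gu.
rewrite (le_trans (cn_le _))// mulr_natl mulr2n cint_Re cint_Im lerD//.
- rewrite (le_trans (le_normr_Rintegral _ _))//; apply: le_Rintegral => //.
  + exact: (integrable_abse i1).
  + by move=> x Dx; rewrite (le_trans (Re_le_cn _))// gu.
- rewrite (le_trans (le_normr_Rintegral _ _))//; apply: le_Rintegral => //.
  + exact: (integrable_abse i2).
  + by move=> x Dx; rewrite (le_trans (Im_le_cn _))// gu.
Qed.

Lemma cint_mkcond D g :
  cint D g = cint setT (fun x => (\1_D x)%:C%C * g x).
Proof.
apply: complexP; rewrite !(cint_Re, cint_Im) Rintegral_mkcond; apply: eq_Rintegral => x _;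
  rewrite ?cReZ ?cImZ patchE indicE; case: ifPn => _; by rewrite ?mul1r ?mul0r.
Qed.

Lemma cintegrable_mkcond D g : measurable D ->
  cintegrable D g <-> cintegrable setT (fun x => (\1_D x)%:C%C * g x).
Proof.
move=> mD.
have key (v : TR -> R) : mu.-integrable D (fun x => (v x)%:E) <->
    mu.-integrable setT (fun x => (\1_D x * v x)%:E).
  have := @integrable_mkcond _ _ _ mu D (fun x => (v x)%:E) mD; move=> ->.
  suff -> : (fun x => (v x)%:E) \_ D = (fun x => (\1_D x * v x)%:E) by [].
  apply/funext => x; rewrite patchE indicE; case: ifPn => _;
    by rewrite ?mul1r ?mul0r.
have [kr rk] := key (fun x => Re (g x)); have [ki ik] := key (fun x => Im (g x)).
split=> -[i1 i2]; split.
- by under eq_fun do rewrite cReZ; exact: kr.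
- by under eq_fun do rewrite cImZ; exact: ki.
- by apply: rk; under eq_fun do rewrite -cReZ.
- by apply: ik; under eq_fun do rewrite -cImZ.
Qed.

(** Dominated convergence, run once for an abstract projection [p] and used for the real and the
    imaginary part. Both convergences are expressed through [cn], so that they are limits of real
    numbers. *)
Lemma cint_cvg D (g_ : nat -> TR -> R[i]) g u : measurable D ->
  (forall n, cmeas D (g_ n)) -> cmeas D g ->
  mu.-integrable D (EFin \o u) ->
  (forall n x, D x -> cn (g_ n x) <= u x) ->
  {ae mu, forall x, D x -> cn (g_ n x - g x) @[n --> \oo] --> (0 : R)} ->
  cn (cint D (g_ n) - cint D g) @[n --> \oo] --> (0 : R).
Proof.
move=> mD mg_ mg iu gu cv.
have aux (p : R[i] -> R) (pB : forall z w, p (z - w) = p z - p w)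
    (pn : forall z, `|p z| <= cn z)
    (mp : forall h, cmeas D h -> measurable_fun D (fun x => p (h x))) :
    mu.-integrable D (fun x => (p (g x))%:E) /\
    (\int[mu]_(x in D) p (g_ n x))%R @[n --> \oo] -->
    (\int[mu]_(x in D) p (g x))%R.
  have [] := @dominated_convergence _ _ _ mu D mD
    (fun n x => (p (g_ n x))%:E) (fun x => (p (g x))%:E) (EFin \o u).
  - by move=> n; apply/measurable_EFinP; exact: mp.
  - by apply/measurable_EFinP; exact: mp.
  - apply: filterS cv => x cv Dx; apply/fine_cvgP; split; first by apply: nearW.
    rewrite /comp /=; apply/subr_cvg0.
    apply: (norm_le_cvg0 _ (cv Dx)) => n; rewrite -pB; exact: pn.
  - exact: iu.
  - by apply: aeW => x n Dx /=; rewrite lee_fin (le_trans (pn _))// gu.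
  - move=> ig _ cvi; split => //.
    apply: fine_cvg; rewrite /Rintegral fineK; first exact: cvi.
    exact: integrable_fin_num.
have [i1 c1] := aux (@complex.Re R) (@cReB R) (@Re_le_cn R) (fun h mh => mh.1).
have [i2 c2] := aux (@complex.Im R) (@cImB R) (@Im_le_cn R) (fun h mh => mh.2).
apply: (@norm_le_cvg0 _ _ _ _
  (fun n => `|(\int[mu]_(x in D) Re (g_ n x))%R - (\int[mu]_(x in D) Re (g x))%R|
    + `|(\int[mu]_(x in D) Im (g_ n x))%R - (\int[mu]_(x in D) Im (g x))%R|)).
- move=> n; rewrite [leLHS]ger0_norm ?cn_ge0//.
  have := cn_le (cint D (g_ n) - cint D g); rewrite cReB cImB !cint_Re !cint_Im.
  exact.
- rewrite -[X in _ --> X]addr0; apply: cvgD.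
  + by move/subr_cvg0 : c1 => /cvg_norm; rewrite normr0.
  + by move/subr_cvg0 : c2 => /cvg_norm; rewrite normr0.
Qed.

Lemma integral_itv_indic (a b : R) : a <= b ->
  mu.-integrable setT (EFin \o (fun s : TR => \1_(`[a, b]%classic : set R) s : R)) /\
  (\int[mu]_(x in setT) \1_(`[a, b]%classic : set R) x)%R = b - a.
Proof.
move=> ab; split.
  apply: (@Rintegrable_support _ a b 1).
  - by apply: measurable_indic; exact: measurable_itv.
  - by move=> x; rewrite indicE; case: (_ \in _); rewrite ?normr1 ?normr0.
  - by move=> x nx; rewrite indicE memNset// /= in_itv/=; exact/negP.
rewrite /Rintegral integral_indic; [|exact: measurableT|exact: measurable_itv].
rewrite setIT.
have muE : mu `[a, b]%classic = (b - a)%:E.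
  rewrite (@lebesgue_measure_itv R `[a, b]%R)/= lte_fin; case: ltP => // ba.
  by rewrite (@le_anti _ _ a b) ?ab// subrr.
exact: (congr1 fine muE).
Qed.

Lemma cn_cint_box (g : TR -> R[i]) (a b C : R) : a <= b -> cmeas setT g ->
  (forall x, a <= x <= b -> cn (g x) <= C) -> (forall x, ~~ (a <= x <= b) -> g x = 0) ->
  cn (cint setT g) <= 2 * (C * (b - a)).
Proof.
move=> ab mg gC g0; have [ii iE] := integral_itv_indic ab.
apply: (le_trans (@cn_cint_le setT _ (fun s => C * \1_(`[a, b]%classic : set R) s) _ _ _ _)) => //.
- exact: RintegralZl_le.
- move=> x _; rewrite indicE; have [h|h] := boolP (a <= x <= b).
    by rewrite mem_set ?mulr1 ?gC//= in_itv.
  by rewrite memNset ?g0 ?cn0 ?mulr0//= in_itv/=; exact/negP.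
- by rewrite RintegralZl// iE.
Qed.

End ComplexIntegral.

(** * Fubini and affine substitution *)

Section Fubini.
Context {R : realType}.
Local Notation mu := (@lebesgue_measure R).
Local Notation TR := (measurableTypeR R).

(** A majorant in product form makes joint integrability immediate by Tonelli; each double integral
    of the proof has one. *)
Lemma Rfubini_prod (f : TR * TR -> R) (U V : TR -> R) :
  measurable_fun setT f ->
  mu.-integrable setT (EFin \o U) -> mu.-integrable setT (EFin \o V) ->
  (forall x y, `|f (x, y)| <= U x * V y) ->
  (\int[mu]_x (\int[mu]_y f (x, y)) = \int[mu]_y (\int[mu]_x f (x, y)))%R.
Proof.
move=> mf iU iV fUV.
have fUV' x y : `|f (x, y)| <= `|U x| * `|V y|.
  by rewrite (le_trans (fUV x y))// -normrM ler_norm.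
have i1 x : mu.-integrable setT (fun y => (f (x, y))%:E).
  apply: (le_integrable _ _ _ (integrableZl _ (U x) iV)) => //.
    by apply/measurable_EFinP; apply: measurableT_comp => //; exact: measurable_pair1.
  by move=> y _; rewrite /= lee_fin normrM fUV'.
have i2 y : mu.-integrable setT (fun x => (f (x, y))%:E).
  apply: (le_integrable _ _ _ (integrableZl _ (V y) iU)) => //.
    by apply/measurable_EFinP; apply: measurableT_comp => //; exact: measurable_pair2.
  by move=> x _; rewrite /= lee_fin normrM mulrC fUV'.
have mV : measurable_fun setT V by case/integrableP: iV => /measurable_EFinP.
have mU : measurable_fun setT U by case/integrableP: iU => /measurable_EFinP.
have ip : (mu \x mu)%E.-integrable setT (EFin \o f).
  apply/integrable12ltyP; first exact/measurable_EFinP.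
  apply: (@le_lt_trans _ _ (\int[mu]_x (`|U x|%:E * \int[mu]_y `|V y|%:E))%E).
    apply: ge0_le_integral => //.
    - by move=> x _; apply: integral_ge0.
    - apply: (measurable_fun_fubini_tonelli_F (abse \o (EFin \o f))) => //=.
      by apply/measurable_EFinP; exact: measurableT_comp.
    - apply: emeasurable_funM; last exact: measurable_cst.
      by apply/measurable_EFinP; exact: measurableT_comp.
    - move=> x _; rewrite -ge0_integralZl//; last first.
        by apply/measurable_EFinP; exact: measurableT_comp.
      apply: ge0_le_integral => //.
      + apply/measurable_EFinP; apply: measurableT_comp => //.
        by apply: measurableT_comp => //; exact: measurable_pair1.
      + by apply/measurable_EFinP; apply: measurable_funM => //;
          exact: measurableT_comp.
      + by move=> y _; rewrite /= lee_fin fUV'.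
  have := integrable_fin_num _ (integrable_abse iV) => /= /(_ measurableT) fV.
  under eq_integral do rewrite -(fineK fV) muleC.
  rewrite ge0_integralZl//; last 2 first.
  - by apply/measurable_EFinP; exact: measurableT_comp.
  - by rewrite lee_fin fine_ge0// integral_ge0.
  have := integrable_fin_num _ (integrable_abse iU) => /= /(_ measurableT) fU.
  by rewrite -(fineK fU) -EFinM ltry.
have := Fubini ip; rewrite /Rintegral.
move=> H; congr fine; transitivity (\int[mu]_x \int[mu]_y (f (x, y))%:E)%E.
  by apply: eq_integral => x _; rewrite fineK// integrable_fin_num.
rewrite [LHS]H; apply: eq_integral => x _; rewrite fineK//.
exact: integrable_fin_num.
Qed.

Lemma cfubini_prod (k : TR * TR -> R[i]) (U V : TR -> R) :
  cmeas setT k ->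
  mu.-integrable setT (EFin \o U) -> mu.-integrable setT (EFin \o V) ->
  (forall x y, cn (k (x, y)) <= U x * V y) ->
  cint setT (fun x => cint setT (fun y => k (x, y))) =
  cint setT (fun y => cint setT (fun x => k (x, y))).
Proof.
move=> [m1 m2] iU iV kUV; apply: complexP.
- apply: (Rfubini_prod m1 iU iV) => x y.
  exact: le_trans (Re_le_cn _) (kUV x y).
- apply: (Rfubini_prod m2 iU iV) => x y.
  exact: le_trans (Im_le_cn _) (kUV x y).
Qed.

End Fubini.

Section Affine.
Context {R : realType}.
Local Notation mu := (@lebesgue_measure R).
Local Notation TR := (measurableTypeR R).
Context (a b : R) (a0 : a != 0).
Let A : TR -> TR := fun x => a * x + b.

Lemma measurable_affine : measurable_fun setT A.
Proof.
by apply: measurable_funD => //; apply: measurable_funM => //; exact: measurable_cst.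
Qed.

Let mA_mixin := isMeasurableFun.Build _ _ _ _ A measurable_affine.
Let Ap : {mfun TR >-> TR} := HB.pack A mA_mixin.
Let nna : {nonneg R} := NngNum (normr_ge0 a).

(** Uniqueness of Lebesgue measure: the scaled pushforward gives intervals []c, e]] their length.
    For [a < 0] the preimage is closed on the left instead, which leaves the length unchanged. *)
Lemma lebesgue_measure_affine (D : set TR) : measurable D ->
  mu D = (`|a|%:E * mu (A @^-1` D))%E.
Proof.
move=> mD.
suff H : mu D = mscale nna (pushforward mu Ap) D by rewrite (H measurable_affine).
move=> m; apply: lebesgue_measure_unique => // _ [[c e] _ <-] /=.
rewrite /mscale/= /pushforward/=.
have [ce|ec] := ltP c e; last first.
  have -> : `]c, e]%classic = set0 :> set R by rewrite set_itv_ge// -leNgt bnd_simp.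
  by rewrite preimage_set0 !measure0 mule0.
have : a != 0 by []; case: ltgtP => // [an|ap] _.
- have -> : A @^-1` `]c, e] = `[(e - b) / a, (c - b) / a[%classic.
    apply/seteqP; split => x; rewrite /A /= !in_itv/= => /andP[h1 h2];
     apply/andP; split.
    - by rewrite ler_ndivrMr// lerBrDr mulrC.
    - by rewrite ltr_ndivlMr// ltrBlDr mulrC.
    - by move: h2; rewrite ltr_ndivlMr// ltrBlDr mulrC.
    - by move: h1; rewrite ler_ndivrMr// lerBrDr mulrC.
  rewrite !lebesgue_measure_itv/= !lte_fin ce ltr_nM2r ?invr_lt0// ltrD2r ce.
  by rewrite -!EFinB -EFinM ltr0_norm//; congr EFin; field; rewrite lt_eqF.
- have -> : A @^-1` `]c, e] = `](c - b) / a, (e - b) / a]%classic.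
    apply/seteqP; split => x; rewrite /A /= !in_itv/= => /andP[h1 h2];
     apply/andP; split.
    - by rewrite ltr_pdivrMr// ltrBlDr mulrC.
    - by rewrite ler_pdivlMr// lerBrDr mulrC.
    - by move: h1; rewrite ltr_pdivrMr// ltrBlDr mulrC.
    - by move: h2; rewrite ler_pdivlMr// lerBrDr mulrC.
  rewrite !lebesgue_measure_itv/= !lte_fin ce ltr_pM2r ?invr_gt0// ltrD2r ce.
  by rewrite -!EFinB -EFinM gtr0_norm//; congr EFin; field.
Qed.

Lemma ge0_integral_affine (f : TR -> \bar R) : measurable_fun setT f ->
  (forall x, 0 <= f x)%E ->
  (\int[mu]_x f x = `|a|%:E * \int[mu]_x f (a * x + b)%R)%E.
Proof.
move=> mf f0.
rewrite (eq_measure_integral (mscale nna (pushforward mu Ap))); last first.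
  by move=> D mD _; exact: (lebesgue_measure_affine mD).
rewrite ge0_integral_mscale//.
by rewrite ge0_integral_pushforward//; exact: measurable_affine.
Qed.

Lemma integrable_affine (f : TR -> \bar R) : mu.-integrable setT f ->
  mu.-integrable setT (fun x => f (a * x + b)%R).
Proof.
move=> /integrableP[mf fi]; apply/integrableP; split.
  by apply: (measurableT_comp mf); exact: measurable_affine.
move: fi; rewrite (ge0_integral_affine (f := abse \o f)); last 2 first.
- exact: measurableT_comp.
- by move=> x; exact: abse_ge0.
rewrite !ltey; apply: contra => /eqP -> /=.
by rewrite gt0_muley// lte_fin normr_gt0.
Qed.

Lemma Rintegral_affine (f : TR -> R) : mu.-integrable setT (EFin \o f) ->
  (\int[mu]_x f (a * x + b) = `|a|^-1 * \int[mu]_x f x)%R.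
Proof.
move=> fi; have ai := integrable_affine fi.
have mf : measurable_fun setT (EFin \o f) by case/integrableP : fi.
apply: (mulfI (x := `|a|)); first by rewrite normr_eq0.
rewrite mulrA divff ?normr_eq0// mul1r -RintegralZl//; rewrite /Rintegral.
congr fine.
under [LHS]eq_integral do rewrite EFinM.
rewrite integralZl//.
rewrite [in RHS]integralE [in LHS]integralE.
rewrite (ge0_integral_affine (f := (EFin \o f)^\+%E))//; last exact: measurable_funepos.
rewrite (ge0_integral_affine (f := (EFin \o f)^\-%E))//; last exact: measurable_funeneg.
have h := integrable_pos_fin_num measurableT ai.
have -> : (\int[mu]_x (EFin \o f)^\+%E (a * x + b)%R =
    \int[mu]_x (fun x : TR => (f (a * x + b))%:E)^\+%E x)%E.
  by apply: eq_integral => x _; rewrite !funeposE.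
have -> : (\int[mu]_x (EFin \o f)^\-%E (a * x + b)%R =
    \int[mu]_x (fun x : TR => (f (a * x + b))%:E)^\-%E x)%E.
  by apply: eq_integral => x _; rewrite !funenegE.
rewrite muleBr//; apply: fin_num_adde_defr; exact: h.
Qed.

Lemma cintegrable_affine (g : TR -> R[i]) : cintegrable setT g ->
  cintegrable setT (fun x => g (a * x + b)).
Proof.
by move=> [i1 i2]; split; [exact: (integrable_affine i1)|exact: (integrable_affine i2)].
Qed.

Lemma cint_affine (g : TR -> R[i]) : cintegrable setT g ->
  cint setT (fun x => g (a * x + b)) = (`|a|^-1)%:C%C * cint setT g.
Proof.
move=> [i1 i2]; apply: complexP; rewrite ?cReZ ?cImZ ?cint_Re ?cint_Im.
- exact: (Rintegral_affine i1).
- exact: (Rintegral_affine i2).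
Qed.

End Affine.

Lemma measurable_eq_affine {R : realType} (a b : R)
    (f : measurableTypeR R -> measurableTypeR R) :
  (forall x, f x = a * x + b) -> measurable_fun setT f.
Proof. by move=> fE; rewrite (_ : f = fun x => a * x + b); [exact: measurable_affine|exact/funext]. Qed.

(** * Norming functionals *)

Section Sublinear.
Context {R : realType} {X : lmodType R[i]}.
Local Notation "t %:C" := (t%:C)%C.
Implicit Types (q p : X -> R) (x y : X) (t s : R).

Record sublinear q : Prop := Sublinear {
  subl_add : forall x y, q (x + y) <= q x + q y ;
  subl_hom : forall t x, 0 <= t -> q (t%:C *: x) = t * q x }.

Lemma subl0 q : sublinear q -> q 0 = 0.
Proof. by move=> [_ h]; rewrite -(scale0r 0) -[0 in LHS]/(0%:C) h// mul0r. Qed.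

Lemma sublN q x : sublinear q -> - q (- x) <= q x.
Proof.
move=> sq; rewrite lerNl -subr_ge0 opprK.
by rewrite (le_trans _ (subl_add sq _ _))// addNr (subl0 sq).
Qed.

(* The largest sublinear functional below [q] whose value at [- y] is [- q y]
   or less. *)
Definition shave q y x : R :=
  inf [set r | exists2 t, 0 <= t & r = q (x + t%:C *: y) - t * q y].

(** Subadditivity for [t y = (x + t y) - x]. It makes the infimum in [shave] finite. *)
Lemma shave_lb q y x t : sublinear q -> 0 <= t ->
  - q (- x) <= q (x + t%:C *: y) - t * q y.
Proof.
move=> sq t0; rewrite lerBrDr addrC lerBlDr -(subl_hom sq)//.
apply: le_trans (subl_add sq _ _).
by rewrite addrAC subrr add0r.
Qed.

Lemma shave_le q y x t : sublinear q -> 0 <= t ->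
  shave q y x <= q (x + t%:C *: y) - t * q y.
Proof.
move=> sq t0; apply: ge_inf; last by exists t.
by exists (- q (- x)) => _ [s s0 ->]; exact: shave_lb.
Qed.

Lemma shave_ge q y x r : sublinear q ->
  (forall t, 0 <= t -> r <= q (x + t%:C *: y) - t * q y) -> r <= shave q y x.
Proof.
move=> sq h; apply: lb_le_inf; last by move=> _ [t t0 ->]; exact: h.
by exists (q (x + 0%:C *: y) - 0 * q y), 0.
Qed.

Lemma shave_le_self q y x : sublinear q -> shave q y x <= q x.
Proof.
move=> sq; have := shave_le y x sq (lexx 0).
by rewrite mul0r subr0 -[0%:C]/(0 : R[i]) scale0r addr0.
Qed.

Lemma shaveN q y : sublinear q -> shave q y (- y) <= - q y.
Proof.
move=> sq; have := shave_le y (- y) sq ler01.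
by rewrite mul1r -[1%:C]/(1 : R[i]) scale1r addNr (subl0 sq) sub0r.
Qed.

Lemma sublinear_shave q y : sublinear q -> sublinear (shave q y).
Proof.
move=> sq; have add u v : shave q y (u + v) <= shave q y u + shave q y v.
  rewrite -lerBlDr; apply: shave_ge => // t t0.
  rewrite lerBlDl -lerBlDr; apply: shave_ge => // s s0.
  rewrite lerBlDr; apply: (le_trans (shave_le _ _ sq (addr_ge0 t0 s0))).
  have : u + v + (t + s)%:C *: y = (u + t%:C *: y) + (v + s%:C *: y).
    by rewrite rmorphD/= scalerDl addrACA.
  move=> ->; have := subl_add sq (u + t%:C *: y) (v + s%:C *: y).
  by lra.
split => // t x; rewrite le_eqVlt => /predU1P[<-|t0].
  rewrite mul0r -[0%:C]/(0 : R[i]) scale0r; apply/le_anti/andP; split.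
    by rewrite (le_trans (shave_le_self _ _ sq))// (subl0 sq).
  apply: shave_ge => // s s0; have := shave_lb y 0 sq s0.
  by rewrite oppr0 (subl0 sq) oppr0.
(* One inequality suffices for homogeneity: the reverse one is the same with [s^-1] applied to
   [s z]. *)
have half s z : 0 < s -> s * shave q y z <= shave q y (s%:C *: z).
  move=> s0; apply: shave_ge => // r r0.
  rewrite -ler_pdivlMl//; apply: le_trans (shave_le y z sq (_ : 0 <= s^-1 * r)) _.
    by rewrite mulr_ge0// invr_ge0 ltW.
  have -> : s%:C *: z + r%:C *: y = s%:C *: (z + (s^-1 * r)%:C *: y).
    by rewrite scalerDr scalerA -rmorphM/= mulrA divff ?gt_eqF// mul1r.
  by rewrite (subl_hom sq _ (ltW s0)) mulrBr !mulrA mulVf ?gt_eqF// mul1r.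
apply/le_anti/andP; split; last exact: half.
rewrite -ler_pdivrMl//; have := half t^-1 (t%:C *: x); rewrite invr_gt0 => /(_ t0).
by rewrite scalerA -rmorphM/= mulVf ?gt_eqF// scale1r.
Qed.

Record below p := Below { below_fun : X -> R;
  below_subl : sublinear below_fun; below_le : forall x, below_fun x <= p x }.

(** Zorn's lemma for the reversed pointwise order on the sublinear functionals below [p]. A chain is
    bounded by its pointwise infimum, which is finite because each member at [x] is at least
    [- p (- x)]. *)
Lemma minimal_sublinear p : sublinear p ->
  exists q, [/\ sublinear q, forall x, q x <= p x &
    forall q', sublinear q' -> (forall x, q' x <= q x) -> q' = q].
Proof.
move=> sp.
pose r (a b : below p) := `[< forall x, below_fun b x <= below_fun a x >].
have [||A totA|[q sq qp] mq] := @ZL_preorder (below p) (Below sp (fun=> lexx _)) r.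
- by move=> a; apply/asboolP.
- move=> a b c /asboolP ba /asboolP ac; apply/asboolP => x.
  exact: le_trans (ac x) (ba x).
- have [[a0 Aa0]|A0] := pselect (A !=set0); last first.
    by exists (Below sp (fun=> lexx _)) => s As; exfalso; apply: A0; exists s.
  pose E x := [set below_fun a x | a in A].
  have lbE x a : A a -> - p (- x) <= below_fun a x.
    move=> Aa; apply: le_trans (sublN x (below_subl a)).
    by rewrite lerN2 below_le.
  have infle x a : A a -> inf (E x) <= below_fun a x.
    move=> Aa; apply: ge_inf; last by exists a.
    by exists (- p (- x)) => _ [b Ab <-]; exact: (lbE).
  have leinf x c : (forall a, A a -> c <= below_fun a x) -> c <= inf (E x).
    move=> h; apply: lb_le_inf; last by move=> _ [b Ab <-]; exact: h.
    by exists (below_fun a0 x), a0.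
  have sm : sublinear (fun x => inf (E x)).
    split=> [x y|t x t0].
    + rewrite -lerBlDr; apply: (leinf) => a Aa.
      rewrite lerBlDl -lerBlDr; apply: (leinf) => b Ab; rewrite lerBlDr.
      (* Subadditivity of the infimum: the smaller of the two chain members serves at both
         points. *)
      have /orP[/asboolP ab|/asboolP ba] : r a b || r b a.
        by case: (totA _ _ Aa Ab) => ->; rewrite ?orbT.
      * apply: le_trans (infle _ _ Ab) _.
        apply: le_trans (subl_add (below_subl b) _ _) _.
        by have := ab x; lra.
      * apply: le_trans (infle _ _ Aa) _.
        apply: le_trans (subl_add (below_subl a) _ _) _.
        by have := ba y; lra.
    + move: t0; rewrite le_eqVlt => /predU1P[<-|t0].
        rewrite mul0r -[0%:C]/(0 : R[i]) scale0r; apply/le_anti/andP; split.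
          by apply: le_trans (infle _ _ Aa0) _; rewrite (subl0 (below_subl a0)).
        by apply: (leinf) => a Aa; rewrite (subl0 (below_subl a)).
      apply/le_anti/andP; split.
        rewrite -ler_pdivrMl//; apply: (leinf) => a Aa; rewrite ler_pdivrMl//.
        rewrite -(subl_hom (below_subl a) _ (ltW t0)); exact: (infle).
      apply: (leinf) => a Aa; rewrite (subl_hom (below_subl a) _ (ltW t0)).
      by rewrite ler_pM2l//; exact: (infle).
  have mp x : inf (E x) <= p x by apply: le_trans (infle _ _ Aa0) (below_le _ _).
  by exists (Below sm mp) => s As; apply/asboolP => x /=; exact: (infle).
exists q; split => // q' sq' q'q.
have q'p x : q' x <= p x := le_trans (q'q x) (qp x).
have /mq/asboolP /= : r (Below sq qp) (Below sq' q'p) by apply/asboolP.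
by move=> qq'; apply/funext => x; apply/le_anti; rewrite q'q qq'.
Qed.

(* A minimal sublinear functional coincides with each of its shavings, which
   forces additivity. *)
Lemma hahn_banach p v : sublinear p ->
  exists l : X -> R, [/\ forall x y, l (x + y) = l x + l y,
    forall t x, l (t%:C *: x) = t * l x, forall x, l x <= p x & p v <= l v].
Proof.
(* Minimising below [shave p v] instead of [p] forces [q (- v) <= - p v], that is [p v <= q v] once
   [q] is odd. *)
move=> sp; have [q [sq qp mq]] := minimal_sublinear (sublinear_shave v sp).
have shq y : shave q y = q.
  by apply: mq; [exact: sublinear_shave|move=> x; exact: shave_le_self].
have qD x y : q (x + y) = q x + q y.
  apply/le_anti; rewrite (subl_add sq)/= -lerBrDr -[in leLHS](shq y).
  have := shave_le y x sq ler01.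
  by rewrite mul1r -[1%:C]/(1 : R[i]) scale1r.
have qN x : q (- x) = - q x.
  by apply/eqP; rewrite -addr_eq0 -qD addNr (subl0 sq).
exists q; split => //.
- move=> t x; have [t0|t0] := leP 0 t; first exact: subl_hom.
  rewrite -[t]opprK rmorphN/= scaleNr qN (subl_hom sq) ?oppr_ge0 ?ltW//.
  by ring.
- by move=> x; rewrite (le_trans (qp x))// shave_le_self.
- by rewrite -lerN2 -qN (le_trans (qp _))// shaveN.
Qed.

End Sublinear.

Section Functionals.
Context {R : realType} {X : completeNormedModType R[i]}.
Local Notation "t %:C" := (t%:C)%C.
Implicit Types (x y : X) (z : R[i]).

Lemma nrm_complex x : (nrm x)%:C = `|x|.
Proof. by rewrite /nrm RRe_real// ger0_real. Qed.

Lemma nrm_ge0 x : 0 <= nrm x.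
Proof. by rewrite -lecR nrm_complex normr_ge0. Qed.

Lemma nrmD x y : nrm (x + y) <= nrm x + nrm y.
Proof. by rewrite -lecR rmorphD/= !nrm_complex ler_normD. Qed.

Lemma nrmZ z x : nrm (z *: x) = cn z * nrm x.
Proof. by apply: complexI; rewrite rmorphM/= !nrm_complex cn_complex normrZ. Qed.

Lemma nrmN x : nrm (- x) = nrm x.
Proof. by rewrite /nrm normrN. Qed.

Lemma nrmB x y : nrm (x - y) <= nrm x + nrm y.
Proof. by rewrite (le_trans (nrmD _ _))// nrmN. Qed.

Lemma nrm_distC x y : nrm (x - y) = nrm (y - x).
Proof. by rewrite -nrmN opprB. Qed.

Lemma nrm_triangle x y t : nrm (x - t) <= nrm (x - y) + nrm (y - t).
Proof. by have := nrmD (x - y) (y - t); rewrite addrA subrK. Qed.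

Lemma nrm0 : nrm (0 : X) = 0.
Proof. by rewrite /nrm normr0. Qed.

Lemma nrm_eq0 x : nrm x = 0 -> x = 0.
Proof. by move=> x0; apply/eqP; rewrite -normr_eq0 -nrm_complex x0. Qed.

(* The constant 2 leaves room for the crude bound [|Re| + |Im|] on the
   complexification of a real functional. *)
Record functional (L : X -> R[i]) : Prop := Functional {
  funD : forall x y, L (x + y) = L x + L y ;
  funZ : forall z x, L (z *: x) = z * L x ;
  fun_bound : forall x, cn (L x) <= 2 * nrm x }.

Lemma fun0 L : functional L -> L 0 = 0.
Proof. by move=> fL; rewrite -(scale0r 0) (funZ fL) mul0r. Qed.

Lemma funN L x : functional L -> L (- x) = - L x.
Proof. by move=> fL; rewrite -scaleN1r (funZ fL) mulN1r. Qed.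

Lemma funB L x y : functional L -> L (x - y) = L x - L y.
Proof. by move=> fL; rewrite (funD fL) (funN _ fL). Qed.

Lemma fun_sum L n (F : 'I_n -> X) : functional L ->
  L (\sum_(i < n) F i) = \sum_(i < n) L (F i).
Proof.
move=> fL; elim/big_ind2 : _ => //; first exact: fun0.
by move=> x1 x2 y1 y2 <- <-; rewrite (funD fL).
Qed.

(* The complexification [l x - i l (i x)] of a real functional [l]. *)
Lemma norming_functional v : exists L, functional L /\ nrm v <= complex.Re (L v).
Proof.
have sn : sublinear (nrm : X -> R).
  by split=> [x y|t x t0]; rewrite ?nrmD// nrmZ cn_real ger0_norm.
have [l [lD lZ ln vl]] := hahn_banach v sn.
have lN x : l (- x) = - l x.
  by rewrite -mulN1r -lZ rmorphN/= scaleN1r.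
have labs x : `|l x| <= nrm x.
  by rewrite ler_norml ln andbT lerNl -lN (le_trans (ln _))// nrmN.
pose L x : R[i] := (l x -i* l ('i%C *: x))%C.
exists L; split; last exact: vl.
split.
- by move=> x y; rewrite /L scalerDr !lD opprD.
- move=> [a b] x.
  have e y : (a +i* b)%C *: y = a%:C *: y + b%:C *: ('i%C *: y).
    by rewrite scalerA -scalerDl; congr (_ *: _); apply: complexP => /=; ring.
  have ii y : 'i%C *: ('i%C *: y) = - y :> X.
    by rewrite scalerA -expr2 sqr_i scaleN1r.
  rewrite /L scalerA [_ * (_ +i* _)%C]mulrC -scalerA !e !lD !lZ ii lN.
  by apply: complexP => /=; ring.
- move=> x; rewrite (le_trans (cn_le _))//= normrN mulr_natl mulr2n lerD//.
  rewrite (le_trans (labs _))// nrmZ cnE/= expr0n/= add0r expr1n sqrtr1.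
  by rewrite mul1r.
Qed.

(** The norming functional satisfies [nrm x <= Re (L x)] exactly, so the constant 2 in [functional]
    is not lost here. *)
Lemma nrm_le_functional x (c : R) :
  (forall L, functional L -> cn (L x) <= c) -> nrm x <= c.
Proof.
move=> h; have [L [fL hL]] := norming_functional x.
rewrite (le_trans hL)// (le_trans (ler_norm _))//.
by rewrite (le_trans (Re_le_cn _))// h.
Qed.

Lemma cvg_nrmP {T : Type} (G : set_system T) {FG : Filter G} (u : T -> X) l :
  u @ G --> l <-> nrm (u t - l) @[t --> G] --> (0 : R).
Proof.
split.
- move=> /cvgrPdist_lt ul; apply/cvgr0Pnorm_lt => e e0.
  have : 0 < e%:C by rewrite ltcR.
  move=> /ul; apply: filterS => t /=; rewrite -nrm_complex ltcR nrm_distC.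
  by rewrite ger0_norm// nrm_ge0.
- move=> /cvgr0Pnorm_lt ul; apply/cvgrPdist_lt => e e0.
  have ee : (complex.Re e)%:C = e by rewrite RRe_real// gtr0_real.
  have : 0 < complex.Re e by rewrite -ltcR ee.
  move=> /ul; apply: filterS => t; rewrite -nrm_complex -ee ltcR nrm_distC.
  by rewrite ger0_norm// nrm_ge0.
Qed.

Lemma cvg_functional {T : Type} (G : set_system T) {FG : Filter G}
    (u : T -> X) l L : functional L -> u @ G --> l ->
  cn (L (u t) - L l) @[t --> G] --> (0 : R).
Proof.
move=> fL /cvg_nrmP ul.
apply: (@norm_le_cvg0 _ _ _ _ (fun t => 2 * nrm (u t - l))).
  by move=> t; rewrite ger0_norm ?cn_ge0// -(funB _ _ fL) (fun_bound fL).
by rewrite -[X in _ --> X](mulr0 (2 : R)); apply: cvgM => //; exact: cvg_cst.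
Qed.

End Functionals.

(** * Bochner integrals *)

Section AeIntegral.
Context {R : realType}.
Local Notation mu := (@lebesgue_measure R).
Local Notation TR := (measurableTypeR R).
Local Notation Re := complex.Re.
Local Notation Im := complex.Im.
Implicit Types (D : set TR).

Lemma cint_ae_le D (g : TR -> R[i]) (h : TR -> R) (e : R) : measurable D ->
  cmeas D g -> measurable_fun D h -> (forall x, 0 <= h x) ->
  {ae mu, forall x, D x -> cn (g x) <= h x} ->
  (\int[mu]_(x in D) (h x)%:E <= e%:E)%E ->
  cintegrable D g /\ cn (cint D g) <= 2 * e.
Proof.
move=> mD [m1 m2] mh h0 gh he.
have aux (p : R[i] -> R) (pn : forall z, `|p z| <= cn z) :
    measurable_fun D (fun x => p (g x)) ->
    mu.-integrable D (fun x => (p (g x))%:E) /\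
    `|(\int[mu]_(x in D) p (g x))%R| <= e.
  move=> mp.
  have le : (\int[mu]_(x in D) `|(p (g x))%:E| <= e%:E)%E.
    apply: le_trans he; apply: ae_ge0_le_integral => //.
    - by apply/measurable_EFinP; exact: measurableT_comp.
    - by move=> x _; rewrite lee_fin.
    - exact/measurable_EFinP.
    - apply: filterS gh => x gh Dx; rewrite lee_fin.
      exact: le_trans (pn _) (gh Dx).
  have ip : mu.-integrable D (fun x => (p (g x))%:E).
    apply/integrableP; split; first exact/measurable_EFinP.
    by apply: le_lt_trans le _; exact: ltry.
  split=> //; rewrite -lee_fin (le_trans _ le)//.
  rewrite EFin_normr_Rintegral//; apply: le_abse_integral => //.
  exact/measurable_EFinP.
have [i1 l1] := aux (@complex.Re R) (@Re_le_cn R) m1.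
have [i2 l2] := aux (@complex.Im R) (@Im_le_cn R) m2.
split; first by split.
by rewrite (le_trans (cn_le _))// mulr_natl mulr2n lerD.
Qed.

(** The majorants in [is_bochner_integral] dominate norms only almost everywhere; this allows
    replacing them by their absolute values. *)
Lemma integral_abs_ae D (h : TR -> R) : measurable D -> measurable_fun D h ->
  {ae mu, forall x, D x -> 0 <= h x} ->
  (\int[mu]_(x in D) (`|h x|)%:E = \int[mu]_(x in D) (h x)%:E)%E.
Proof.
move=> mD mh h0; apply: ae_eq_integral => //.
- by apply/measurable_EFinP; exact: measurableT_comp.
- exact/measurable_EFinP.
- by apply: filterS h0 => x h0 Dx; rewrite ger0_norm// h0.
Qed.

Lemma cint_indic D (A : set TR) (c : R[i]) : measurable D -> measurable A ->
  A `<=` D -> (mu A < +oo)%E ->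
  cintegrable D (fun x => (x \in A)%:R * c) /\
  cint D (fun x => (x \in A)%:R * c) = ((fine (mu A))%:C)%C * c.
Proof.
move=> mD mA AD Afin.
have ii : cintegrable D (fun x => (\1_A x)%:C%C).
  split => /=.
  - apply/integrableP; split; first exact/measurable_EFinP.
    under eq_integral do rewrite gee0_abs ?lee_fin//.
    by rewrite integral_indic// setIidl.
  - exact: integrable0.
have e x : (x \in A)%:R * c = c * (\1_A x)%:C%C :> R[i].
  by rewrite indicE mulrC rmorph_nat.
split.
  under eq_fun do rewrite e; exact: cintegrableZ.
under eq_cint do rewrite e.
rewrite cintZ// mulrC; congr (_ * _); apply: complexP.
- by rewrite cint_Re /= /Rintegral integral_indic// setIidl.
- by rewrite cint_Im /= /Rintegral integral0.
Qed.

End AeIntegral.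

Section HeineCantor.
Context {R : realType}.

(** The pseudodistance [dst] stands for the distance between values of a function, vector-valued or
    real. Only [x] is confined to [[a, b]]: in the Riemann-Lebesgue argument the shifted point may
    leave the interval. *)
Lemma heine_cantor (dst : R -> R -> R) (a b e : R) :
  (forall x y, dst x y = dst y x) ->
  (forall x y z, dst x z <= dst x y + dst y z) ->
  (forall x e, 0 < e -> \forall y \near x, dst x y < e) ->
  0 < e -> exists2 d : R, 0 < d &
    forall x y, a <= x <= b -> `|x - y| < d -> dst x y < e.
Proof.
move=> sym tri cont e0.
have /compact_near_coveringP cov := @segment_compact R a b.
pose P (d : R) (x : R) := forall y, `|x - y| < d -> dst x y < e.
have : \forall d \near (0 : R)^'+, `[a, b] `<=` P d.
  apply: cov => x _.
  have := cont x (e / 2) (divr_gt0 e0 (ltr0Sn _ _)).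
  move=> /nbhs_ballP[d /= d0 hd].
  exists (ball x (d / 2), [set r | r < d / 2]) => /=.
    split; first by apply: nbhsx_ballx; rewrite divr_gt0.
    by apply: nbhs_right_lt; rewrite divr_gt0.
  move=> [x' r] /= [xx' rd] y x'y.
  have h1 : dst x x' < e / 2.
    apply: hd; apply: le_ball xx'; rewrite ler_pdivrMr// ler_peMr ?ltW//.
    by lra.
  have h2 : dst x y < e / 2.
    apply: hd; rewrite /ball/= in xx' *.
    have -> : x - y = (x - x') + (x' - y) by ring.
    by rewrite (le_lt_trans (ler_normD _ _))//; lra.
  have := tri x' x y; rewrite (sym x' x); lra.
move=> H; have : \forall d \near (0 : R)^'+, 0 < d /\ `[a, b] `<=` P d.
  near=> d; split; [near: d; exact: nbhs_right_gt|near: d; exact: H].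
move=> /filter_ex[d [d0 hd]]; exists d => // x y xab.
by apply: hd; rewrite /= in_itv.
Unshelve. all: by end_near. Qed.

End HeineCantor.

Section Bochner.
Context {R : realType} {X : completeNormedModType R[i]}.
Local Notation mu := (@lebesgue_measure R).
Local Notation TR := (measurableTypeR R).
Implicit Types (D A : set TR) (g : R -> X) (s : @simple_fun R X).

Lemma sf_int_functional D s (L : X -> R[i]) : measurable D -> sf_on D s ->
  functional L ->
  cintegrable D (fun x => L (sf_eval s x)) /\
  cint D (fun x => L (sf_eval s x)) = L (sf_int s).
Proof.
move=> mD sD fL; rewrite /sf_eval /sf_int.
have -> : (fun x => L (\sum_(i < sf_n s) ((x \in sf_set s i)%:R : R[i]) *: sf_coef s i)) =
    (fun x => \sum_(i < sf_n s) ((x \in sf_set s i)%:R * L (sf_coef s i))).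
  apply/funext => x; rewrite fun_sum//; apply: eq_bigr => i _.
  by rewrite (funZ fL).
rewrite fun_sum//; move: sD; rewrite /sf_on; elim: (sf_n s) => [|n IH] sD.
  under eq_cint do rewrite big_ord0.
  under eq_fun do rewrite big_ord0.
  rewrite big_ord0; split; first by split; exact: integrable0.
  by apply: complexP; rewrite ?cint_Re ?cint_Im /= /Rintegral integral0.
have [i1 e1] := IH (fun i hi => sD i (ltnW hi)).
have [mA AD Af] := sD n (ltnSn n).
have [i2 e2] := cint_indic (L (sf_coef s n)) mD mA AD Af.
have -> : (fun x : R => \sum_(i < n.+1) (x \in sf_set s i)%:R * L (sf_coef s i)) =
    (fun x : R => \sum_(i < n) (x \in sf_set s i)%:R * L (sf_coef s i) +
      (x \in sf_set s n)%:R * L (sf_coef s n)).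
  by apply/funext => x; rewrite big_ord_recr.
split; first exact: cintegrableD.
by rewrite cintD// e1 e2 big_ord_recr/= (funZ fL).
Qed.

Definition sf_add s s' : @simple_fun R X :=
  SimpleFun (sf_n s + sf_n s')%N
    (fun i => if (i < sf_n s)%N then sf_coef s i else sf_coef s' (i - sf_n s)%N)
    (fun i => if (i < sf_n s)%N then sf_set s i else sf_set s' (i - sf_n s)%N).

Lemma sf_add_on D s s' : sf_on D s -> sf_on D s' -> sf_on D (sf_add s s').
Proof.
move=> h h' i /= hi; case: ltnP => [is_|si]; first exact: h.
by apply: h'; rewrite ltn_subLR.
Qed.

Lemma sf_add_eval s s' x : sf_eval (sf_add s s') x = sf_eval s x + sf_eval s' x.
Proof.
rewrite /sf_eval /= big_split_ord/=; congr (_ + _); apply: eq_bigr => i _ /=.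
- by rewrite ltn_ord.
- by rewrite ltnNge leq_addr/= addKn.
Qed.

(* The analogue of Bochner integrability without prescribing the limit of the
   integrals of the approximating simple functions. *)
Definition sapprox D g (e : R) s (h : TR -> R) :=
  [/\ sf_on D s, measurable_fun D h, forall x, 0 <= h x,
    {ae mu, forall x, D x -> nrm (g x - sf_eval s x) <= h x} &
    (\int[mu]_(x in D) (h x)%:E <= e%:E)%E].

Definition approximable D g := forall e : R, 0 < e ->
  exists s (h : TR -> R), sapprox D g e s h.

(** Tested on a functional, which costs a factor 2, and [cint_ae_le] costs another. This estimate
    yields both uniqueness of the Bochner integral and the Cauchy property behind its existence. *)
Lemma sapprox_dist D g e e' s s' (h h' : TR -> R) : measurable D ->
  sapprox D g e s h -> sapprox D g e' s' h' ->
  nrm (sf_int s - sf_int s') <= 4 * (e + e').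
Proof.
move=> mD [sD mh h0 gh he] [sD' mh' h0' gh' he'].
apply: nrm_le_functional => L fL.
have [i1 e1] := sf_int_functional mD sD fL.
have [i2 e2] := sf_int_functional mD sD' fL.
rewrite (funB _ _ fL) -e1 -e2 -cintB//.
have -> : 4 * (e + e') = 2 * (2 * (e + e')) by ring.
apply: (cint_ae_le (h := fun x => 2 * (h x + h' x)) mD _ _ _ _ _).2 => //.
- by apply: cmeasB; exact: cintegrable_meas.
- by apply: measurable_funM => //; exact: measurable_funD.
- by move=> x; rewrite mulr_ge0// addr_ge0.
- apply: filterS2 gh gh' => x gh gh' Dx.
  rewrite -(funB _ _ fL) (le_trans (fun_bound fL _))// ler_pM2l//.
  have -> : sf_eval s x - sf_eval s' x = (g x - sf_eval s' x) - (g x - sf_eval s x).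
    by rewrite opprB [RHS]addrC addrA subrK.
  by rewrite (le_trans (nrmB _ _))// addrC lerD ?gh ?gh'.
- under eq_integral do rewrite EFinM.
  rewrite ge0_integralZl//; last 2 first.
    by apply/measurable_EFinP; exact: measurable_funD.
    by move=> x _; rewrite lee_fin addr_ge0.
  rewrite EFinM lee_pmul2l//; under eq_integral do rewrite EFinD.
  rewrite ge0_integralD//; try exact/measurable_EFinP;
    try by move=> x _; rewrite lee_fin.
  by rewrite EFinD leeD.
Qed.

Lemma bochner_sapprox D g v (e : R) : is_bochner_integral D g v -> 0 < e ->
  exists s h, sapprox D g e s h /\ nrm (v - sf_int s) <= e.
Proof.
move=> [mD [s [h [sD [mh [gh_ [h0 /cvg_nrmP sv]]]]]]] e0.
have gh n : {ae mu, forall x : TR, D x -> nrm (g x - sf_eval (s n) x) <= h n x}.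
  exact: gh_.
have mD' : @measurable _ TR D by [].
have mh' n : @measurable_fun _ _ TR R D (h n) by exact: mh.
have ih n : (\int[mu]_(x in D) (`|h n x|)%:E = \int[mu]_(x in D) (h n x)%:E)%E.
  apply: integral_abs_ae => //.
  by apply: filterS (gh n) => x gx Dx; exact: le_trans (nrm_ge0 _) (gx Dx).
have /filter_ex[n [n1 n2]] : \forall n \near \oo,
    (\int[mu]_(x in D) (h n x)%:E <= e%:E)%E /\ nrm (sf_int (s n) - v) <= e.
  near=> n; split; near: n.
  - have /fine_cvgP[fh /cvgr0Pnorm_le/(_ _ e0) h0'] := h0.
    near=> n; have fn : (\int[mu]_(x in D) (h n x)%:E)%E \is a fin_num.
      by near: n.
    rewrite -(fineK fn) lee_fin; apply: le_trans (ler_norm _) _.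
    by near: n.
  - move/cvgr0Pnorm_le : sv => /(_ _ e0); apply: filterS => n.
    by rewrite ger0_norm ?nrm_ge0.
exists (s n), (fun x => `|h n x|); split; last by rewrite nrm_distC.
split.
- exact: sD.
- by apply: measurableT_comp => //; exact: mh'.
- by [].
- by apply: filterS (gh n) => x gx Dx; exact: le_trans (gx Dx) (ler_norm _).
- by rewrite ih.
Unshelve. all: by end_near. Qed.

Lemma bochner_approx D g : bochner_integrable D g ->
  measurable D /\ approximable D g.
Proof.
move=> [v gv]; split; first by case: gv.
by move=> e e0; have [s [h [sh _]]] := bochner_sapprox gv e0; exists s, h.
Qed.

Lemma bochner_unique D g v w :
  is_bochner_integral D g v -> is_bochner_integral D g w -> v = w.
Proof.
move=> gv gw; apply/eqP; rewrite -subr_eq0; apply/eqP; apply: nrm_eq0.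
apply/le_anti; rewrite nrm_ge0 andbT; apply/ler_addgt0Pr => e e0.
(* With e1 = e / 10: two errors e1 from the values, and 4 (e1 + e1) between the approximants. *)
have e1 : 0 < e / 10 by rewrite divr_gt0.
have [s [h [sh vs]]] := bochner_sapprox gv e1.
have [s' [h' [sh' ws]]] := bochner_sapprox gw e1.
have mD : @measurable _ TR D by case: gv.
have := sapprox_dist mD sh sh'.
have -> : v - w = (v - sf_int s) + (sf_int s - sf_int s') - (w - sf_int s').
  by rewrite addrA subrK opprB addrA subrK.
move=> d; rewrite add0r (le_trans (nrmB _ _))//.
by have := nrmD (v - sf_int s) (sf_int s - sf_int s'); lra.
Qed.

Lemma bochner_Bint D g v : is_bochner_integral D g v -> Bint D g = v.
Proof.
move=> gv; rewrite /Bint; case: xgetP => [w _ gw|/(_ v)]; last by [].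
exact: bochner_unique gw gv.
Qed.

Lemma BintP D g : bochner_integrable D g -> is_bochner_integral D g (Bint D g).
Proof. by move=> [v gv]; rewrite (bochner_Bint gv). Qed.

(** Measurability of [L (g x)] is a separate hypothesis because simple functions approximate [g]
    only up to null sets. The error 6 e is 4 e from [cint_ae_le] plus 2 e from applying [L] to the
    error on the value. *)
Lemma Bint_functional D g (L : X -> R[i]) : bochner_integrable D g ->
  functional L -> cmeas D (fun x => L (g x)) ->
  cintegrable D (fun x => L (g x)) /\ cint D (fun x => L (g x)) = L (Bint D g).
Proof.
move=> /BintP; set v := Bint D g => gv fL mLg.
have mD : @measurable _ TR D by case: gv.
have key (e : R) : 0 < e -> cintegrable D (fun x => L (g x)) /\
    cn (cint D (fun x => L (g x)) - L v) <= 6 * e.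
  move=> e0; have [s [h [[sD mh h0 gh he] vs]]] := bochner_sapprox gv e0.
  have [is_ es] := sf_int_functional mD sD fL.
  have [] := @cint_ae_le R D (fun x => L (g x) - L (sf_eval s x))
    (fun x => 2 * h x) (2 * e) mD.
  - by apply: cmeasB => //; exact: cintegrable_meas.
  - by apply: measurable_funM.
  - by move=> x; rewrite mulr_ge0.
  - apply: filterS gh => x gx Dx; rewrite -(funB _ _ fL).
    by rewrite (le_trans (fun_bound fL _))// ler_pM2l// gx.
  - under eq_integral do rewrite EFinM.
    rewrite ge0_integralZl//; last 2 first.
      exact/measurable_EFinP.
      by move=> x _; rewrite lee_fin.
    by rewrite EFinM lee_pmul2l.
  move=> id led.
  have ig : cintegrable D (fun x => L (g x)).
    apply: (@eq_cintegrable _ _ (fun x => (L (g x) - L (sf_eval s x)) + L (sf_eval s x))) => //.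
      by move=> x _; rewrite subrK.
    exact: cintegrableD.
  split=> //; move: led; rewrite cintB// es => led.
  have -> : cint D (fun x => L (g x)) - L v =
      (cint D (fun x => L (g x)) - L (sf_int s)) - L (v - sf_int s).
    by rewrite (funB _ _ fL) opprB addrA subrK.
  rewrite (le_trans (cnB _ _))//.
  have := fun_bound fL (v - sf_int s); lra.
split; first by have [] := key 1 ltr01.
apply/eqP; rewrite -subr_eq0; apply/eqP/cn_eq0/le_anti.
rewrite cn_ge0 andbT; apply/ler_addgt0Pr => e e0.
have [_] := key (e / 6) (divr_gt0 e0 (ltr0Sn _ _)).
by rewrite add0r mulrCA divff// mulr1.
Qed.

Lemma sapprox_congr D g g' e s (h : TR -> R) : (forall x, D x -> g x = g' x) ->
  sapprox D g e s h -> sapprox D g' e s h.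
Proof.
move=> gg' [? ? ? gh ?]; split => //.
by apply: filterS gh => x gx Dx; rewrite -gg'// gx.
Qed.

Lemma approx_congr D g g' : (forall x, D x -> g x = g' x) ->
  approximable D g -> approximable D g'.
Proof.
move=> gg' ag e /ag[s [h sh]]; exists s, h; exact: sapprox_congr sh.
Qed.

(** By [sapprox_dist] the integrals of the approximants form a Cauchy sequence, and completeness of
    [X] supplies the value. Integrability thus reduces to approximability, which is easier to
    transport. *)
Lemma approx_bochner D g : measurable D -> approximable D g ->
  bochner_integrable D g.
Proof.
move=> mD ag.
have /choice[sh hsh] : forall n : nat, exists p : @simple_fun R X * (TR -> R),
    sapprox D g (n.+1%:R)^-1 p.1 p.2.
  by move=> n; have [|s [h p]] := ag (n.+1%:R^-1); [rewrite invr_gt0|exists (s, h)].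
have cn_ : cvg (sf_int (sh n).1 @[n --> \oo]).
  apply/cauchy_cvgP/cauchy_ballP => e e0.
  have ee : (complex.Re e)%:C%C = e by rewrite RRe_real// gtr0_real.
  have e0' : 0 < complex.Re e by rewrite -ltcR ee.
  near \oo => N.
  have small n : (N <= n)%N -> n.+1%:R^-1 < complex.Re e / 10.
    move=> Nn; apply: (@le_lt_trans _ _ N.+1%:R^-1); last first.
      by near: N; exact: near_infty_natSinv_lt (PosNum (divr_gt0 e0' _)).
    by rewrite lef_pV2 ?posrE// ler_nat.
  rewrite near_map2.
  exists ([set n | (N <= n)%N], [set n | (N <= n)%N]) => /=.
    by split; exact: nbhs_infty_ge.
  move=> [n m] /= [Nn Nm]; rewrite -ball_normE /= -nrm_complex -ee ltcR.
  apply: le_lt_trans (sapprox_dist mD (hsh n) (hsh m)) _.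
  have := small _ Nn; have := small _ Nm; have := e0'.
  set a := n.+1%:R^-1; set b := m.+1%:R^-1; set r := complex.Re e; lra.
exists (limn (fun n => sf_int (sh n).1)); split => //.
exists (fun n => (sh n).1), (fun n => (sh n).2); split.
  by move=> n; case: (hsh n).
split; first by move=> n; case: (hsh n).
split; first by move=> n; case: (hsh n).
split; last exact: cn_.
apply: (@squeeze_cvge _ _ _ _ (fun=> 0%E) _ (fun n => (n.+1%:R^-1)%:E)).
- apply: nearW => n; have [_ _ h0 _ hle] := hsh n; rewrite hle andbT.
  by apply: integral_ge0 => x _; rewrite lee_fin.
- exact: cvg_cst.
- apply: cvg_EFin; first by apply: nearW.
  exact: cvg_harmonic.
Unshelve. all: by end_near. Qed.

Lemma approx_lim D g : measurable D ->
  (forall e : R, 0 < e -> exists g' (h : TR -> R),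
    [/\ approximable D g', measurable_fun D h, forall x, 0 <= h x,
      {ae mu, forall x : TR, D x -> nrm (g x - g' x) <= h x} &
      (\int[mu]_(x in D) (h x)%:E <= e%:E)%E]) ->
  approximable D g.
Proof.
move=> mD H e e0; have e1 : 0 < e / 2 by rewrite divr_gt0.
have [g' [h [ag' mh h0 gh he]]] := H _ e1.
have [s [h' [sD mh' h0' gh' he']]] := ag' _ e1.
exists s, (fun x => h x + h' x); split => //.
- exact: measurable_funD.
- by move=> x; rewrite addr_ge0.
- apply: filterS2 gh gh' => x gx gx' Dx.
  have -> : g x - sf_eval s x = (g x - g' x) + (g' x - sf_eval s x).
    by rewrite addrA subrK.
  by rewrite (le_trans (nrmD _ _))// lerD ?gx ?gx'.
- under eq_integral do rewrite EFinD.
  rewrite ge0_integralD//; try exact/measurable_EFinP;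
    try by move=> x _; rewrite lee_fin.
  by rewrite [e]splitr EFinD leeD.
Qed.

Lemma approxD D g g' : measurable D -> approximable D g -> approximable D g' ->
  approximable D (fun x => g x + g' x).
Proof.
move=> mD ag ag' e e0; have e1 : 0 < e / 2 by rewrite divr_gt0.
have [s [h [sD mh h0 gh he]]] := ag _ e1.
have [s' [h' [sD' mh' h0' gh' he']]] := ag' _ e1.
exists (sf_add s s'), (fun x => h x + h' x); split => //.
- exact: sf_add_on.
- exact: measurable_funD.
- by move=> x; rewrite addr_ge0.
- apply: filterS2 gh gh' => x gx gx' Dx.
  rewrite sf_add_eval opprD addrACA.
  by rewrite (le_trans (nrmD _ _))// lerD ?gx ?gx'.
- under eq_integral do rewrite EFinD.
  rewrite ge0_integralD//; try exact/measurable_EFinP;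
    try by move=> x _; rewrite lee_fin.
  by rewrite [e]splitr EFinD leeD.
Qed.

Lemma approx0 D : measurable D -> approximable D (fun=> 0).
Proof.
move=> mD e e0; exists (SimpleFun 0 (fun=> 0) (fun=> set0)), (fun=> 0); split => //.
- by apply: aeW => x _; rewrite /sf_eval big_ord0 subr0 nrm0.
- by rewrite integral0 lee_fin ltW.
Qed.

Lemma approx_sum D n (G : nat -> R -> X) : measurable D ->
  (forall i, (i < n)%N -> approximable D (G i)) ->
  approximable D (fun x => \sum_(i < n) G i x).
Proof.
move=> mD; elim: n => [|n IH] aG.
  by under eq_fun do rewrite big_ord0; exact: approx0.
under eq_fun do rewrite big_ord_recr; apply: approxD => //; last exact: aG.
by apply: IH => i hi; apply: aG; exact: ltnW.
Qed.

(** The approximant is constant on each of the finitely many cells [idx x = i], and finite measure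
    turns a uniform error into an integral one. *)
Lemma approx_partition D A g : measurable D -> measurable A -> A `<=` D ->
  (mu A < +oo)%E ->
  (forall e : R, 0 < e -> exists (K : nat) (idx : R -> nat) (c : nat -> X),
    (forall i, measurable (A `&` [set x | idx x = i])) /\
    (forall x, A x -> (idx x < K)%N /\ nrm (g x - c (idx x)) <= e)) ->
  approximable D (fun x => (x \in A)%:R *: g x).
Proof.
move=> mD mA AD Afin H e e0.
set a := fine (mu A).
have a0 : 0 <= a by rewrite fine_ge0.
(* [a + 1] rather than [a], since [A] may be a null set. *)
have e1 : 0 < e / (a + 1) by rewrite divr_gt0// ltr_wpDl.
have [K [idx [c [mi hi]]]] := H _ e1.
exists (SimpleFun K c (fun i => A `&` [set x | idx x = i])),
  (fun x => \1_A x * (e / (a + 1))); split.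
- move=> i _ /=; split; [exact: mi|by move=> x [/AD]|].
  by apply: le_lt_trans Afin; apply: le_measure; rewrite ?inE//; exact: mi.
- by apply: measurable_funM => //; exact: measurable_cst.
- by move=> x; rewrite mulr_ge0// ltW.
- apply: aeW => x Dx; rewrite /sf_eval /= indicE.
  have [xA|xA] := boolP (x \in A); last first.
    rewrite mul0r scale0r big1 ?subr0 ?nrm0// => i _.
    rewrite memNset ?scale0r// => -[Ax _]; move/negP : xA; apply.
    exact/mem_set.
  have [ik le] := hi x (set_mem xA).
  rewrite scale1r mul1r (bigD1 (Ordinal ik))//= big1 ?addr0.
    by rewrite mem_set ?scale1r//; split => //; exact: set_mem.
  move=> i inx; rewrite memNset ?scale0r// => -[_ /= xi].
  by move/eqP : inx; apply; apply: val_inj.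
- under eq_integral do rewrite EFinM.
  rewrite ge0_integralZr//; last 2 first.
    by apply/measurable_EFinP.
    by rewrite lee_fin ltW.
  have -> : (\int[mu]_(x in D) (\1_A x)%:E = a%:E)%E.
    by rewrite integral_indic// setIidl// fineK// ge0_fin_numE.
  rewrite -EFinM lee_fin -/a mulrCA ler_piMr ?(ltW e0)//.
  by rewrite ler_pdivrMr ?ltr_wpDl// mul1r lerDl.
Qed.

Lemma approx_real_bnd D A (b : TR -> R) (M : R) (x0 : X) :
  measurable D -> measurable A -> A `<=` D ->
  (mu A < +oo)%E -> measurable_fun A b -> (forall x, A x -> `|b x| <= M) ->
  approximable D (fun x => (x \in A)%:R *: ((b x)%:C%C *: x0)).
Proof.
move=> mD mA AD Afin mb bM; apply: approx_partition => // e e0.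
pose M1 := `|M| + 1; have M10 : 0 < M1 by rewrite ltr_wpDl.
pose d := e / (nrm x0 + 1).
have n1 : 0 < nrm x0 + 1 by rewrite ltr_wpDl// nrm_ge0.
have d0 : 0 < d by rewrite divr_gt0.
(* The cells are level sets of [b] of height [d]; adding [M1] makes the truncated quantity
   nonnegative. *)
pose idx x := Num.truncn ((b x + M1) / d).
have bd x : A x -> 0 <= (b x + M1) / d /\ (b x + M1) / d < 2 * M1 / d.
  move=> Ax; have := bM _ Ax; rewrite ler_norml => /andP[b1 b2].
  have := ler_norm M; rewrite -/M1 => MM.
  have M1E : M1 = `|M| + 1 by [].
  split; first by rewrite divr_ge0 ?ltW//; lra.
  by rewrite ltr_pM2r ?invr_gt0//; lra.
exists (Num.truncn (2 * M1 / d)).+1, idx,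
  (fun i => (i%:R * d - M1)%:C%C *: x0); split.
  move=> i; have -> : A `&` [set x | idx x = i] =
      A `&` b @^-1` `[i%:R * d - M1, i.+1%:R * d - M1[.
    apply/seteqP; split => x /= [Ax]; have [p1 p2] := bd _ Ax.
      move=> ix; split => //; rewrite in_itv/=.
      have /andP[q1 q2] := truncn_itv p1; move: q1 q2; rewrite -/(idx x) ix.
      by rewrite ler_pdivlMr// ltr_pdivrMr// => q1 q2; lra.
    rewrite in_itv/= => /andP[q1 q2]; split => //; apply/truncn_def.
    by rewrite ler_pdivlMr// ltr_pdivrMr//; lra.
  exact: mb.
move=> x Ax; have [p1 p2] := bd _ Ax; split.
  by rewrite ltnS; apply: le_truncn; exact: ltW.
have /andP[q1 q2] := truncn_itv p1; rewrite -/(idx x) in q1 q2.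
rewrite ler_pdivlMr// ltr_pdivrMr// -natr1 in q1 q2.
rewrite -scalerBl nrmZ -rmorphB/= cn_real.
have : `|b x - ((idx x)%:R * d - M1)| <= d.
  by rewrite ler_norml; apply/andP; split; lra.
move=> h; apply: (@le_trans _ _ (d * nrm x0)).
  by rewrite ler_wpM2r ?nrm_ge0.
by rewrite /d mulrAC ler_pdivrMr// ler_pM2l// lerDl.
Qed.

(** By [approx_lim] the function [g] may be taken simple. The product is then a finite sum of real
    bounded functions times fixed vectors, the imaginary part of [b] being paired with
    ['i *: sf_coef s i]. *)
Lemma approx_bndM D g (b : TR -> R[i]) (M : R) : measurable D ->
  cmeas D b -> (forall x, D x -> cn (b x) <= M) -> approximable D g ->
  approximable D (fun x => b x *: g x).
Proof.
move=> mD mb bM ag; apply: approx_lim => // e e0.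
have n1 : 0 < `|M| + 1 by rewrite ltr_wpDl.
have [s [h [sD mh h0 gh he]]] := ag _ (divr_gt0 e0 n1).
exists (fun x => b x *: sf_eval s x), (fun x => (`|M| + 1) * h x); split.
- have e' x : b x *: sf_eval s x = \sum_(i < sf_n s)
     ((x \in sf_set s i)%:R *: ((complex.Re (b x))%:C%C *: sf_coef s i) +
      (x \in sf_set s i)%:R *: ((complex.Im (b x))%:C%C *: ('i%C *: sf_coef s i))).
    rewrite /sf_eval scaler_sumr; apply: eq_bigr => i _.
    rewrite -scalerDr [in RHS]scalerA -scalerDl !scalerA mulrC; congr (_ * _ *: _).
    by rewrite {1}(complexE (b x)) [_ * 'i%C]mulrC.
  apply: (@approx_congr D (fun x => \sum_(i < sf_n s) _)) => [x _|].
    exact/esym/e'.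
  apply: (@approx_sum D (sf_n s) (fun i x =>
     ((x \in sf_set s i)%:R *: ((complex.Re (b x))%:C%C *: sf_coef s i) +
      (x \in sf_set s i)%:R *: ((complex.Im (b x))%:C%C *: ('i%C *: sf_coef s i))))) => //.
  move=> i hi; have [mA AD Af] := sD i hi.
  have [m1 m2] := mb.
  apply: approxD => //; apply: (approx_real_bnd (M := M)) => //.
  + exact: measurable_funS mD AD m1.
  + by move=> x /AD Dx; rewrite (le_trans (Re_le_cn _))// bM.
  + exact: measurable_funS mD AD m2.
  + by move=> x /AD Dx; rewrite (le_trans (Im_le_cn _))// bM.
- by apply: measurable_funM => //; exact: measurable_cst.
- by move=> x; rewrite mulr_ge0// ltW.
- apply: filterS gh => x gx Dx; rewrite -scalerBr nrmZ ler_pM ?cn_ge0 ?nrm_ge0 ?gx//.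
  by rewrite (le_trans (bM _ Dx))// (le_trans (ler_norm _))// lerDl.
- under eq_integral do rewrite EFinM.
  rewrite ge0_integralZl//; last 2 first.
    exact/measurable_EFinP.
    by move=> x _; rewrite lee_fin.
  apply: (le_trans (lee_wpmul2l _ he)); first by rewrite lee_fin ltW.
  by rewrite -EFinM lee_fin mulrC divfK// gt_eqF.
Qed.

(** Uniform continuity on the bounded window gives cells of length [d] on which [f] is nearly its
    value at the left end. *)
Lemma approx_continuous_bnd D (N : nat) (f : R -> X) : measurable D ->
  (forall x (e : R), 0 < e -> \forall y \near x, nrm (f x - f y) < e) ->
  approximable D (fun x => (x \in D `&` `[- N%:R, N%:R[)%:R *: f x).
Proof.
move=> mD cf; have mI : @measurable _ TR `[- N%:R, N%:R[%classic by [].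
have mA := measurableI _ _ mD mI.
apply: approx_partition => //.
- apply: (@le_lt_trans _ _ (mu `[- N%:R, N%:R[%classic)).
    by apply: le_measure; rewrite ?inE.
  by rewrite lebesgue_measure_itv/=; case: ifP => _; rewrite -?EFinB ltry.
move=> e e0.
have [d d0 hd] := @heine_cantor R (fun x y => nrm (f x - f y)) (- N%:R) N%:R e
  (fun x y => nrm_distC _ _)
  (fun x y z => nrm_triangle (f x) (f y) (f z)) cf e0.
pose idx x := Num.truncn ((x + N%:R) / d).
exists (Num.truncn ((N%:R + N%:R) / d)).+1, idx, (fun i => f (i%:R * d - N%:R)).
have bd x : (D `&` `[- N%:R, N%:R[%classic) x -> 0 <= (x + N%:R) / d /\
    (x + N%:R) / d <= (N%:R + N%:R) / d.
  move=> [_ /=]; rewrite in_itv/= => /andP[x1 x2].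
  split; first by rewrite divr_ge0 ?(ltW d0)//; lra.
  by rewrite ler_pM2r ?invr_gt0//; lra.
split.
  move=> i; have -> : D `&` `[- N%:R, N%:R[ `&` [set x | idx x = i] =
      (D `&` `[- N%:R, N%:R[) `&` `[i%:R * d - N%:R, i.+1%:R * d - N%:R[.
    apply/seteqP; split => x [Ax] /=; have [p1 p2] := bd _ Ax.
      move=> ix; split => //; rewrite in_itv/=.
      have /andP[q1 q2] := truncn_itv p1; move: q1 q2; rewrite -/(idx x) ix.
      by rewrite ler_pdivlMr// ltr_pdivrMr// => q1 q2; lra.
    rewrite in_itv/= => /andP[q1 q2]; split => //; apply/truncn_def.
    by rewrite ler_pdivlMr// ltr_pdivrMr//; lra.
  by apply: measurableI.
move=> x Ax; have [p1 p2] := bd _ Ax; split.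
  by rewrite ltnS; exact: le_truncn.
have /andP[q1 q2] := truncn_itv p1; rewrite -/(idx x) in q1 q2.
rewrite ler_pdivlMr// ltr_pdivrMr// -natr1 in q1 q2.
apply/ltW/hd.
  by case: Ax => _ /=; rewrite in_itv/= => /andP[x1 x2]; rewrite x1 ltW.
by rewrite ger0_norm; lra.
Qed.

(** Truncation to the set where [cn (w x) <= n] and [- n <= x < n] gives a bounded weight on a
    bounded window. The discarded part is at most [M * cn (w x)] off that set, and its integral
    tends to 0 by dominated convergence. *)
Lemma approx_cintM D (w : TR -> R[i]) (f : R -> X) (M : R) : measurable D ->
  cintegrable D w ->
  (forall x (e : R), 0 < e -> \forall y \near x, nrm (f x - f y) < e) ->
  (forall x, nrm (f x) <= M) ->
  approximable D (fun x => w x *: f x).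
Proof.
move=> mD iw cf fM; have mw := cintegrable_meas iw.
have M0 : 0 <= M := le_trans (nrm_ge0 _) (fM 0).
pose B (n : nat) := [set x : TR | cn (w x) <= n%:R] `&` `[- n%:R, n%:R[%classic.
have mcn := cmeas_cn mw.
have mB n : measurable (D `&` B n).
  have -> : D `&` B n = (D `&` (fun x => cn (w x)) @^-1` `]-oo, n%:R]) `&` `[- n%:R, n%:R[.
    by rewrite /B setIA; congr (_ `&` _ `&` _); apply/seteqP; split => x /=;
      rewrite in_itv.
  by apply: measurableI => //; exact: mcn.
pose hn (n : nat) (x : TR) := M * (\1_(~` (D `&` B n)) x * cn (w x)).
have icn := cintegrable_cn mD iw.
apply: approx_lim => // e e0.
have h0 n x : 0 <= hn n x by rewrite !mulr_ge0 ?cn_ge0.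
have mhn n : measurable_fun D (hn n).
  apply: measurable_funM => //; apply: measurable_funM => //.
  exact: measurable_indic (measurableC (mB n)).
have [|||||_ _ cv] := @dominated_convergence _ _ _ mu D mD (fun n x => (hn n x)%:E) (fun=> 0%E)
  (fun x => (M * cn (w x))%:E).
- by move=> n; exact/measurable_EFinP.
- exact: measurable_cst.
- apply: aeW => x Dx; apply: cvg_near_cst.
  near=> n; rewrite /hn indicE memNset ?mul0r ?mulr0// => -[]; split => //; split.
    by near: n; exact: nbhs_infty_ger.
  rewrite /= in_itv/=; apply/andP; split.
    rewrite lerNl (le_trans (ler_norm _))// normrN.
    by near: n; exact: nbhs_infty_ger.
  by rewrite (le_lt_trans (ler_norm _))//; near: n; exact: nbhs_infty_gtr.
- have := integrableZl mD M icn.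
  by apply: eq_integrable => // x _ /=; rewrite EFinM.
- apply: aeW => x n Dx; rewrite gee0_abs ?lee_fin// /hn ler_wpM2l//.
  by rewrite ler_piMl ?cn_ge0// indicE; case: (_ \in _).
have /filter_ex[n he] : \forall n \near \oo,
    (\int[mu]_(x in D) (hn n x)%:E <= e%:E)%E.
  move: cv; rewrite integral0 => /fine_cvgP[fh /cvgr0Pnorm_le/(_ _ e0) h0'].
  near=> n; have fn : (\int[mu]_(x in D) (hn n x)%:E)%E \is a fin_num.
    by near: n.
  rewrite -(fineK fn) lee_fin; apply: le_trans (ler_norm _) _.
  by near: n.
exists (fun x => ((\1_(D `&` B n) x)%:C%C * w x) *: ((x \in D `&` `[- n%:R, n%:R[)%:R *: f x)),
  (hn n); split => //.
- apply: (approx_bndM (M := n%:R)) => //.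
  + apply: cmeasM => //; apply: cmeas_real.
    exact: measurable_indic.
  + move=> x Dx; rewrite cnM cn_real indicE.
    have [xB|xB] := boolP (x \in _); last by rewrite normr0 mul0r.
    by rewrite normr1 mul1r; move/set_mem : xB => [_ []].
  + exact: approx_continuous_bnd.
- apply: aeW => x Dx; rewrite /hn !indicE.
  have [xB|xB] := boolP (x \in D `&` B n).
    rewrite mem_set; last by move/set_mem : xB => [? [_ ?]].
    by rewrite mul1r scale1r subrr nrm0 mulr_ge0// mulr_ge0// cn_ge0.
  rewrite mul0r scale0r subr0 nrmZ mem_set /=; last by move=> h; move/negP : xB; apply; apply/mem_set.
  by rewrite mul1r mulrC ler_wpM2r ?cn_ge0.
Unshelve. all: by end_near. Qed.

Lemma sapprox_extend D g e s (h : TR -> R) : measurable D ->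
  (forall x, ~ D x -> g x = 0) -> sapprox D g e s h -> sapprox setT g e s (h \_ D).
Proof.
move=> mD g0 [sD mh h0 gh he]; split.
- by move=> i hi; have [] := sD i hi; split.
- by apply/(measurable_restrictT _ mD).
- by move=> x; rewrite patchE; case: ifP.
- apply: filterS gh => x gx _; rewrite patchE.
  have [xD|xD] := boolP (x \in D); first exact/gx/set_mem.
  rewrite g0 ?sub0r ?nrmN; last by move=> h1; move/negP : xD; apply; apply/mem_set.
  rewrite /sf_eval big1 ?nrm0// => i _.
  rewrite memNset ?scale0r// => h1; move/negP : xD; apply; apply/mem_set.
  by have [_ SD _] := sD i (ltn_ord i); exact: SD.
- move: he; rewrite integral_mkcond; apply: le_trans.
  by rewrite restrict_EFin.
Qed.

Lemma approx_extend D g : measurable D -> approximable D g ->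
  (forall x, ~ D x -> g x = 0) -> approximable setT g.
Proof.
move=> mD ag g0 e e0; have [s [h sh]] := ag _ e0.
by exists s, (h \_ D); exact: sapprox_extend.
Qed.

End Bochner.

(** * Fourier inversion *)

Section Poisson.
Context {R : realType}.
Local Notation mu := (@lebesgue_measure R).
Local Notation TR := (measurableTypeR R).
Local Notation Re := complex.Re.
Local Notation Im := complex.Im.

Definition laplacian_density (s : R) : R := expR (- `|s|).

Definition poisson (w : R) : R := 2 / (1 + w ^+ 2).

Lemma poisson_gt0 w : 0 < poisson w.
Proof. by rewrite divr_gt0// ltr_wpDr// sqr_ge0. Qed.

Lemma poisson_den_gt0 (w : R) : 0 < 1 + w ^+ 2.
Proof. by rewrite ltr_wpDr// sqr_ge0. Qed.

Lemma continuous_laplacian_density : continuous laplacian_density.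
Proof.
move=> x; apply: (@continuous_comp _ _ _ (fun x : R => - `|x|) expR).
  by apply: continuousN; exact: norm_continuous.
exact: continuous_expR.
Qed.

Lemma continuous_is_derive (f df : R -> R) :
  (forall x : R, is_derive x 1 f (df x)) -> continuous f.
Proof.
move=> fdf x; apply: differentiable_continuous; apply/derivable1_diffP.
by have [] := fdf x.
Qed.

Lemma continuous_cosM (w : R) : continuous (fun s : R => cos (s * w)).
Proof.
apply: (@continuous_is_derive _ (fun s => - sin (s * w) * w)) => s.
apply: trigger_derive; rewrite /GRing.scale /=.
by ring.
Qed.

Lemma continuous_poisson : continuous poisson.
Proof.
move=> x; apply: cvgM; first exact: cvg_cst.
apply: cvgV; first by rewrite gt_eqF// poisson_den_gt0.
by apply: cvgD; [exact: cvg_cst|exact: exprn_continuous].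
Qed.

(** The 1 added to the cosine makes the integrand nonnegative, as the fundamental theorem on a
    half-line requires; [poisson_kernel] subtracts it again. *)
Lemma laplacian_density_cos_half (w : R) :
  (\int[mu]_(s in `[0%R, +oo[) (expR (- s) * (1 + cos (s * w)))%:E =
    (1 + (1 + w ^+ 2)^-1)%:E)%E.
Proof.
have w1 := poisson_den_gt0 w.
pose F (s : R) := expR (- s) * ((w * sin (s * w) - cos (s * w)) / (1 + w ^+ 2) - 1).
have dF (s : R) : is_derive s 1 F (expR (- s) * (1 + cos (s * w))).
  rewrite /F; apply: trigger_derive.
  rewrite /GRing.scale /= !(mul1r, mulr1, mul0r, add0r, addr0, oppr0, mulr0, scaler0).
  by field; rewrite gt_eqF.
have cdF : continuous (fun s : R => expR (- s) * (1 + cos (s * w))).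
  apply: (@continuous_is_derive _ (fun s => - expR (- s) * (1 + cos (s * w)) + expR (- s) * (- sin (s * w) * w))) => s.
  apply: trigger_derive; rewrite /GRing.scale /=.
  by rewrite !(mul1r, mulr1, mulr0, addr0, add0r); ring.
have cF : continuous F by move=> s; apply: differentiable_continuous; exact/derivable1_diffP.
rewrite (@ge0_continuous_FTC2y R _ F 0 0) //.
- rewrite /F oppr0 expR0 mul0r sin0 cos0 mulr0 sub0r mul1r -EFinB.
  by congr EFin; field; rewrite gt_eqF.
- apply: continuous_subspaceT; exact: cdF.
- apply: (@norm_le_cvg0 _ _ _ _ (fun s => expR (- s) * ((`|w| + 1) / (1 + w ^+ 2) + 1))).
    move=> s; rewrite /F normrM ger0_norm ?expR_ge0// ler_wpM2l ?expR_ge0//.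
    rewrite (le_trans (ler_normB _ _))// normr1 lerD2r normrM normfV (gtr0_norm w1).
    rewrite ler_wpM2r ?invr_ge0 ?(ltW w1)// (le_trans (ler_normB _ _))// normrM.
    by rewrite lerD ?cos_max// ler_piMr// sin_max.
  rewrite -[X in _ --> X](mul0r ((`|w| + 1) / (1 + w ^+ 2) + 1)).
  apply: cvgM; last exact: cvg_cst.
  exact: cvgr_expR.
- by apply: cvg_at_right_filter; exact: cF.
- by move=> s _; rewrite derive1E; apply: derive_val.
Qed.

Lemma laplacian_density_cos (w : R) :
  (\int[mu]_s (laplacian_density s * (1 + cos (s * w)))%:E =
    (2 * (1 + (1 + w ^+ 2)^-1))%:E)%E.
Proof.
have cc : continuous (fun s : R => laplacian_density s * (1 + cos (s * w))).
  move=> s; apply: continuousM; first exact: continuous_laplacian_density.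
  apply: continuousD; first exact: cst_continuous.
  exact: continuous_cosM.
rewrite ge0_symfun_integralT//.
- rewrite EFinM; congr (_ * _)%E.
  rewrite -laplacian_density_cos_half.
  rewrite (_ : [set x | 0 <= x] = `[0%R, +oo[%classic).
    apply: eq_integral => x; rewrite inE/= in_itv/= andbT => x0.
    by rewrite /laplacian_density ger0_norm.
  by apply/seteqP; split=> x/=; rewrite in_itv/= andbT.
- by move=> x; rewrite mulr_ge0 ?expR_ge0// -lerBlDl sub0r cos_geN1.
- by move=> x /=; rewrite /laplacian_density normrN mulNr cosN.
Qed.

Lemma integrable_laplacian_density : mu.-integrable setT (EFin \o laplacian_density).
Proof.
apply/integrableP; split.
  apply/measurable_EFinP; apply: continuous_measurable_fun.
  exact: continuous_laplacian_density.
apply: (@le_lt_trans _ _ (\int[mu]_s (laplacian_density s * (1 + cos (s * 0)))%:E)%E).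
  apply: ge0_le_integral => //.
  - apply/measurable_EFinP; apply: measurableT_comp => //.
    by apply: continuous_measurable_fun; exact: continuous_laplacian_density.
  - apply/measurable_EFinP; apply: measurable_funM.
      by apply: continuous_measurable_fun; exact: continuous_laplacian_density.
    by under eq_fun do rewrite mulr0; exact: measurable_cst.
  - move=> x _; rewrite /= lee_fin mulr0 cos0 ger0_norm ?expR_ge0//.
    by rewrite ler_peMr ?expR_ge0// lerDl.
by rewrite laplacian_density_cos ltry.
Qed.

Lemma laplacian_density_ge0 s : 0 <= laplacian_density s.
Proof. exact: expR_ge0. Qed.

Lemma laplacian_density_le1 s : laplacian_density s <= 1.
Proof. by rewrite -expR0 ler_expR oppr_le0. Qed.

Lemma measurable_mulr_cis (w : R) :
  cmeas setT (fun s : TR => cis (s * w)).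
Proof.
by apply: cmeas_cis; apply: measurable_funM => //; exact: measurable_cst.
Qed.

Lemma cintegrable_laplacian_density :
  cintegrable setT (fun s : TR => (laplacian_density s)%:C%C).
Proof. by split=> /=; [exact: integrable_laplacian_density|exact: integrable0]. Qed.

Lemma poisson_kernel (w : R) :
  cint setT (fun s : TR => (laplacian_density s)%:C%C * cis (s * w)) =
  (poisson w)%:C%C.
Proof.
have mc := measurable_mulr_cis w.
have ib : cintegrable setT (fun s : TR => cis (s * w) * (laplacian_density s)%:C%C).
  apply: (cintegrable_bndM (M := 1)) => //.
  - exact: cintegrable_laplacian_density.
  - by move=> x _; rewrite cn_cis.
have icos : mu.-integrable setT (EFin \o (fun s : TR => laplacian_density s * cos (s * w))).
  case: ib => i1 _; apply: eq_integrable i1 => // x _ /=.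
  by rewrite expR0 mul1r mulr0 subr0 mulrC.
have isin : mu.-integrable setT (EFin \o (fun s : TR => laplacian_density s * sin (s * w))).
  case: ib => _ i1; apply: eq_integrable i1 => // x _ /=.
  by rewrite expR0 !mul1r mulr0 add0r mulrC.
have key u : mu.-integrable setT (EFin \o (fun s : TR => laplacian_density s * cos (s * u))) ->
    (\int[mu]_s (laplacian_density s) + \int[mu]_s (laplacian_density s * cos (s * u))
    = 2 * (1 + (1 + u ^+ 2)^-1))%R.
  move=> iu; rewrite -RintegralD//; last exact: integrable_laplacian_density.
  rewrite /Rintegral -[RHS]/(fine (2 * (1 + (1 + u ^+ 2)^-1))%:E) -laplacian_density_cos.
  by congr fine; apply: eq_integral => x _; rewrite mulrDr mulr1.
(* At frequency 0 the formula reads [2 * mass = 4], which gives the total mass 2 to subtract at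
   [w]. *)
have e0 := key 0; have := key w icos.
have -> : (\int[mu]_s laplacian_density s)%R = 2.
  have : mu.-integrable setT (EFin \o (fun s : TR => laplacian_density s * cos (s * 0))).
    apply: eq_integrable integrable_laplacian_density => // x _ /=.
    by rewrite mulr0 cos0 mulr1.
  move=> /e0; under [X in _ + X]eq_Rintegral do rewrite mulr0 cos0 mulr1.
  by rewrite expr0n/= addr0 invr1; lra.
move=> h; apply: complexP; rewrite ?cint_Re ?cint_Im /=.
- have -> : poisson w = 2 * (1 + (1 + w ^+ 2)^-1) - 2 by rewrite /poisson; ring.
  rewrite -h [X in _ = X]addrAC subrr add0r.
  by apply: eq_Rintegral => s _; rewrite expR0 !mul1r mul0r subr0.
- transitivity (\int[mu]_s (laplacian_density s * sin (s * w)))%R.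
    by apply: eq_Rintegral => s _; rewrite expR0 !mul1r mul0r addr0.
  (* The sine integral vanishes: the reflection [s -> - s] changes its sign. *)
  have n1 : (-1 : R) != 0 by rewrite oppr_eq0 oner_eq0.
  have := Rintegral_affine 0 n1 isin.
  rewrite normrN1 invr1 mul1r.
  under eq_Rintegral do rewrite addr0 mulN1r mulNr sinN mulrN
    /laplacian_density normrN -/(laplacian_density _) -mulN1r.
  rewrite RintegralZl//; lra.
Qed.

Lemma integrable_poisson : mu.-integrable setT (EFin \o (poisson : TR -> R)).
Proof.
have mp : measurable_fun setT (poisson : TR -> R).
  have h : measurable_fun setT (poisson : R -> R).
    exact: (continuous_measurable_fun continuous_poisson).
  exact: h.
apply/integrableP; split; first exact/measurable_EFinP.
under eq_integral do rewrite /= ger0_norm ?(ltW (poisson_gt0 _))//.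
rewrite ge0_symfun_integralT; last 3 first.
- by move=> x; rewrite ltW// poisson_gt0.
- exact: continuous_poisson.
- by move=> x /=; rewrite /poisson sqrrN.
rewrite (_ : [set x | 0 <= x] = `[0%R, +oo[%classic); last first.
  by apply/seteqP; split=> x/=; rewrite in_itv/= andbT.
rewrite (@ge0_continuous_FTC2y R _ (fun x => 2 * atan x) 0 (2 * (pi / 2))) //.
- by rewrite -EFinB -EFinM ltry.
- by move=> x _; rewrite ltW// poisson_gt0.
- apply: continuous_subspaceT; exact: continuous_poisson.
- by apply: cvgM; [exact: cvg_cst|exact: cvgy_atan].
- by apply: cvg_at_right_filter; apply: cvgM; [exact: cvg_cst|exact: continuous_atan].
- move=> x _; rewrite derive1E deriveZ//= /GRing.scale/= -derive1E derive1_atan.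
  by [].
Qed.

Definition poisson_mass : R := (\int[mu]_(w in setT) poisson w)%R.

Lemma poisson_mass_gt0 : 0 < poisson_mass.
Proof.
(* The kernel is at least 1 on [[0, 1]]. *)
have : (1 <= poisson_mass)%R.
  have <- : (\int[mu]_(w in `[0%R, 1%R]) (cst 1 w))%R = 1 :> R.
    rewrite Rintegral_cst// mul1r.
    by have := @lebesgue_measure_itv R `[0, 1]%R; rewrite /= lte_fin ltr01 oppr0 adde0 => ->.
  rewrite Rintegral_mkcond; apply: le_Rintegral => //.
  - apply: (le_integrable _ _ _ integrable_poisson) => //.
    + apply/measurable_EFinP; apply/(measurable_restrictT (cst (1 : R))) => //.
    + move=> x _ /=; rewrite lee_fin patchE (ger0_norm (ltW (poisson_gt0 _))).
      case: ifPn => [/set_mem/=|_]; last by rewrite normr0 ltW// poisson_gt0.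
      rewrite in_itv/= => /andP[x0 x1]; rewrite normr1 /poisson ler_pdivlMr ?poisson_den_gt0//.
      by rewrite mul1r -lerBrDl (le_trans (_ : _ <= 1))// ?expr_le1//; lra.
  - exact: integrable_poisson.
  - move=> x _; rewrite patchE.
    case: ifPn => [/set_mem/=|_]; last by rewrite ltW// poisson_gt0.
    rewrite in_itv/= => /andP[x0 x1]; rewrite /poisson ler_pdivlMr ?poisson_den_gt0//.
    by rewrite mul1r -lerBrDl (le_trans (_ : _ <= 1))// ?expr_le1//; lra.
by apply: lt_le_trans.
Qed.

End Poisson.

Section FourierInversion.
Context {R : realType}.
Local Notation mu := (@lebesgue_measure R).
Local Notation TR := (measurableTypeR R).

Lemma fourierE (p : R -> R[i]) (s : R) :
  fourier p s = cint setT (fun u => cis (- (s * u)) * p u).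
Proof.
apply: eq_cint => u _; congr (_ * _).
by rewrite /cis; congr cexp; apply: complexP => /=; rewrite ?oppr0.
Qed.

Lemma cmeas_cis_lin (a b : R) : cmeas setT (fun u : TR => cis (a * u + b)).
Proof.
by apply: cmeas_cis; exact: measurable_affine.
Qed.

Lemma cmeas_cisN (s : R) : cmeas setT (fun u : TR => cis (- (s * u))).
Proof.
have := cmeas_cis_lin (- s) 0.
by under eq_fun do rewrite addr0 mulNr.
Qed.

Lemma cintegrable_cisM (th : TR -> R) (p : TR -> R[i]) :
  measurable_fun setT th -> cintegrable setT p ->
  cintegrable setT (fun u => cis (th u) * p u).
Proof.
move=> mth ip; apply: (cintegrable_bndM (M := 1)) => //; first exact: cmeas_cis.
by move=> x _; rewrite cn_cis.
Qed.

Lemma cintegrable_Mcis (th : TR -> R) (p : TR -> R[i]) :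
  measurable_fun setT th -> cintegrable setT p ->
  cintegrable setT (fun u => p u * cis (th u)).
Proof.
move=> mth ip; apply: eq_cintegrable (cintegrable_cisM mth ip) => // u _.
exact: mulrC.
Qed.

Lemma cn_fourier_le (p : TR -> R[i]) (s : R) : cintegrable setT p ->
  cn (fourier p s) <= 2 * (\int[mu]_(u in setT) cn (p u))%R.
Proof.
move=> ip; rewrite fourierE; apply: cn_cint_le => //.
- by apply: cmeasM; [exact: cmeas_cisN|exact: cintegrable_meas].
- exact: cintegrable_cn.
- by move=> u _; rewrite cnM cn_cis mul1r.
Qed.

Lemma cn_cvg0M (z_ : nat -> R[i]) z w :
  cn (z_ n - z) @[n --> \oo] --> (0 : R) ->
  cn (w * z_ n - w * z) @[n --> \oo] --> (0 : R).
Proof.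
move=> h; apply: (norm_le_cvg0 _ (cvg0_cstM (cn w) h)) => n.
by rewrite -mulrBr cnM ger0_norm// mulr_ge0 ?cn_ge0.
Qed.

Lemma cn_cvg_unique (z_ : nat -> R[i]) z w :
  cn (z_ n - z) @[n --> \oo] --> (0 : R) ->
  cn (z_ n - w) @[n --> \oo] --> (0 : R) -> z = w.
Proof.
move=> hz hw; apply/eqP; rewrite -subr_eq0; apply/eqP/cn_eq0.
have h : cn (z_ n - z) + cn (z_ n - w) @[n --> \oo] --> (0 : R).
  by rewrite -[X in _ --> X](addr0 0); exact: cvgD.
apply: (@cvg0_cst R nat \oo); apply: (norm_le_cvg0 _ h) => n.
rewrite ger0_norm ?cn_ge0//.
have -> : z - w = (z_ n - w) - (z_ n - z) by rewrite opprB [RHS]addrC addrA subrK.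
by rewrite (le_trans (cnB _ _))// addrC.
Qed.

Lemma cis_cvg (a_ : nat -> R) (a : R) : a_ @ \oo --> a ->
  cn (cis (a_ n) - cis a) @[n --> \oo] --> (0 : R).
Proof.
move=> ha.
have hc : cos (a_ n) @[n --> \oo] --> cos a.
  by apply: (cvg_comp _ _ ha); exact: continuous_cos.
have hs : sin (a_ n) @[n --> \oo] --> sin a.
  by apply: (cvg_comp _ _ ha); exact: continuous_sin.
apply: (@norm_le_cvg0 _ _ _ _ (fun n => `|cos (a_ n) - cos a| + `|sin (a_ n) - sin a|)).
  move=> n; rewrite ger0_norm ?cn_ge0//.
  by have := cn_le (cis (a_ n) - cis a); rewrite !cisE.
rewrite -[X in _ --> X](addr0 0); apply: cvgD.
  by move/subr_cvg0 : hc => /cvg_norm; rewrite normr0.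
by move/subr_cvg0 : hs => /cvg_norm; rewrite normr0.
Qed.

(** Sequential form, so that continuity of an integral in a parameter follows from [cint_cvg]. *)
Lemma ccontinuous_cvg (g : R -> R[i]) :
  (forall (u : nat -> R) x, u @ \oo --> x ->
    cn (g (u n) - g x) @[n --> \oo] --> (0 : R)) ->
  ccontinuous g.
Proof.
move=> h; split=> x; apply/(@cvg_nbhsP _ R^o) => u ux; apply/subr_cvg0.
- apply: (norm_le_cvg0 _ (h u x ux)) => n; rewrite -cReB; exact: Re_le_cn.
- apply: (norm_le_cvg0 _ (h u x ux)) => n; rewrite -cImB; exact: Im_le_cn.
Qed.

Lemma ccontinuous_cmeas (g : R -> R[i]) : ccontinuous g ->
  cmeas (setT : set TR) g.
Proof. by move=> [c1 c2]; split; exact: continuous_measurable_fun. Qed.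

Lemma ccontinuous_fourier (p : TR -> R[i]) : cintegrable setT p ->
  ccontinuous (fourier p).
Proof.
move=> ip; apply: ccontinuous_cvg => u x ux.
suff : cn (cint setT (fun v => cis (- (u n * v)) * p v) -
      cint setT (fun v => cis (- (x * v)) * p v)) @[n --> \oo] --> (0 : R).
  by apply: norm_le_cvg0 => n; rewrite !fourierE ger0_norm ?cn_ge0.
apply: (@cint_cvg _ setT (fun n v => cis (- (u n * v)) * p v) _ (fun v => cn (p v))) => //.
- by move=> n; apply: cmeasM; [exact: cmeas_cisN|exact: cintegrable_meas].
- by apply: cmeasM; [exact: cmeas_cisN|exact: cintegrable_meas].
- exact: cintegrable_cn.
- by move=> n v _; rewrite cnM cn_cis mul1r.
- apply: aeW => v _.
  have h : (fun n => - (u n * v)) @ \oo --> - (x * v).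
    by apply: cvgN; exact: (cvgMr_tmp (b := v) ux).
  have := cn_cvg0M (p v) (cis_cvg h).
  by apply: norm_le_cvg0 => n; rewrite ger0_norm ?cn_ge0// mulrC [_ * p v]mulrC.
Qed.

(** Fubini with the majorant [cn (K s) * cn (p u)]. It serves to produce Poisson kernels, to move
    the transform off [phi], and to estimate the low frequencies. *)
Lemma fourier_pairing (K p : TR -> R[i]) (x : R) :
  cintegrable setT K -> cintegrable setT p ->
  cint setT (fun s => K s * (cis (s * x) * fourier p s)) =
  cint setT (fun u => p u * cint setT (fun s => K s * cis (s * (x - u)))).
Proof.
move=> iK ip.
pose k (z : TR * TR) : R[i] := K z.1 * (cis (z.1 * x) * (cis (- (z.1 * z.2)) * p z.2)).
have mK := cintegrable_meas iK; have mp := cintegrable_meas ip.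
have mk : cmeas setT k.
  have m1 : measurable_fun setT (fun z : TR * TR => z.1) by exact: measurable_fst.
  have m2 : measurable_fun setT (fun z : TR * TR => z.2) by exact: measurable_snd.
  apply: cmeasM; first exact: (cmeas_comp mK m1).
  apply: cmeasM; first by apply: cmeas_cis; apply: measurable_funM => //; exact: measurable_cst.
  apply: cmeasM; last exact: (cmeas_comp mp m2).
  by apply: cmeas_cis; apply: measurableT_comp => //; exact: measurable_funM.
have := @cfubini_prod R k (fun s => cn (K s)) (fun u => cn (p u)) mk
  (cintegrable_cn measurableT iK) (cintegrable_cn measurableT ip).
move=> /(_ _)/wrap[|H]; first by move=> s u; rewrite /k/= !cnM !cn_cis !mul1r.
transitivity (cint setT (fun s => cint setT (fun u => k (s, u)))).
  apply: eq_cint => s _; rewrite fourierE.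
  have i1 : cintegrable setT (fun u : TR => cis (- (s * u)) * p u).
    apply: cintegrable_cisM ip.
    by apply: (@measurable_eq_affine _ (- s) 0) => u; ring.
  rewrite -(cintZ _ measurableT i1).
  by rewrite -(cintZ _ measurableT (cintegrableZ _ measurableT i1)).
rewrite H; apply: eq_cint => u _.
have i2 : cintegrable setT (fun s : TR => K s * cis (s * (x - u))).
  apply: cintegrable_Mcis iK.
  by apply: (@measurable_eq_affine _ (x - u) 0) => s; ring.
rewrite -(cintZ _ measurableT i2).
apply: eq_cint => s _; rewrite /k/=.
have -> : cis (s * (x - u)) = cis (s * x) * cis (- (s * u)) by rewrite -cisD mulrBr.
ring.
Qed.

(** Pointwise, because the functions to be inverted vanish on the negative axis and may jump at
    0. *)
Definition c_continuous_at (p : R -> R[i]) (x : R) :=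
  forall u : nat -> R, u @ \oo --> x -> cn (p (u n) - p x) @[n --> \oo] --> (0 : R).

Lemma natinv_cvg0 : (fun n => n.+1%:R^-1 : R) @ \oo --> (0 : R).
Proof. exact: cvg_harmonic. Qed.

(** The Abel weight [exp (- e |s|)] has a dilated Poisson kernel as transform; the substitution
    [u = x - e y] removes the dilation from the kernel. *)
Lemma poisson_convolution (p : TR -> R[i]) (e x : R) : cintegrable setT p -> 0 < e ->
  cint setT (fun s => (laplacian_density (e * s))%:C%C * (cis (s * x) * fourier p s)) =
  cint setT (fun y => p (x - e * y) * (poisson y)%:C%C).
Proof.
move=> ip e0.
have iKe : cintegrable setT (fun s : TR => (laplacian_density (e * s))%:C%C).
  have := cintegrable_affine 0 (lt0r_neq0 e0) cintegrable_laplacian_density.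
  by apply: eq_cintegrable => // s _; rewrite addr0.
rewrite fourier_pairing//.
have kE w : cint setT (fun s => (laplacian_density (e * s))%:C%C * cis (s * w)) =
    (e^-1 * poisson (w / e))%:C%C.
  have ie : cintegrable setT (fun s : TR => (laplacian_density s)%:C%C * cis (s * (w / e))).
    have := cintegrable_cisM (th := fun s => s * (w / e)) _ cintegrable_laplacian_density.
    move=> /(_ _)/wrap[|]; first by apply: measurable_funM => //; exact: measurable_cst.
    by apply: eq_cintegrable => // s _; rewrite mulrC.
  have := cint_affine 0 (lt0r_neq0 e0) ie.
  rewrite poisson_kernel gtr0_norm// => h; rewrite rmorphM -h.
  apply: eq_cint => s _; rewrite addr0; congr (_ * cis _).
  by field; rewrite gt_eqF.
under eq_cint do rewrite kE.
have ne0 : - e != 0 by rewrite oppr_eq0 gt_eqF.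
have ipk : cintegrable setT (fun u : TR => p u * (poisson ((x - u) / e))%:C%C).
  have : cintegrable setT (fun u : TR => (poisson ((x - u) / e))%:C%C * p u).
    apply: (cintegrable_bndM (M := 2)) => //.
    - apply: cmeas_real; apply: measurableT_comp.
        exact: (continuous_measurable_fun continuous_poisson).
      by apply: (@measurable_eq_affine _ (- e^-1) (x / e)) => u; ring.
    - move=> u _; rewrite cn_real ger0_norm ?(ltW (poisson_gt0 _))//.
      by rewrite /poisson ler_pdivrMr ?poisson_den_gt0// ler_peMr// lerDl sqr_ge0.
  by apply: eq_cintegrable => // s _; rewrite mulrC.
have := cint_affine x ne0 ipk; rewrite normrN gtr0_norm// -cintZ// => h.
transitivity (cint setT (fun u : TR => (e^-1)%:C%C * (p u * (poisson ((x - u) / e))%:C%C))).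
  by apply: eq_cint => u _; rewrite rmorphM/=; ring.
rewrite -h; apply: eq_cint => y _.
have -> : (x - (- e * y + x)) / e = y by field; rewrite gt_eqF.
by congr (p _ * _); ring.
Qed.

(* Pairing the Abel means of [fourier phi * fourier p] with Poisson kernels;
   the normalising constant [poisson_mass] (which is [2 pi]) is never needed
   explicitly. *)
Lemma fourier_inversion_conv (phi p : TR -> R[i]) (B t : R) :
  cintegrable setT phi -> cintegrable setT p -> (forall x, cn (p x) <= B) ->
  (forall x, x != 0 -> c_continuous_at p x) ->
  cintegrable setT (fourier phi) ->
  cint setT (fun s => fourier phi s * (cis (s * t) * fourier p s)) =
  (poisson_mass : R)%:C%C * cint setT (fun v => phi v * p (t - v)).
Proof.
move=> iphi ip pB cp iPhi.
pose e n : R := n.+1%:R^-1.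
have e0 n : 0 < e n by rewrite invr_gt0.
have cP := ccontinuous_cmeas (ccontinuous_fourier iphi).
have cp_ := ccontinuous_cmeas (ccontinuous_fourier ip).
have mphi := cintegrable_meas iphi; have mp := cintegrable_meas ip.
have B0 : 0 <= B := le_trans (cn_ge0 _) (pB 0).
set M := 2 * (\int[mu]_(u in setT) cn (p u))%R.
have mcis x : cmeas setT (fun s : TR => cis (s * x)).
  exact: measurable_mulr_cis.
have mlap n : cmeas setT (fun s : TR => (laplacian_density (e n * s))%:C%C).
  apply: cmeas_real; have := @continuous_comp R R R ( *%R (e n)) laplacian_density.
  move=> h; apply: continuous_measurable_fun => s; apply: h; first exact: mulrl_continuous.
  exact: continuous_laplacian_density.
pose A n := cint setT (fun s => (laplacian_density (e n * s))%:C%C *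
  (fourier phi s * (cis (s * t) * fourier p s))).
have lim1 : cn (A n - cint setT (fun s => fourier phi s * (cis (s * t) * fourier p s)))
    @[n --> \oo] --> (0 : R).
  apply: (@cint_cvg R setT (fun n s => (laplacian_density (e n * s))%:C%C *
     (fourier phi s * (cis (s * t) * fourier p s))) _ (fun s => cn (fourier phi s) * M)) => //.
  - by move=> n; do !apply: cmeasM.
  - by do !apply: cmeasM.
  - have := RintegralZl_le M measurableT (cintegrable_cn measurableT iPhi).
    by apply: eq_integrable => // x _ /=; rewrite mulrC.
  - move=> n s _; rewrite cnM cn_real ger0_norm ?laplacian_density_ge0//.
    rewrite (le_trans (ler_piMl (cn_ge0 _) (laplacian_density_le1 _)))//.
    by rewrite !cnM cn_cis mul1r ler_wpM2l ?cn_ge0// cn_fourier_le.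
  - apply: aeW => s _; set z := fourier phi s * _.
    have h : (fun n => laplacian_density (e n * s)) @ \oo --> (1 : R).
      rewrite (_ : 1 = laplacian_density (0 * s)); last first.
        by rewrite mul0r /laplacian_density normr0 oppr0 expR0.
      have h : (fun n => e n * s) @ \oo --> 0 * s.
        exact: (cvgMr_tmp (b := s) natinv_cvg0).
      by apply: (cvg_comp _ _ h); exact: continuous_laplacian_density.
    move/subr_cvg0/cvg_norm : h; rewrite normr0 => /(cvg0_cstM (cn z)).
    apply: norm_le_cvg0 => n; rewrite ger0_norm ?cn_ge0//.
    rewrite -[X in _ - X]mul1r -mulrBl cnM mulrC ler_wpM2l ?cn_ge0//.
    by rewrite -(rmorph1 (real_complex R)) -rmorphB/= cn_real.
(* The Abel-weighted transform of [p] is used as the kernel of [fourier_pairing] against [phi]; the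
   inner integral is then a Poisson average of [p] around [t - v]. *)
have AE n : A n = cint setT (fun v => phi v *
    cint setT (fun y => p (t - v - e n * y) * (poisson y)%:C%C)).
  have [q qE] : exists q : TR -> R[i], forall s, q s =
      (laplacian_density (e n * s))%:C%C * (cis (s * t) * fourier p s) by eexists.
  have iq : cintegrable setT q.
    have : cintegrable setT (fun s : TR => (cis (s * t) * fourier p s) * (laplacian_density (e n * s))%:C%C).
      apply: (cintegrable_bndM (M := M)) => //.
      - have := cintegrable_affine 0 (lt0r_neq0 (e0 n)) cintegrable_laplacian_density.
        by apply: eq_cintegrable => // s _; rewrite addr0.
      - exact: cmeasM.
      - by move=> s _; rewrite cnM cn_cis mul1r cn_fourier_le.
    by apply: eq_cintegrable => // s _; rewrite qE mulrC.
  transitivity (cint setT (fun s => q s * (cis (s * 0) * fourier phi s))).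
    apply: eq_cint => s _; rewrite mulr0 cis0 qE mul1r -!mulrA; congr (_ * _).
    by rewrite mulrC -mulrA.
  rewrite (fourier_pairing 0 iq iphi).
  apply: eq_cint => v _; congr (_ * _).
  rewrite -(poisson_convolution (t - v) ip (e0 n)).
  apply: eq_cint => s _; rewrite qE.
  have -> : cis (s * (t - v)) = cis (s * t) * cis (s * (0 - v)).
    by rewrite -cisD -mulrDr add0r.
  by rewrite -!mulrA; congr (_ * (_ * _)); rewrite mulrC.
have lim2 : cn (A n - (poisson_mass : R)%:C%C * cint setT (fun v => phi v * p (t - v)))
    @[n --> \oo] --> (0 : R).
  have mpt x a : cmeas setT (fun y : TR => p (x - a * y)).
    have := @measurable_affine R (- a) x => ma.
    have := cmeas_comp mp ma.
    by under eq_fun do rewrite mulNr addrC.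
  have ipt : cintegrable setT (fun v => p (t - v) * phi v).
    apply: (cintegrable_bndM (M := B)) => //.
    by have := mpt t 1; under eq_fun do rewrite mul1r.
  have -> : (poisson_mass : R)%:C%C * cint setT (fun v => phi v * p (t - v)) =
      cint setT (fun v => phi v * (p (t - v) * (poisson_mass : R)%:C%C)).
    rewrite -cintZ//; last by apply: eq_cintegrable ipt => // v _; rewrite mulrC.
    by apply: eq_cint => v _; ring.
  have ipp x a : cintegrable setT (fun y : TR => p (x - a * y) * (poisson y)%:C%C).
    apply: (cintegrable_bndM (M := B)) => //.
    by split=> /=; [exact: integrable_poisson|exact: integrable0].
  set W := fun n (v : TR) => cint setT (fun y => p (t - v - e n * y) * (poisson y)%:C%C).
  suff H : cn (cint setT (fun v => phi v * W n v) -
      cint setT (fun v => phi v * (p (t - v) * (poisson_mass : R)%:C%C))) @[n --> \oo] --> (0 : R).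
    by apply: norm_le_cvg0 H => n; rewrite AE ger0_norm ?cn_ge0.
  have cW n v : cn (W n v) <= 2 * (B * poisson_mass).
    rewrite /poisson_mass -RintegralZl//; last exact: integrable_poisson.
    apply: cn_cint_le => //.
    - exact: cintegrable_meas.
    - exact: RintegralZl_le _ _ integrable_poisson.
    - move=> y _; rewrite cnM cn_real ger0_norm ?(ltW (poisson_gt0 _))//.
      by rewrite ler_wpM2r ?(ltW (poisson_gt0 _)).
  apply: (@cint_cvg R setT (fun n v => phi v * W n v) _
    (fun v => (2 * (B * poisson_mass)) * cn (phi v))) => //.
  - move=> n; apply: cmeasM => //.
    (* In this form [v] enters only through [cis], so [W n] is continuous and therefore
       measurable. *)
    have WE v : W n v = cint setT (fun s => (laplacian_density (e n * s))%:C%C *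
        (cis (s * (t - v)) * fourier p s)).
      by rewrite /W -poisson_convolution.
    have : ccontinuous (W n); last exact: ccontinuous_cmeas.
    apply: ccontinuous_cvg => u x ux.
    suff : cn (cint setT (fun s => (laplacian_density (e n * s))%:C%C * (cis (s * (t - u k)) * fourier p s)) -
      cint setT (fun s => (laplacian_density (e n * s))%:C%C * (cis (s * (t - x)) * fourier p s))) @[k --> \oo] --> (0 : R).
      by apply: norm_le_cvg0 => k; rewrite !WE ger0_norm ?cn_ge0.
    apply: (@cint_cvg R setT (fun k s => (laplacian_density (e n * s))%:C%C * (cis (s * (t - u k)) * fourier p s)) _
       (fun s => M * laplacian_density (e n * s))) => //.
    + by move=> k; do !apply: cmeasM.
    + by do !apply: cmeasM.
    + apply: RintegralZl_le => //.
      have [i1 _] := cintegrable_affine 0 (lt0r_neq0 (e0 n)) cintegrable_laplacian_density.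
      by apply: eq_integrable i1 => // s _ /=; rewrite addr0.
    + move=> k s _; rewrite !cnM cn_cis mul1r cn_real ger0_norm ?laplacian_density_ge0//.
      by rewrite mulrC ler_wpM2r ?laplacian_density_ge0// cn_fourier_le.
    + apply: aeW => s _; apply: cn_cvg0M.
      have h : (fun k => s * (t - u k)) @ \oo --> s * (t - x).
        by apply: cvgMl_tmp; apply: cvgB => //; exact: cvg_cst.
      have := cn_cvg0M (fourier p s) (cis_cvg h).
      by apply: norm_le_cvg0 => k; rewrite ger0_norm ?cn_ge0// mulrC [_ * fourier p s]mulrC.
  - apply: cmeasM => //; apply: cmeasM; last exact: cmeas_cst.
    by have := mpt t 1; under eq_fun do rewrite mul1r.
  - exact: RintegralZl_le _ _ (cintegrable_cn _ _).
  - by move=> n v _; rewrite cnM mulrC ler_wpM2r ?cn_ge0.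
  (* Continuity of [p] at [t - v] is known except for [v = t], a null set. *)
  - have : {ae mu, forall v : TR, v != t}.
      exists [set t]; split; first exact: measurable_set1.
        exact: lebesgue_measure_set1.
      by move=> v /= /negP; rewrite negbK => /eqP.
    apply: filterS => v vt _; apply: cn_cvg0M.
    have E : p (t - v) * (poisson_mass : R)%:C%C =
        cint setT (fun y => p (t - v) * (poisson y)%:C%C).
      rewrite cintZ//; last by split=> /=; [exact: integrable_poisson|exact: integrable0].
      congr (_ * _); apply: complexP; first by [].
      by rewrite cint_Im/= /Rintegral integral0.
    rewrite E.
    apply: (@cint_cvg R setT (fun n y => p (t - v - e n * y) * (poisson y)%:C%C) _
      (fun y => B * poisson y)) => //.
    + by move=> n; exact: cintegrable_meas.
    + apply: cmeasM; first exact: cmeas_cst.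
      by apply: cmeas_real; exact: (continuous_measurable_fun continuous_poisson).
    + exact: RintegralZl_le _ _ integrable_poisson.
    + move=> n y _; rewrite cnM cn_real ger0_norm ?(ltW (poisson_gt0 _))//.
      by rewrite ler_wpM2r ?(ltW (poisson_gt0 _)).
    + apply: aeW => y _.
      have tv : t - v != 0 by rewrite subr_eq0 eq_sym.
      have h : (fun n => t - v - e n * y) @ \oo --> t - v.
        rewrite -[X in _ --> X]subr0; apply: cvgB; first exact: cvg_cst.
        by rewrite -[X in _ --> X](mul0r y); exact: (cvgMr_tmp (b := y) natinv_cvg0).
      have := cn_cvg0M (poisson y)%:C%C (cp _ tv _ h).
      apply: norm_le_cvg0 => n.
      by rewrite ger0_norm ?cn_ge0// mulrC [_ * (poisson y)%:C%C]mulrC.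
exact: cn_cvg_unique lim1 lim2.
Qed.

End FourierInversion.

(** * Smooth cutoffs *)

Section Bump.
Context {R : realType}.
Local Notation mu := (@lebesgue_measure R).
Local Notation TR := (measurableTypeR R).

(** A family closed under differentiation: the derivative of the member [(P, n)] is the member
    [(bump_next P n, n + 2)]. All derivatives of the standard bump are thus treated at once. *)
Definition bump_fam (P : {poly R}) (n : nat) (x : R) : R :=
  if `|x| < 1 then P.[x] * (((1 - x ^+ 2)^-1) ^+ n * expR (- (1 - x ^+ 2)^-1)) else 0.

Definition bump_next (P : {poly R}) (n : nat) : {poly R} :=
  P^`() * (1 - 'X^2) ^+ 2 + (2 * n%:R)%:P * 'X * P * (1 - 'X^2) - 2%:P * 'X * P.

Lemma sqr_absr (x : R) : `|x| ^+ 2 = x ^+ 2.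
Proof. by rewrite -normrX ger0_norm// sqr_ge0. Qed.

(** The m-th power of [exp (- z) <= 1 / z] at [z = 1 / (m y)]. *)
Lemma expRN_inv_le (y : R) (m : nat) : 0 < y -> expR (- y^-1) <= (m%:R * y) ^+ m.
Proof.
move=> y0; case: m => [|m]; first by rewrite expr0 expR_le1 oppr_le0 invr_ge0 ltW.
have m0 : 0 < m.+1%:R * y by rewrite mulr_gt0.
have -> : - y^-1 = m.+1%:R * (- (m.+1%:R * y)^-1) by field; rewrite gt_eqF// nat1r pnatr_eq0.
rewrite expRM_natl lerXn2r ?nnegrE ?expR_ge0 ?(ltW m0)//.
rewrite -[leRHS]invrK expRN lef_pV2 ?posrE ?expR_gt0 ?invr_gt0//.
by rewrite (le_trans _ (expR_ge1Dx _))// lerDr.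
Qed.

(** With exponent [n + 2] in [expRN_inv_le], n powers cancel the pole and two remain, enough for a
    zero derivative at the points of modulus 1. The 4 bounds [(1 + |x|) ^ 2]. *)
Lemma bump_fam_flat (P : {poly R}) (n : nat) : exists2 C, 0 <= C &
  forall x, `|bump_fam P n x| <= C * (1 - `|x|) ^+ 2.
Proof.
have [c _ hc] : exists2 c, c \in `[-1, 1]%R & forall x, x \in `[-1, 1]%R -> `|P.[x]| <= `|P.[c]|.
  apply: EVT_max; first by lra.
  apply: continuous_subspaceT => x.
  by apply: continuous_comp; [exact: continuous_horner|exact: norm_continuous].
have C0 : 0 <= `|P.[c]| * ((n.+2)%:R ^+ n.+2 * 4).
  by rewrite mulr_ge0// mulr_ge0// exprn_ge0.
exists (`|P.[c]| * ((n.+2)%:R ^+ n.+2 * 4)); first exact: C0.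
move=> x; rewrite /bump_fam; case: ifPn => [x1|_]; last first.
  by rewrite normr0 mulr_ge0// sqr_ge0.
have x2 : x ^+ 2 = `|x| ^+ 2 by rewrite sqr_absr.
have x0 : 0 <= `|x| by [].
have yE : 1 - x ^+ 2 = (1 - `|x|) * (1 + `|x|) by rewrite x2; ring.
set y := 1 - x ^+ 2 in yE *.
have y0 : 0 < y by rewrite yE mulr_gt0//; lra.
rewrite normrM -mulrA ler_pM//.
  by apply: hc; rewrite in_itv/=; move: x1; rewrite ltr_norml => /andP[? ?]; rewrite !ltW.
rewrite ger0_norm ?mulr_ge0 ?expR_ge0 ?exprn_ge0 ?invr_ge0 ?(ltW y0)//.
rewrite exprVn.
apply: (@le_trans _ _ (n.+2%:R ^+ n.+2 * y ^+ 2)).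
  rewrite mulrC ler_pdivrMr ?exprn_gt0//.
  apply: le_trans (expRN_inv_le n.+2 y0) _.
  by rewrite -mulrA -exprD add2n exprMn.
rewrite -[leRHS]mulrA ler_wpM2l ?exprn_ge0// yE exprMn mulrC ler_wpM2r ?sqr_ge0//.
rewrite (_ : 4 = 2 ^+ 2); last by rewrite expr2; ring.
by rewrite lerXn2r ?nnegrE//; lra.
Qed.

Lemma near_norm_lt1 (x : R) : `|x| < 1 -> \forall y \near x, `|y| < 1.
Proof.
move=> x1; have := @norm_continuous _ R x.
by move=> /cvgr_lt; apply.
Qed.

Lemma near_norm_gt1 (x : R) : 1 < `|x| -> \forall y \near x, 1 < `|y|.
Proof.
move=> x1; have := @norm_continuous _ R x.
by move=> /cvgr_gt; apply.
Qed.

Lemma is_derive_sq_bound (g : R -> R) (a C : R) :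
  (forall x, `|g x| <= C * (x - a) ^+ 2) -> is_derive a 1 g 0.
Proof.
move=> gC; have C0 : 0 <= C by have := gC (a + 1); rewrite addrAC subrr add0r expr1n mulr1; exact: le_trans.
have ga : g a = 0.
  by apply/eqP; rewrite -normr_le0 (le_trans (gC a))// subrr expr0n/= mulr0.
have H : h^-1 *: ((g \o shift a) (h *: 1) - g a) @[h --> 0^'] --> (0 : R).
  apply: (@norm_le_cvg0 _ _ _ _ (fun h => C * `|h|)) => [h|].
    rewrite ga subr0 /= /GRing.scale/= mulr1 normrM normfV.
    have [->|h0] := eqVneq h 0; first by rewrite normr0 invr0 !(mul0r, mulr0).
    rewrite mulrC ler_pdivrMr ?normr_gt0// (le_trans (gC _))// addrK.
    by rewrite -mulrA ler_wpM2l// -expr2 -normrX ler_norm.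
  apply: cvg0_cstM; rewrite -[X in _ --> X](@normr0 _ R).
  apply: cvg_norm; apply: cvg_within_filter; exact: cvg_id.
apply: DeriveDef; last exact: (cvg_lim _ H).
by apply/cvg_ex; exists 0.
Qed.

Lemma is_derive_bump_fam (P : {poly R}) (n : nat) (x : R) :
  is_derive x 1 (bump_fam P n) (bump_fam (bump_next P n) n.+2 x).
Proof.
have [x1|x1|x1] := ltgtP `|x| 1.
- have y0 : 1 - x ^+ 2 != 0.
    rewrite subr_eq0 eq_sym; apply: contraL x1 => /eqP x2.
    rewrite -leNgt -(@ler_pXn2r _ 2) ?nnegrE// expr1n -normrX x2.
    by rewrite normr1.
  apply: (near_eq_is_derive (f := fun z => P.[z] * (((1 - z ^+ 2)^-1) ^+ n * expR (- (1 - z ^+ 2)^-1)))).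
    by near=> z; rewrite /bump_fam ifT//; near: z; exact: near_norm_lt1.
  have Dy : is_derive x 1 (fun z : R => 1 - z ^+ 2) (- (2 * x)).
    by apply: trigger_derive; rewrite /GRing.scale /=; ring.
  have Du : is_derive x 1 (fun z : R => (1 - z ^+ 2)^-1) (2 * x * (1 - x ^+ 2)^-1 ^+ 2).
    have h := @is_deriveV R (fun z => 1 - z ^+ 2) x _ 1 y0 Dy.
    by apply: (is_derive_eq h); rewrite /GRing.scale /= -exprVn; ring.
  have De : is_derive x 1 (expR \o (fun z : R => - (1 - z ^+ 2)^-1))
      (expR (- (1 - x ^+ 2)^-1) * (- (2 * x * (1 - x ^+ 2)^-1 ^+ 2))).
    exact: is_derive1_comp (is_deriveN Du).
  have D := is_deriveM (is_derive_poly P x) (is_deriveM (is_deriveX n Du) De).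
  rewrite (_ : (fun z => _) = horner P * ((fun z : R => (1 - z ^+ 2)^-1) ^+ n *
     (expR \o (fun z : R => - (1 - z ^+ 2)^-1)))); last first.
    by apply/funext => z; rewrite !fctE.
  apply: (is_derive_eq D); rewrite /bump_fam x1 !exprSr.
  rewrite /bump_next !hornerE /GRing.scale /=.
  rewrite !fctE /=.
  set e := expR _; set y := 1 - x ^+ 2 in y0 *.
  have -> : n%:R * y^-1 ^+ n.-1 = n%:R * y^-1 ^+ n * y.
    case: n {D} => [|n]; first by rewrite !mul0r.
    by rewrite /= [in RHS]exprSr -!mulrA mulVf// mulr1.
  move: (y^-1 ^+ n) => v.
  by field.
- have -> : bump_fam (bump_next P n) n.+2 x = 0 by rewrite /bump_fam ltNge (ltW x1).
  apply: (near_eq_is_derive (f := fun=> 0)).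
  near=> z; rewrite /bump_fam ifF//; apply/negbTE; rewrite -leNgt ltW//; near: z; exact: near_norm_gt1.
- have -> : bump_fam (bump_next P n) n.+2 x = 0 by rewrite /bump_fam x1 ltxx.
  have [C C0 hC] := bump_fam_flat P n.
  apply: (@is_derive_sq_bound _ _ C) => z; apply: le_trans (hC z) _.
  rewrite ler_wpM2l// -x1 -[leLHS]sqr_absr -[leRHS]sqr_absr lerXn2r ?nnegrE//.
  by rewrite (le_trans (ler_dist_dist _ _))// distrC.
Unshelve. all: by end_near. Qed.

(** A smooth function carried together with explicit formulas for all its derivatives, which can be
    estimated directly. *)
Definition smooth_family (w : nat -> R -> R) :=
  forall i (x : R), is_derive x (1 : R) (w i) (w i.+1 x).

Lemma smooth_familyP w : smooth_family w -> smooth (w 0%N).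
Proof.
move=> fw n x; suff -> : iter n (fun g : R -> R => derive1 g) (w 0%N) = w n.
  by have [] := fw n x.
elim: n => [//|n IH] /=; rewrite IH; apply/funext => y.
by rewrite derive1E; exact: derive_val.
Qed.

Lemma smooth_family_continuous w : smooth_family w -> forall i, continuous (w i).
Proof. by move=> fw i; exact: continuous_is_derive (fw i). Qed.

Lemma smooth_family_affine w (a b c : R) : smooth_family w ->
  smooth_family (fun i x => c * (a ^+ i * w i (a * x + b))).
Proof.
move=> fw i x.
have D : is_derive x 1 (fun x : R => a * x + b) a.
  by apply: trigger_derive; rewrite /GRing.scale /=; ring.
have h := @is_derive1_comp R (w i) (fun x => a * x + b) x _ _ (fw i (a * x + b)) D.
have h2 := is_deriveZ (c * a ^+ i) h.
rewrite (_ : (fun x => _) = (c * a ^+ i) *: (w i \o (fun x => a * x + b))); last first.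
  by apply/funext => z; rewrite mulrA.
by apply: (is_derive_eq h2); rewrite /GRing.scale/= exprS; ring.
Qed.

Lemma smooth_familyB w v : smooth_family w -> smooth_family v ->
  smooth_family (fun i x => w i x - v i x).
Proof. by move=> fw fv i x; have := is_deriveB (fw i x) (fv i x). Qed.

Lemma continuous_bounded_itv (g : R -> R) (a b : R) : a <= b -> continuous g ->
  exists2 C, 0 <= C & forall x, a <= x <= b -> `|g x| <= C.
Proof.
move=> ab cg.
have [c _ hc] : exists2 c, c \in `[a, b]%R & forall x, x \in `[a, b]%R -> `|g x| <= `|g c|.
  apply: EVT_max => //; apply: continuous_subspaceT => x.
  by apply: continuous_comp; [exact: cg|exact: norm_continuous].
by exists `|g c| => // x xab; apply: hc; rewrite in_itv.
Qed.

Fixpoint bump_der (i : nat) : {poly R} * nat :=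
  if i is j.+1 then let p := bump_der j in (bump_next p.1 p.2, p.2.+2) else (1, 0%N).

Definition bump (i : nat) : R -> R := bump_fam (bump_der i).1 (bump_der i).2.

Lemma smooth_family_bump : smooth_family bump.
Proof. by move=> i x; exact: is_derive_bump_fam. Qed.

Lemma bump_out i (x : R) : 1 <= `|x| -> bump i x = 0.
Proof. by move=> x1; rewrite /bump /bump_fam ltNge x1. Qed.

Lemma bump0_ge0 (x : R) : 0 <= bump 0 x.
Proof.
rewrite /bump /bump_fam /= hornerC expr0 !mul1r.
by case: ifP => // _; exact: expR_ge0.
Qed.

Lemma integrable_bump (D : set TR) : measurable D -> mu.-integrable D (EFin \o bump 0).
Proof.
move=> mD; have cb := @smooth_family_continuous _ smooth_family_bump 0%N.
have [C C0 hC] := @continuous_bounded_itv _ (-1) 1 (ltac:(lra)) cb.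
have : mu.-integrable setT (EFin \o bump 0).
  apply: (@Rintegrable_support _ _ (-1) 1 C).
  - exact: continuous_measurable_fun.
  - move=> x; have [x1|x1] := leP 1 `|x|; first by rewrite bump_out// normr0.
    by apply: hC; rewrite -ler_norml ltW.
  - move=> x x1; rewrite bump_out// leNgt; apply: contra x1 => x1.
    by rewrite -ler_norml ltW.
by apply: integrableS.
Qed.

Definition bump_mass : R := (\int[mu]_(x in `]-oo, 1%R]) bump 0 x)%R.

Lemma bump_mass_gt0 : 0 < bump_mass.
Proof.
(* Here [1 / (1 - x ^ 2) <= 4 / 3 <= 2]. *)
have h (x : R) : x \in `[-2^-1, 2^-1]%R -> expR (-2) <= bump 0 x.
  rewrite in_itv/= -ler_norml => x1.
  rewrite /bump /bump_fam /= hornerC expr0 !mul1r ifT ?ler_expR ?lerN2; last by lra.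
  have x2 : x ^+ 2 <= 4^-1.
    by rewrite -sqr_absr (_ : 4^-1 = 2^-1 ^+ 2) ?lerXn2r ?nnegrE//; field.
  by rewrite -[leRHS]invrK lef_pV2 ?posrE; lra.
have h1 : 0 < (\int[mu]_(x in `[-2^-1, 2^-1]) (cst (expR (-2)) x))%R.
  rewrite Rintegral_cst//.
  have := @lebesgue_measure_itv R `[-2^-1, 2^-1]%R => /=; rewrite lte_fin ifT; last by lra.
  by move=> ->; rewrite -EFinB/= mulr_gt0 ?expR_gt0//; lra.
have h2 : (\int[mu]_(x in `[-2^-1, 2^-1]) (cst (expR (-2)) x) <=
    \int[mu]_(x in `[-2^-1, 2^-1]) bump 0 x)%R.
  apply: le_Rintegral => //.
  - apply: (@Rintegrable_le _ _ _ (bump 0)) => //.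
      exact: integrable_bump.
    by move=> x xI; rewrite ger0_norm ?expR_ge0// h.
  - exact: integrable_bump.
apply: (lt_le_trans h1); apply: (le_trans h2).
rewrite /bump_mass Rintegral_mkcond [leRHS]Rintegral_mkcond.
apply: le_Rintegral => //.
- rewrite -restrict_EFin; apply/(integrable_mkcond _ _).1 => //; exact: integrable_bump.
- rewrite -restrict_EFin; apply/(integrable_mkcond _ _).1 => //; exact: integrable_bump.
- move=> x _; rewrite !patchE; case: ifPn => [/set_mem/=|_].
    rewrite in_itv/= => /andP[x1 x2]; rewrite ifT//; apply/mem_set; rewrite /= in_itv/=.
    by lra.
  by case: ifP => // _; exact: bump0_ge0.
Qed.

Definition bump_prim (x : R) : R := (\int[mu]_(t in `]-oo, x]) bump 0 t)%R.

Lemma is_derive_bump_prim (x : R) : is_derive x 1 bump_prim (bump 0 x).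
Proof.
have x1 : x < x + 1 by rewrite ltrDl.
have ib : mu.-integrable [set` Interval (BInfty _ true) (BRight (x + 1))] (EFin \o bump 0).
  exact: integrable_bump.
have [d e] := @continuous_FTC1 R (bump 0) (BInfty _ true) x (x + 1) x1 ib (ltNyr x)
  (@smooth_family_continuous _ smooth_family_bump 0%N x).
by apply: DeriveDef; [exact: d|rewrite -derive1E; exact: e].
Qed.

Lemma bump_prim_out x : x <= -1 -> bump_prim x = 0.
Proof.
move=> x1; rewrite /bump_prim; transitivity (\int[mu]_(t in `]-oo, x]) cst (0 : R) t)%R.
  apply: eq_Rintegral => t; rewrite inE/= in_itv/= => tx; rewrite bump_out//.
  by rewrite -normrN (le_trans _ (ler_norm _))//; lra.
by rewrite /Rintegral integral0.
Qed.

Lemma bump_prim_mass x : 1 <= x -> bump_prim x = bump_mass.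
Proof.
move=> x1; rewrite /bump_prim /bump_mass Rintegral_mkcond [RHS]Rintegral_mkcond.
apply: eq_Rintegral => t _; rewrite !patchE.
case: ifPn => [_|/negP tx]; case: ifPn => [t1|/negP t1] //.
- rewrite bump_out// leNgt; apply/negP => /ltr_normlP[_ t2]; apply: t1.
  by apply/mem_set; rewrite /= in_itv/= ltW.
- move/set_mem : t1; rewrite /= in_itv/= => t1; exfalso; apply: tx; apply/mem_set.
  by rewrite /= in_itv/= (le_trans t1).
Qed.

Definition step (i : nat) (x : R) : R :=
  bump_mass^-1 * (if i is j.+1 then bump j x else bump_prim x).

Lemma smooth_family_step : smooth_family step.
Proof.
move=> [|i] x; rewrite /step.
  have := is_deriveZ bump_mass^-1 (is_derive_bump_prim x); exact.
have := is_deriveZ bump_mass^-1 (smooth_family_bump i x); exact.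
Qed.

Lemma step0_lo x : x <= -1 -> step 0 x = 0.
Proof. by move=> x1; rewrite /step bump_prim_out// mulr0. Qed.

Lemma step0_hi x : 1 <= x -> step 0 x = 1.
Proof. by move=> x1; rewrite /step bump_prim_mass// mulVf// gt_eqF// bump_mass_gt0. Qed.

Lemma stepS_out i x : 1 <= `|x| -> step i.+1 x = 0.
Proof. by move=> x1; rewrite /step bump_out// mulr0. Qed.

(* [cutoff 0] is [1] on [-1, 1] and vanishes off [-2, 2]; [cutoff i] is its
   [i]-th derivative. *)
Definition cutoff (i : nat) (x : R) : R :=
  2 ^+ i * step i (2 * x + 3) - 2 ^+ i * step i (2 * x - 3).

Lemma smooth_family_cutoff : smooth_family cutoff.
Proof.
have h1 := smooth_family_affine 2 3 1 smooth_family_step.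
have h2 := smooth_family_affine 2 (-3) 1 smooth_family_step.
by move=> i x; have := smooth_familyB h1 h2 i x; under [X in is_derive _ _ X]eq_fun do rewrite !mul1r; rewrite !mul1r.
Qed.

Lemma cutoff0_in x : `|x| <= 1 -> cutoff 0 x = 1.
Proof.
move=> /ler_normlP[x1 x2]; rewrite /cutoff expr0 !mul1r step0_hi ?step0_lo ?subr0//; lra.
Qed.

Lemma cutoff_out i x : 2 <= `|x| -> cutoff i x = 0.
Proof.
rewrite ler_normr => /orP[x2|x2]; case: i => [|i]; rewrite /cutoff.
- by rewrite !step0_hi ?subrr//; lra.
- by rewrite !stepS_out ?mulr0 ?subrr// ler_normr; apply/orP; left; lra.
- by rewrite !step0_lo ?mulr0 ?subrr//; lra.
- by rewrite !stepS_out ?mulr0 ?subrr// ler_normr; apply/orP; right; lra.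
Qed.

Lemma cutoffS_in i x : `|x| <= 1 -> cutoff i.+1 x = 0.
Proof.
move=> /ler_normlP[x1 x2]; rewrite /cutoff !stepS_out ?mulr0 ?subrr//.
- by rewrite ler_normr; apply/orP; right; lra.
- by rewrite ler_normr; apply/orP; left; lra.
Qed.

Lemma cutoff_bounded i : exists2 C, 0 <= C & forall x, `|cutoff i x| <= C.
Proof.
have [C C0 hC] := @continuous_bounded_itv _ (-2) 2 (ltac:(lra))
  (@smooth_family_continuous _ smooth_family_cutoff i).
exists C => // x; have [x2|x2] := leP 2 `|x|; first by rewrite cutoff_out// normr0.
by apply: hC; rewrite -ler_norml ltW.
Qed.

Lemma nondecreasing_is_derive (f df : R -> R) :
  (forall x : R, is_derive x (1 : R) f (df x)) -> (forall x, 0 <= df x) ->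
  forall x y, x <= y -> f x <= f y.
Proof.
move=> fd d0 x y; rewrite le_eqVlt => /predU1P[->//|xy].
have [c _ e] := MVT xy (fun z _ => fd z) (continuous_subspaceT (continuous_is_derive fd)).
by rewrite -subr_ge0 e mulr_ge0// subr_ge0 ltW.
Qed.

Lemma step0_bounds x : 0 <= step 0 x <= 1.
Proof.
have nd := nondecreasing_is_derive (smooth_family_step 0).
have d0 z : 0 <= step 1 z.
  by rewrite /step mulr_ge0 ?bump0_ge0// invr_ge0 ltW// bump_mass_gt0.
apply/andP; split.
- have h : Num.min x (-1) <= -1 by rewrite ge_min lexx orbT.
  by rewrite -(step0_lo h) nd// ge_min lexx.
- have h : 1 <= Num.max x 1 by rewrite le_max lexx orbT.
  by rewrite -(step0_hi h) nd// le_max lexx.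
Qed.

End Bump.

(** * Integration by parts *)

Section ComplexDerivative.
Context {R : realType}.
Local Notation mu := (@lebesgue_measure R).
Local Notation TR := (measurableTypeR R).
Local Notation Re := complex.Re.
Local Notation Im := complex.Im.
Implicit Types (U V : R -> R[i]) (u v : R[i]) (x : R).

Definition cder x V v :=
  is_derive x (1 : R) (fun y => Re (V y)) (Re v) /\
  is_derive x (1 : R) (fun y => Im (V y)) (Im v).

Lemma cderD x U u V v : cder x U u -> cder x V v ->
  cder x (fun y => U y + V y) (u + v).
Proof.
move=> [u1 u2] [v1 v2]; split.
- under eq_fun do rewrite cReD; rewrite cReD; exact: (is_deriveD u1 v1).
- under eq_fun do rewrite cImD; rewrite cImD; exact: (is_deriveD u2 v2).
Qed.

Lemma cderM x U u V v : cder x U u -> cder x V v ->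
  cder x (fun y => U y * V y) (u * V x + U x * v).
Proof.
move=> [u1 u2] [v1 v2]; split.
- under eq_fun do rewrite cReM.
  apply: (is_derive_eq (is_deriveB (is_deriveM u1 v1) (is_deriveM u2 v2))).
  by rewrite cReD !cReM /GRing.scale/=; ring.
- under eq_fun do rewrite cImM.
  apply: (is_derive_eq (is_deriveD (is_deriveM u1 v2) (is_deriveM u2 v1))).
  by rewrite cImD !cImM /GRing.scale/=; ring.
Qed.

Lemma cder_real x (f : R -> R) (d : R) : is_derive x (1 : R) f d ->
  cder x (fun y => (f y)%:C%C) d%:C%C.
Proof. by move=> fd; split => //=; exact: is_derive_cst. Qed.

Lemma cder_cst x (z : R[i]) : cder x (fun=> z) 0.
Proof. by split; exact: is_derive_cst. Qed.

Lemma cder_cis x (t : R) :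
  cder x (fun y => cis (y * t)) ('i%C * t%:C%C * cis (x * t)).
Proof.
split.
- have -> : (fun y => Re (cis (y * t))) = (fun y => cos (y * t)).
    by apply/funext => y; rewrite cisE.
  by apply: trigger_derive; rewrite cisE/= /GRing.scale/=; ring.
- have -> : (fun y => Im (cis (y * t))) = (fun y => sin (y * t)).
    by apply/funext => y; rewrite cisE.
  by apply: trigger_derive; rewrite cisE/= /GRing.scale/=; ring.
Qed.

Lemma cder_near x U V v : (\near x, U x = V x) -> cder x U v -> cder x V v.
Proof.
move=> UV [u1 u2]; split.
- by apply: near_eq_is_derive u1; apply: filterS UV => y ->.
- by apply: near_eq_is_derive u2; apply: filterS UV => y ->.
Qed.

Lemma ccontinuousD U V : ccontinuous U -> ccontinuous V ->
  ccontinuous (fun x => U x + V x).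
Proof.
move=> [u1 u2] [v1 v2]; split => x.
- by under eq_fun do rewrite cReD; apply: cvgD; [exact: u1|exact: v1].
- by under eq_fun do rewrite cImD; apply: cvgD; [exact: u2|exact: v2].
Qed.

Lemma ccontinuousM U V : ccontinuous U -> ccontinuous V ->
  ccontinuous (fun x => U x * V x).
Proof.
move=> [u1 u2] [v1 v2]; split => x.
- under eq_fun do rewrite cReM; apply: cvgB; apply: cvgM;
    [exact: u1|exact: v1|exact: u2|exact: v2].
- under eq_fun do rewrite cImM; apply: cvgD; apply: cvgM;
    [exact: u1|exact: v2|exact: u2|exact: v1].
Qed.

Lemma ccontinuous_real (f : R -> R) : continuous f ->
  ccontinuous (fun x => (f x)%:C%C).
Proof. by move=> cf; split => x /=; [exact: cf|exact: cvg_cst]. Qed.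

Lemma ccontinuous_cst (z : R[i]) : ccontinuous (fun _ : R => z).
Proof. by split => x; exact: cvg_cst. Qed.

Lemma ccontinuousN U : ccontinuous U -> ccontinuous (fun x => - U x).
Proof.
move=> [u1 u2]; split => x.
- by under eq_fun do rewrite cReN; apply: cvgN; exact: u1.
- by under eq_fun do rewrite cImN; apply: cvgN; exact: u2.
Qed.

Lemma ccontinuousB U V : ccontinuous U -> ccontinuous V ->
  ccontinuous (fun x => U x - V x).
Proof. by move=> cU cV; apply: ccontinuousD => //; exact: ccontinuousN. Qed.

Lemma cder_ccontinuous V V' : (forall x, cder x V (V' x)) -> ccontinuous V.
Proof.
by move=> dV; split; apply: continuous_is_derive => x; have [] := dV x.
Qed.

Lemma ccontinuous_cis (t : R) : ccontinuous (fun x => cis (x * t)).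
Proof. by apply: cder_ccontinuous => x; exact: cder_cis. Qed.

Lemma ccontinuous_cn V : ccontinuous V -> continuous (fun x => cn (V x)).
Proof.
move=> [v1 v2] x.
have -> : (fun x => cn (V x)) = Num.sqrt \o (fun x => Re (V x) ^+ 2 + Im (V x) ^+ 2).
  by apply/funext => y; rewrite /= cnE.
apply: continuous_comp; last exact: sqrt_continuous.
apply: cvgD; rewrite !expr2; under eq_fun do rewrite expr2; apply: cvgM;
  by [exact: v1|exact: v2].
Qed.

Lemma cint_FTC (a b : R) V V' : a < b ->
  (forall x, a <= x <= b -> cder x V (V' x)) -> ccontinuous V' ->
  cintegrable `[a, b]%classic V' /\ cint `[a, b]%classic V' = V b - V a.
Proof.
move=> ab dV [c1 c2].
have aux (f f' : R -> R) : (forall x, a <= x <= b -> is_derive x (1 : R) f (f' x)) ->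
    continuous f' -> mu.-integrable `[a, b]%classic (fun x => (f' x)%:E) /\
    (\int[mu]_(x in `[a, b]) f' x)%R = f b - f a.
  move=> df cf'; have cf x : a <= x <= b -> {for x, continuous f}.
    move=> xab; apply: differentiable_continuous; apply/derivable1_diffP.
    by have [] := df x xab.
  split.
    apply: continuous_compact_integrable; first exact: segment_compact.
    exact: continuous_subspaceT.
  rewrite /Rintegral (@continuous_FTC2 R f' f)//.
  - exact: continuous_subspaceT.
  - split.
    + move=> x; rewrite in_itv/= => /andP[x1 x2].
      have [] := df x; last by []; by rewrite !ltW.
    + by apply: cvg_at_right_filter; apply: cf; rewrite lexx ltW.
    + by apply: cvg_at_left_filter; apply: cf; rewrite lexx ltW.
  - move=> x; rewrite in_itv/= => /andP[x1 x2]; rewrite derive1E.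
    by have := df x; rewrite !ltW// => /(_ isT) h; exact: derive_val.
have [i1 e1] := aux _ _ (fun x xab => (dV x xab).1) c1.
have [i2 e2] := aux _ _ (fun x xab => (dV x xab).2) c2.
by split=> //; apply: complexP; rewrite ?cReB ?cImB ?cint_Re ?cint_Im.
Qed.

Lemma cintegrable_support (g : TR -> R[i]) (a b C : R) :
  cmeas setT g -> (forall x, cn (g x) <= C) ->
  (forall x, ~~ (a <= x <= b) -> g x = 0) -> cintegrable setT g.
Proof.
move=> mg gC g0.
apply: (@cintegrable_le _ _ _ (fun x => cn (g x))) => //.
apply: (@Rintegrable_support _ _ a b C).
- exact: cmeas_cn.
- by move=> x; rewrite ger0_norm ?cn_ge0.
- by move=> x /g0 ->; rewrite cn0.
Qed.

Lemma ccontinuous_bounded V (a b : R) : ccontinuous V ->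
  (forall x, ~~ (a <= x <= b) -> V x = 0) ->
  exists2 C, 0 <= C & forall x, cn (V x) <= C.
Proof.
move=> cV V0; have [ab|ba] := leP a b; last first.
  exists 0 => // x; rewrite V0 ?cn0//; apply/negP => /andP[x1 x2].
  by have := lt_le_trans ba (le_trans x1 x2); rewrite ltxx.
have [C C0 hC] := continuous_bounded_itv ab (ccontinuous_cn cV).
exists C => // x; have [xab|xab] := boolP (a <= x <= b).
  by have := hC x xab; rewrite ger0_norm ?cn_ge0.
by rewrite V0// cn0.
Qed.

Lemma cintegrable_ccontinuous V (a b : R) : ccontinuous V ->
  (forall x, ~~ (a <= x <= b) -> V x = 0) -> cintegrable setT V.
Proof.
move=> cV V0; have [C C0 hC] := ccontinuous_bounded cV V0.
by apply: (cintegrable_support (a := a) (b := b) (C := C)) => //; exact: ccontinuous_cmeas.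
Qed.

Lemma cintegrable_out U (A : R) : ccontinuous U ->
  (forall s, A <= `|s| -> U s = 0) -> cintegrable setT U.
Proof.
move=> cU UA; apply: (@cintegrable_ccontinuous _ (- A) A) => // x.
by rewrite -ler_norml -ltNge => /ltW/UA.
Qed.

Lemma cint_support (g : TR -> R[i]) (D : set TR) :
  (forall x, ~ D x -> g x = 0) -> cint setT g = cint D g.
Proof.
move=> g0; rewrite [RHS]cint_mkcond; apply: eq_cint => x _.
rewrite indicE; case: (boolP (x \in D)) => [_|xD]; first by rewrite mul1r.
by rewrite g0 ?mulr0// => Dx; move/negP : xD; apply; exact/mem_set.
Qed.

Lemma cint_cder0 (A : R) V V' : 0 < A -> (forall x, cder x V (V' x)) ->
  ccontinuous V' -> (forall x, A <= `|x| -> V x = 0) ->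
  (forall x, A <= `|x| -> V' x = 0) -> cint setT V' = 0.
Proof.
move=> A0 dV cV' V0 V0'.
rewrite (@cint_support V' `[-A, A]%classic).
  have [_ ->] := @cint_FTC (- A) A V V' (ltac:(by rewrite gtrN)) (fun x _ => dV x) cV'.
  by rewrite !V0 ?subrr ?normrN// ger0_norm// ltW.
move=> x xA; apply: V0'; rewrite leNgt; apply/negP => xA'; apply: xA.
by rewrite /= in_itv/= -ler_norml ltW.
Qed.

(** The derivative of [cis (s * t) * U s] has integral 0. Taking moduli gives an equality for every
    real [t], which can be iterated. *)
Lemma fourier_ibp (A t : R) U U' : 0 < A -> (forall x, cder x U (U' x)) ->
  ccontinuous U' -> (forall x, A <= `|x| -> U x = 0) ->
  (forall x, A <= `|x| -> U' x = 0) ->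
  `|t| * cn (cint setT (fun s => cis (s * t) * U s)) =
  cn (cint setT (fun s => cis (s * t) * U' s)).
Proof.
move=> A0 dU cU' U0 U0'.
have cU := cder_ccontinuous dU.
have sup (W : R -> R[i]) : (forall x, A <= `|x| -> W x = 0) ->
    forall x, ~~ (- A <= x <= A) -> cis (x * t) * W x = 0.
  move=> W0 x xA; rewrite W0 ?mulr0// leNgt; apply: contra xA => xA.
  by rewrite -ler_norml ltW.
have ci := ccontinuous_cis t.
have i1 := cintegrable_ccontinuous (ccontinuousM ci cU) (sup _ U0).
have i2 := cintegrable_ccontinuous (ccontinuousM ci cU') (sup _ U0').
have := @cint_cder0 A (fun s => cis (s * t) * U s)
  (fun s => 'i%C * t%:C%C * cis (s * t) * U s + cis (s * t) * U' s) A0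
  (fun x => cderM (cder_cis x t) (dU x)).
move=> /(_ _ _ _)/wrap[|||].
- apply: ccontinuousD; last exact: ccontinuousM.
  apply: ccontinuousM => //; apply: ccontinuousM => //; exact: ccontinuous_cst.
- by move=> x xA; rewrite U0// mulr0.
- by move=> x xA; rewrite U0// U0'// !mulr0 addr0.
rewrite cintD//; last first.
  have := cintegrableZ ('i%C * t%:C%C) measurableT i1.
  by apply: eq_cintegrable => // s _; rewrite !mulrA.
under [X in X + _ = _]eq_cint do rewrite -mulrA.
rewrite cintZ// => /eqP; rewrite addr_eq0 => /eqP/(congr1 (@cn R)).
rewrite cnN !cnM cn_real => <-; congr (_ * _).
by rewrite cnE/= expr0n/= add0r expr1n sqrtr1 mul1r.
Qed.

(* Two integrations by parts. *)
Lemma fourier_decay (w : nat -> R -> R) (A : R) : 0 < A -> smooth_family w ->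
  (forall i x, A <= `|x| -> w i x = 0) ->
  exists2 C, 0 <= C & forall t : R,
    cn (cint setT (fun s => (w 0%N s)%:C%C * cis (s * t))) <= C * poisson t.
Proof.
move=> A0 fw w0.
have cw i : ccontinuous (fun s => (w i s)%:C%C).
  by apply: ccontinuous_real; exact: smooth_family_continuous.
have sup i x : ~~ (- A <= x <= A) -> (w i x)%:C%C = 0 :> R[i].
  move=> xA; rewrite w0// leNgt; apply: contra xA => xA.
  by rewrite -ler_norml ltW.
have iw i := cintegrable_ccontinuous (cw i) (sup i).
pose M i := 2 * (\int[mu]_(x in setT) cn ((w i x)%:C%C))%R.
have hM i t : cn (cint setT (fun s => cis (s * t) * (w i s)%:C%C)) <= M i.
  apply: cn_cint_le => //.
  - by apply: cmeasM; [exact: measurable_mulr_cis|exact: ccontinuous_cmeas].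
  - exact: cintegrable_cn.
  - by move=> x _; rewrite cnM cn_cis mul1r.
have ibp i t : `|t| * cn (cint setT (fun s => cis (s * t) * (w i s)%:C%C)) =
    cn (cint setT (fun s => cis (s * t) * (w i.+1 s)%:C%C)).
  apply: (@fourier_ibp A) => //.
  - by move=> x; apply: cder_real; exact: fw.
  - by move=> x /(w0 i) ->.
  - by move=> x /(w0 i.+1) ->.
have M0 i : 0 <= M i := le_trans (cn_ge0 _) (hM i 0).
(* [(1 + t ^ 2)] times the integral is at most [M 0 + M 2]; the 2 is the numerator of [poisson]. *)
exists ((M 0%N + M 2%N) / 2); first by rewrite divr_ge0// addr_ge0.
move=> t; rewrite /poisson mulrA divfK// ler_pdivlMr ?poisson_den_gt0//.
under eq_cint do rewrite mulrC.
rewrite mulrDr mulr1 lerD//.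
by rewrite mulrC -sqr_absr expr2 -mulrA ibp ibp.
Qed.

End ComplexDerivative.

(** * Damped transforms on the half-line *)

Section HalfLine.
Context {R : realType}.
Local Notation mu := (@lebesgue_measure R).
Local Notation TR := (measurableTypeR R).
Local Notation Re := complex.Re.
Local Notation Im := complex.Im.
Implicit Types (a r t u : R) (g P : R -> R[i]).

Definition damp a u : R := \1_(`[0, +oo[%classic : set R) u * expR (- (a * u)).

(** Its Fourier transform at [s] is the Laplace transform of [g] at [a + i s]. *)
Definition damped a g u : R[i] := (damp a u)%:C%C * g u.

Lemma damp_ge0 a u : 0 <= damp a u.
Proof. by rewrite mulr_ge0 ?expR_ge0. Qed.

Lemma dampE a u : 0 <= u -> damp a u = expR (- (a * u)).
Proof. by move=> u0; rewrite /damp indicE mem_set ?mul1r//= in_itv/= u0. Qed.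

Lemma damp_neg a u : u < 0 -> damp a u = 0.
Proof.
by move=> u0; rewrite /damp indicE memNset ?mul0r//= in_itv/= andbT; apply/negP; rewrite -ltNge.
Qed.

Lemma measurable_damp a : measurable_fun setT (damp a : TR -> R).
Proof.
apply: measurable_funM.
  by apply: measurable_indic; exact: measurable_itv.
apply: measurableT_comp => //.
by apply: (@measurable_eq_affine _ (- a) 0) => u; ring.
Qed.

Lemma damp_le_laplacian a u : 0 < a -> damp a u <= laplacian_density (a * u).
Proof.
move=> a0; have [u0|u0] := leP 0 u; last by rewrite damp_neg// expR_ge0.
by rewrite dampE// /laplacian_density ger0_norm// mulr_ge0// ltW.
Qed.

Lemma integrable_damp a : 0 < a -> mu.-integrable setT (EFin \o (damp a : TR -> R)).
Proof.
move=> a0; apply: (@Rintegrable_le _ _ _ (fun u => laplacian_density (a * u))) => //.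
- exact: measurable_damp.
- have := integrable_affine 0 (lt0r_neq0 a0) integrable_laplacian_density.
  by apply: eq_integrable => // u _ /=; rewrite addr0.
- by move=> u _; rewrite ger0_norm ?damp_ge0// damp_le_laplacian.
Qed.

Lemma damp_le1 a u : 0 <= a -> damp a u <= 1.
Proof.
move=> a0; have [u0|u0] := leP 0 u; last by rewrite damp_neg.
by rewrite dampE// -expR0 ler_expR oppr_le0 mulr_ge0.
Qed.

Lemma cn_damped_le a g B u : (forall v, 0 <= v -> cn (g v) <= B) ->
  cn (damped a g u) <= B * damp a u.
Proof.
move=> gB; have [u0|u0] := leP 0 u; last first.
  by rewrite /damped damp_neg// mul0r cn0 mulr0.
by rewrite /damped cnM cn_real ger0_norm ?damp_ge0// mulrC ler_wpM2r ?damp_ge0 ?gB.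
Qed.

Lemma cmeas_damped a g : cmeas (setT : set TR) g -> cmeas (setT : set TR) (damped a g).
Proof. by move=> mg; apply: cmeasM => //; apply: cmeas_real; exact: measurable_damp. Qed.

Lemma cintegrable_damped a g B : 0 < a -> cmeas (setT : set TR) g ->
  (forall v, 0 <= v -> cn (g v) <= B) -> cintegrable setT (damped a g).
Proof.
move=> a0 mg gB; apply: (@cintegrable_le _ _ _ (fun u => B * damp a u)) => //.
- exact: cmeas_damped.
- exact: RintegralZl_le (integrable_damp a0).
- by move=> u _; exact: cn_damped_le.
Qed.

(** The base point -1 gives a two-sided derivative at 0, the left end of the interval to which
    [cint_FTC] is applied; [prim g] itself may have a corner there. *)
Lemma cder_prim g u : ccontinuous g -> -1 < u ->
  cder u (fun x => cint `[-1, x]%classic g) (g u).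
Proof.
move=> [c1 c2] u1.
have aux (f : R -> R) : continuous f ->
    is_derive u (1 : R) (fun x => \int[mu]_(t in `[-1, x]) f t)%R (f u).
  move=> cf; have uu : u < u + 1 by rewrite ltrDl.
  have fi : mu.-integrable `[-1, (u + 1)] (EFin \o f).
    apply: continuous_compact_integrable; first exact: segment_compact.
    exact: continuous_subspaceT.
  have [d e] := @continuous_FTC1_closed R f (-1) u (u + 1) uu fi u1 (cf u).
  by apply: DeriveDef; [exact: d|rewrite -derive1E; exact: e].
by split; [exact: aux c1|exact: aux c2].
Qed.

Lemma cintegrable_itv g (x y : R) : ccontinuous g -> cintegrable `[x, y]%classic g.
Proof.
move=> [c1 c2]; split; apply: continuous_compact_integrable;
  by [exact: segment_compact|exact: continuous_subspaceT].
Qed.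

Lemma prim_sub g u : ccontinuous g -> 0 <= u ->
  cint `[0, u]%classic g = cint `[-1, u]%classic g - cint `[-1, 0]%classic g.
Proof.
move=> cg u0.
have n1 : (-1 : R) <= 0 by rewrite lerN10.
have aux (f : R -> R) : mu.-integrable `[-1, u]%classic (fun x => (f x)%:E) ->
    (\int[mu]_(t in `[0, u]) f t = \int[mu]_(t in `[-1, u]) f t - \int[mu]_(t in `[-1, 0]) f t)%R.
  move=> fi; rewrite (@Rintegral_itvB _ f (BLeft (-1)) (BRight u) 0)//.
    rewrite [RHS]Rintegral_itv_obnd_cbnd//.
    apply: integrableS fi => // x /=; rewrite !in_itv/= => /andP[x0 ->].
    by rewrite andbT (le_trans n1)// ltW.
have [i1 i2] := cintegrable_itv (-1) u cg.
by apply: complexP; rewrite ?cReB ?cImB ?cint_Re ?cint_Im; exact: aux.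
Qed.

(* Equal to 0 for [u < 0], where the interval is empty. *)
Definition prim g u : R[i] := cint `[0, u]%classic g.

Lemma prim_neg g u : u < 0 -> prim g u = 0.
Proof.
move=> u0; rewrite /prim /cint set_itv_ge ?integral_set0 ?bnd_simp -?ltNge//.
Qed.

Lemma prim_max g u : ccontinuous g ->
  prim g u = cint `[-1, Num.max u 0]%classic g - cint `[-1, 0]%classic g.
Proof.
move=> cg; have [u0|u0] := leP 0 u; first by rewrite -prim_sub.
by rewrite prim_neg// subrr.
Qed.

Lemma is_derive_continuous_at (h : R -> R) (x d : R) :
  is_derive x (1 : R) h d -> {for x, continuous h}.
Proof. by move=> [dh _]; apply: differentiable_continuous; apply/derivable1_diffP. Qed.

Lemma ccontinuous_prim g : ccontinuous g -> ccontinuous (prim g).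
Proof.
move=> cg.
have cm x : {for x, continuous (fun u : R => Num.max u 0)}.
  by apply: continuous_max; [exact: cvg_id|exact: cvg_cst].
have mgt (x : R) : -1 < Num.max x 0 by rewrite lt_max (ltrN10 R) orbT.
split.
- rewrite (_ : (fun x => _) = (fun v : R => Re (cint `[-1, v]%classic g) - Re (cint `[-1, 0]%classic g)) \o (fun u : R => Num.max u 0)); last first.
    by apply/funext => u; rewrite [LHS](congr1 (@complex.Re R) (prim_max u cg)) cReB.
  move=> x; apply: continuous_comp; first exact: cm.
  apply: continuousB; last exact: cvg_cst.
  by apply: is_derive_continuous_at; exact: (cder_prim cg (mgt x)).1.
- rewrite (_ : (fun x => _) = (fun v : R => Im (cint `[-1, v]%classic g) - Im (cint `[-1, 0]%classic g)) \o (fun u : R => Num.max u 0)); last first.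
    by apply/funext => u; rewrite [LHS](congr1 (@complex.Im R) (prim_max u cg)) cImB.
  move=> x; apply: continuous_comp; first exact: cm.
  apply: continuousB; last exact: cvg_cst.
  by apply: is_derive_continuous_at; exact: (cder_prim cg (mgt x)).2.
Qed.

(** With [z = a + i s], the integrand is the derivative of [exp (- z u)] times the primitive of [g],
    which vanishes at 0. *)
Lemma expN_prim_FTC a s g (N : R) : ccontinuous g -> 0 < N ->
  cint `[0, N]%classic
    (fun u => (expR (- (a * u)))%:C%C * cis (- (s * u)) * (g u - (a +i* s)%C * prim g u)) =
  (expR (- (a * N)))%:C%C * cis (- (s * N)) * prim g N.
Proof.
move=> cg N0.
pose E u : R[i] := (expR (- (a * u)))%:C%C * cis (- (s * u)).
have dE u : cder u E (- (a +i* s)%C * E u).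
  have dr : is_derive u (1 : R) (fun u : R => expR (- (a * u))) (- a * expR (- (a * u))).
    have -> : (fun u : R => expR (- (a * u))) = expR \o (fun u => (- a) *: u).
      by apply/funext => v /=; rewrite -mulNr.
    apply: is_derive_eq; rewrite /GRing.scale/= mulr1 mulrC mulNr//.
    by rewrite !mulNr.
  have := cderM (cder_real dr) (cder_cis u (- s)).
  rewrite (_ : (fun y => _ * _) = E); last first.
    by apply/funext => y; rewrite /E mulrN mulrC [y * s]mulrC mulrC.
  rewrite /E mulrN [u * s]mulrC; congr cder.
  apply: complexP; rewrite !(cReD, cImD, cReM, cImM, cReN, cImN)/=; ring.
have cE : ccontinuous E by exact: cder_ccontinuous dE.
have := @cint_FTC R 0 N (fun u => E u * (cint `[-1, u]%classic g - cint `[-1, 0]%classic g))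
  (fun u => E u * (g u - (a +i* s)%C * prim g u)) N0.
move=> [].
- move=> x /andP[x0 xN].
  have x1 : -1 < x by rewrite (lt_le_trans _ x0)// ltrN10.
  have := cderM (dE x) (cderD (cder_prim cg x1) (cder_cst x (- cint `[-1, 0]%classic g))).
  congr cder; rewrite -prim_sub// -/(prim g x) addr0; ring.
- apply: ccontinuousM => //; apply: ccontinuousB => //.
  by apply: ccontinuousM; [exact: ccontinuous_cst|exact: ccontinuous_prim].
- move=> _ ->; rewrite -prim_sub ?ltW// -/(prim g N).
  by rewrite subrr mulr0 subr0.
Qed.

(** The identity g^(z) = z P^(z): [expN_prim_FTC] on [[0, N]], with a boundary term that tends to 0
    because the primitive is bounded. *)
Lemma fourier_damped_prim a s g B B' : 0 < a -> ccontinuous g ->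
  (forall u, 0 <= u -> cn (g u) <= B) ->
  (forall u, 0 <= u -> cn (prim g u) <= B') ->
  cintegrable setT (damped a (prim g)) /\
  fourier (damped a g) s = (a +i* s)%C * fourier (damped a (prim g)) s.
Proof.
move=> a0 cg gB PB.
have iP : cintegrable setT (damped a (prim g)).
  by apply: cintegrable_damped PB => //; apply: ccontinuous_cmeas; exact: ccontinuous_prim.
have ig : cintegrable setT (damped a g).
  by apply: cintegrable_damped gB => //; exact: ccontinuous_cmeas.
split=> //; apply/eqP; rewrite -subr_eq0; apply/eqP.
have mth : measurable_fun setT (fun u : TR => - (s * u) : R).
  by apply: (@measurable_eq_affine _ (- s) 0) => u; ring.
rewrite !fourierE -cintZ//; last exact: cintegrable_cisM.
rewrite -cintB//; [|exact: cintegrable_cisM|by apply: cintegrableZ => //; exact: cintegrable_cisM].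
pose H u := cis (- (s * u)) * damped a g u - (a +i* s)%C * (cis (- (s * u)) * damped a (prim g) u).
have iH : cintegrable setT H.
  apply: cintegrableB => //; first exact: cintegrable_cisM.
  by apply: cintegrableZ => //; exact: cintegrable_cisM.
apply: (@cn_cvg_unique _ (fun n => cint setT (fun u => (\1_(`[0, n.+1%:R]%classic : set R) u)%:C%C * H u))).
- apply: (@cint_cvg R setT _ H (fun u => cn (H u))) => //.
  + move=> n; apply: cmeasM; last exact: cintegrable_meas.
    by apply: cmeas_real; apply: measurable_indic; exact: measurable_itv.
  + exact: cintegrable_meas.
  + exact: cintegrable_cn.
  + move=> n u _; rewrite cnM cn_real indicE; case: (_ \in _) => /=.
      by rewrite normr1 mul1r.
    by rewrite normr0 mul0r cn_ge0.
  + apply: aeW => u _; have [u0|u0] := ltP u 0.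
      rewrite (_ : (fun n => _) = fun=> 0); first exact: cvg_cst.
      apply/funext => n; rewrite /H /damped damp_neg// !mul0r !mulr0 subrr mulr0 subr0.
      exact: cn0.
    apply: cvg_near_cst; exists (Num.bound u) => // n /= un.
    rewrite indicE mem_set/=; first by rewrite mul1r subrr cn0.
    rewrite in_itv/= u0/=; have := archi_boundP u0 => /ltW/le_trans; apply.
    by rewrite ler_nat (leq_trans un).
(* The boundary term is at most [B' exp (- a N)], and [exp (- a N) <= 1 / (a N)]. *)
- apply: (norm_le_cvg0 (v := fun n => B' * (a^-1 * n.+1%:R^-1))); last first.
    by apply: cvg0_cstM; apply: cvg0_cstM; exact: natinv_cvg0.
  move=> n; rewrite subr0 -cint_mkcond ger0_norm ?cn_ge0//.
  rewrite (@eq_cint _ _ _ (fun u => (expR (- (a * u)))%:C%C * cis (- (s * u)) * (g u - (a +i* s)%C * prim g u))); last first.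
    by move=> u /=; rewrite in_itv/= => /andP[u0 _]; rewrite /H /damped dampE//; ring.
  rewrite expN_prim_FTC// !cnM cn_cis mulr1 cn_real ger0_norm ?expR_ge0// mulrC.
  have an : 0 < a * n.+1%:R by rewrite mulr_gt0.
  apply: ler_pM; rewrite ?cn_ge0 ?expR_ge0 ?PB// -invfM.
  rewrite expRN lef_pV2 ?posrE ?expR_gt0//.
  by rewrite (le_trans _ (expR_ge1Dx _))// lerDr.
Qed.

(** Leibniz' rule for [s * w 0 s]. At [i = 0] the second term has coefficient 0, so the truncated
    predecessor is harmless. *)
Lemma smooth_family_mulX (w : nat -> R -> R) : smooth_family w ->
  smooth_family (fun i s => s * w i s + i%:R * w i.-1 s).
Proof.
move=> sw i x; have dw := sw i x.
case: i dw => [|i] dw.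
  have -> : (fun s : R => s * w 0%N s + 0%:R * w 0.-1 s) = (fun s : R => s * w 0%N s).
    by apply/funext => s; rewrite mul0r addr0.
  by apply: is_derive_eq; rewrite /GRing.scale/=; ring.
have dw' := sw i x.
apply: is_derive_eq; rewrite /GRing.scale/=.
rewrite -[i.+2%:R]natr1; ring.
Qed.

(** Dilating the cutoff turns the decay bound into a dilated Poisson kernel, whose integral does not
    depend on [r]. *)
Lemma fourier_dilation_decay (w : nat -> R -> R) : smooth_family w ->
  (forall i x, 2 <= `|x| -> w i x = 0) ->
  exists2 C, 0 <= C & forall r x : R, 0 < r ->
    cintegrable setT (fun s : R => (w 0%N (r^-1 * s))%:C%C * cis (s * x)) /\
    cn (cint setT (fun s => (w 0%N (r^-1 * s))%:C%C * cis (s * x))) <= C * (r * poisson (r * x)).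
Proof.
move=> sw w0; have [C C0 HC] := @fourier_decay _ w 2 ltac:(done) sw w0.
exists C => // r x r0.
have ii : cintegrable setT (fun v : TR => (w 0%N v)%:C%C * cis (v * (r * x))).
  apply: (@cintegrable_out _ _ 2); last by move=> v /w0 ->; exact: mul0r.
  by apply: ccontinuousM; [apply: ccontinuous_real; exact: (@smooth_family_continuous _ _ sw 0)|exact: ccontinuous_cis].
have ri : r^-1 != 0 by rewrite invr_eq0 gt_eqF.
have e : (fun s => (w 0%N (r^-1 * s))%:C%C * cis (s * x)) =
   (fun s => (fun v : TR => (w 0%N v)%:C%C * cis (v * (r * x))) (r^-1 * s + 0)).
  by apply/funext => s /=; rewrite addr0; congr (_ * cis _); field; rewrite gt_eqF.
rewrite e; split; first exact: (cintegrable_affine 0 ri ii).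
rewrite (cint_affine 0 ri ii) (ger0_norm (x := r^-1)) ?invr_ge0 ?(ltW r0)// invrK.
rewrite cnM cn_real ger0_norm ?(ltW r0)//.
by rewrite mulrCA ler_wpM2l ?(ltW r0)//; exact: HC.
Qed.

Lemma integrable_poisson_dilation r t : 0 < r ->
  mu.-integrable setT (EFin \o (fun u : TR => r * poisson (r * (t - u)))) /\
  (\int[mu]_(u in setT) (r * poisson (r * (t - u))) = (poisson_mass : R))%R.
Proof.
move=> r0; have rN : - r != 0 by rewrite oppr_eq0 gt_eqF.
have e : (fun u : TR => poisson (r * (t - u))) = (fun u => poisson (- r * u + r * t)).
  by apply/funext => u; congr poisson; ring.
have i1 : mu.-integrable setT (EFin \o (fun u : TR => poisson (r * (t - u)))).
  by rewrite e; exact: (integrable_affine (r * t) rN (@integrable_poisson R)).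
split; first exact: RintegralZl_le.
rewrite RintegralZl// e (Rintegral_affine (r * t) rN (@integrable_poisson R)).
by rewrite normrN ger0_norm ?(ltW r0)// mulrA divff ?mul1r// gt_eqF.
Qed.

(* As [fourier (damped a g) s = (a + i s) * fourier (damped a (prim g)) s], only
   the bound [B'] of the primitive enters; the factor [a + i s] is of size
   [a + r] on the support of the cutoff. *)
Lemma low_frequency : exists C0 C1 : R, [/\ 0 <= C0, 0 <= C1 &
  forall a r t g B B', 0 < a -> 0 < r -> ccontinuous g ->
  (forall u, 0 <= u -> cn (g u) <= B) ->
  (forall u, 0 <= u -> cn (prim g u) <= B') ->
  cn (cint setT (fun s : R => (cutoff 0 (r^-1 * s))%:C%C * (cis (s * t) * fourier (damped a g) s)))
    <= (a * C0 + r * C1) * B'].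
Proof.
have out i (x : R) : 2 <= `|x| -> cutoff i x = 0 by exact: cutoff_out.
have [C0 C00 H0] := fourier_dilation_decay (@smooth_family_cutoff R) out.
have out1 i (x : R) : 2 <= `|x| -> x * cutoff i x + i%:R * cutoff i.-1 x = 0.
  by move=> x2; rewrite !out// !mulr0 addr0.
have [C1 C10 H1] := fourier_dilation_decay (smooth_family_mulX (@smooth_family_cutoff R)) out1.
have M0 : 0 <= (poisson_mass : R) by rewrite ltW// poisson_mass_gt0.
exists (2 * C0 * poisson_mass), (2 * C1 * poisson_mass).
split; rewrite ?mulr_ge0//.
move=> a r t g B B' a0 r0 cg gB PB.
pose K (s : R) := (cutoff 0 (r^-1 * s))%:C%C * (a +i* s)%C.
(* Writing [s = r * (r^-1 * s)], the part [i s] of the factor becomes [i r] times a dilate of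
   [x * cutoff 0 x]; this is where the gain [r] appears. *)
have KE x : (fun s => K s * cis (s * x)) = (fun s : R =>
    a%:C%C * ((cutoff 0 (r^-1 * s))%:C%C * cis (s * x)) +
    'i%C * r%:C%C * (((r^-1 * s) * cutoff 0 (r^-1 * s) + 0%:R * cutoff 0.-1 (r^-1 * s))%:C%C * cis (s * x))).
  apply/funext => s; rewrite mul0r addr0 /K.
  have -> : (r^-1 * s * cutoff 0 (r^-1 * s))%:C%C = (r^-1)%:C%C * s%:C%C * (cutoff 0 (r^-1 * s))%:C%C :> R[i].
    by rewrite -!rmorphM.
  have -> : (a +i* s)%C = a%:C%C + 'i%C * (r%:C%C * (r^-1)%:C%C) * s%:C%C.
    rewrite -rmorphM divff ?gt_eqF// mulr1.
    by apply: complexP; rewrite !(cReD, cImD, cReM, cImM)/=; ring.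
  ring.
have iK x : cintegrable setT (fun s => K s * cis (s * x)).
  rewrite KE; apply: cintegrableD => //; apply: cintegrableZ => //.
    by have [] := H0 r x r0.
  by have [] := H1 r x r0.
have KB x : cn (cint setT (fun s => K s * cis (s * x))) <= (a * C0 + r * C1) * (r * poisson (r * x)).
  have [i0 b0] := H0 r x r0; have [i1 b1] := H1 r x r0.
  rewrite KE cintD//; [|exact: cintegrableZ|exact: cintegrableZ].
  rewrite !cintZ// (le_trans (cnD _ _))// !cnM !cn_real !ger0_norm ?(ltW a0) ?(ltW r0)//.
  have -> : cn ('i%C : R[i]) = 1 by rewrite cnE/= expr0n/= add0r expr1n sqrtr1.
  by rewrite mul1r mulrDl -!mulrA lerD// ler_wpM2l ?(ltW a0) ?(ltW r0).
have [iP fE] : cintegrable setT (damped a (prim g)) /\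
    forall s, fourier (damped a g) s = (a +i* s)%C * fourier (damped a (prim g)) s.
  split; first by have [] := fourier_damped_prim 0 a0 cg gB PB.
  by move=> s; have [] := fourier_damped_prim s a0 cg gB PB.
rewrite (@eq_cint _ _ _ (fun s => K s * (cis (s * t) * fourier (damped a (prim g)) s))); last first.
  by move=> s _; rewrite fE /K; ring.
have iK0 : cintegrable setT K.
  apply: eq_cintegrable (iK 0) => // s _; by rewrite mulr0 cis0 mulr1.
rewrite (fourier_pairing t iK0 iP).
have [ip ipE] := integrable_poisson_dilation t r0.
have B'0 : 0 <= B' by apply: le_trans (PB 0 (lexx 0)); exact: cn_ge0.
pose k := B' * (a * C0 + r * C1).
apply: (le_trans (@cn_cint_le R setT _ (fun u => k * (r * poisson (r * (t - u)))) _ _ _ _)) => //.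
- apply: cmeasM; first exact: cintegrable_meas.
  rewrite (_ : (fun u => _) = (fun u : TR => fourier K (1 * u + - t))); last first.
    by apply/funext => u; rewrite fourierE; apply: eq_cint => s _; rewrite mulrC; congr (cis _ * _); ring.
  apply: (@cmeas_comp _ _ TR TR R setT (fun u : TR => 1 * u + - t : TR) (fourier K)).
    by apply: ccontinuous_cmeas; exact: ccontinuous_fourier.
  exact: measurable_eq_affine.
- exact: RintegralZl_le.
- move=> u _; rewrite cnM /k -mulrA; apply: ler_pM; rewrite ?cn_ge0 ?KB//.
  have [u0|u0] := leP 0 u; last by rewrite /damped damp_neg// mul0r cn0.
  rewrite /damped cnM cn_real ger0_norm ?damp_ge0// -[leRHS]mul1r ler_pM ?damp_ge0 ?cn_ge0 ?PB//.
  by rewrite damp_le1 ?(ltW a0).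
rewrite RintegralZl// ipE /k; rewrite le_eqVlt; apply/orP; left; apply/eqP; ring.
Qed.

End HalfLine.

Section CisLipschitz.
Context {R : realType}.
Implicit Types x y s a u : R.

Lemma cos_sin_lip x y : `|cos x - cos y| <= `|x - y| /\ `|sin x - sin y| <= `|x - y|.
Proof.
wlog xy : x y / x <= y => [hw|].
  have [/hw//|/ltW/hw] := leP x y.
  by rewrite (distrC x) (distrC (cos x)) (distrC (sin x)).
rewrite (distrC x) (ger0_norm (x := y - x)) ?subr_ge0//.
(* A derivative bounded by 1 makes both [x + h x] and [x - h x] nondecreasing. *)
have aux (h dh : R -> R) : (forall x : R, is_derive x 1 h (dh x)) ->
    (forall x, `|dh x| <= 1) -> `|h x - h y| <= y - x.
  move=> dd b.
  have dl v : -1 <= dh v <= 1 by rewrite -ler_norml.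
  have d1 v : is_derive v (1 : R) (fun x => x + h x) (1 + dh v).
    by have ? := dd v; exact: is_deriveD.
  have d2 v : is_derive v (1 : R) (fun x => x - h x) (1 - dh v).
    by have ? := dd v; exact: is_deriveB.
  have p1 v : 0 <= 1 + dh v by have := dl v; lra.
  have p2 v : 0 <= 1 - dh v by have := dl v; lra.
  have := nondecreasing_is_derive d1 p1 xy; have := nondecreasing_is_derive d2 p2 xy.
  by rewrite ler_norml; lra.
split.
- apply: (aux cos (fun x => - sin x)) => v.
  by rewrite normrN ler_norml sin_geN1 sin_le1.
- apply: (aux sin cos) => v.
  by rewrite ler_norml cos_geN1 cos_le1.
Qed.

Lemma cis_lip x y : cn (cis x - cis y) <= 2 * `|x - y|.
Proof.
have [h1 h2] := cos_sin_lip x y.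
rewrite (le_trans (cn_le _))// !cisE cReB cImB /=; lra.
Qed.

(** Half of the exponential absorbs the factor [u], by [z <= exp z] at [z = a u / 2]. *)
Lemma damp_mulr a u : 0 < a -> damp a u * `|u| <= 2 / a * damp (a / 2) u.
Proof.
move=> a0; have [u0|u0] := leP 0 u; last by rewrite !damp_neg// mul0r mulr0.
rewrite !dampE// ger0_norm//.
have -> : expR (- (a * u)) = expR (- (a / 2 * u)) * expR (- (a / 2 * u)).
  by rewrite -expRD; congr expR; field.
rewrite -mulrA [leRHS]mulrC ler_wpM2l ?expR_ge0//.
have : a / 2 * u <= expR (a / 2 * u).
  by rewrite (le_trans _ (expR_ge1Dx _))// lerDr.
rewrite expRN -(ler_pM2l (x := expR (a / 2 * u))) ?expR_gt0// mulrA divff ?gt_eqF ?expR_gt0//.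
rewrite mul1r => h.
rewrite [leLHS](_ : u = (a / 2 * u) * (2 / a)); last by field; rewrite gt_eqF.
by rewrite ler_wpM2r// divr_ge0// ltW.
Qed.

End CisLipschitz.

(** * Laplace transforms and convolutions under functionals *)

Section Transforms.
Context {R : realType} {X : completeNormedModType R[i]}.
Local Notation mu := (@lebesgue_measure R).
Local Notation TR := (measurableTypeR R).
Implicit Types (D : set TR) (a r t u s : R) (L : X -> R[i]).

Lemma eq_is_bochner_integral D (g h : R -> X) v : (forall x, D x -> g x = h x) ->
  is_bochner_integral D g v -> is_bochner_integral D h v.
Proof.
move=> gh [mD [s [H [h1 [h2 [h3 h4]]]]]]; split => //; exists s, H; do 2 split => //.
split=> // n.
have gn : {ae mu, forall x : TR, D x -> nrm (g x - sf_eval (s n) x) <= H n x} by exact: h3.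
have hn : {ae mu, forall x : TR, D x -> nrm (h x - sf_eval (s n) x) <= H n x}.
  by apply: filterS gn => x gx Dx; rewrite -gh//; exact: gx.
exact: hn.
Qed.

Lemma eq_Bint D (g h : R -> X) : (forall x, D x -> g x = h x) -> Bint D g = Bint D h.
Proof.
move=> gh; rewrite /Bint; congr xget; apply/seteqP; split=> v;
  by apply: eq_is_bochner_integral => x Dx; rewrite gh.
Qed.

Lemma Bint_functional_approx D (g : R -> X) L : measurable D -> approximable D g ->
  functional L -> cmeas D (fun x => L (g x)) ->
  cintegrable D (fun x => L (g x)) /\ cint D (fun x => L (g x)) = L (Bint D g).
Proof. by move=> mD ag; apply: Bint_functional; exact: approx_bochner. Qed.

Section BoundedContinuous.
Context (f : R -> X) (B : R).
Context (fc : forall x (e : R), 0 < e -> \forall y \near x, nrm (f x - f y) < e)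
        (fB : forall x, nrm (f x) <= B).

Lemma functional_ccontinuous (g : R -> X) L :
  (forall x (e : R), 0 < e -> \forall y \near x, nrm (g x - g y) < e) ->
  functional L -> ccontinuous (fun x => L (g x)).
Proof.
move=> gc fL; apply: ccontinuous_cvg => u x ux.
apply: (norm_le_cvg0 (v := fun n => 2 * nrm (g x - g (u n)))) => [n|].
  by rewrite ger0_norm ?cn_ge0// -cnN -funB// -funN// opprB fun_bound.
apply: cvg0_cstM; apply/cvgr0Pnorm_lt => e e0.
have [N _ HN] := ux _ (gc x e e0); exists N => // n /HN /=.
by rewrite ger0_norm ?nrm_ge0.
Qed.

Lemma cmeas_functional L D : functional L -> cmeas D (fun x => L (f x)).
Proof.
move=> fL; have [m1 m2] := ccontinuous_cmeas (functional_ccontinuous fc fL).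
by split; [exact: measurable_funTS m1|exact: measurable_funTS m2].
Qed.

Lemma functional_bounded L x : functional L -> cn (L (f x)) <= 2 * B.
Proof. by move=> fL; rewrite (le_trans (fun_bound fL _))// ler_wpM2l. Qed.

Lemma Bint_weight_functional D (w : TR -> R[i]) L : measurable D -> cintegrable D w ->
  functional L ->
  cint D (fun x => w x * L (f x)) = L (Bint D (fun x => w x *: f x)).
Proof.
move=> mD iw fL.
have ap : approximable D (fun x => w x *: f x) by exact: approx_cintM fc fB.
have [|_ <-] := Bint_functional_approx mD ap fL.
  under eq_fun do rewrite funZ//.
  by apply: cmeasM; [exact: cintegrable_meas|exact: cmeas_functional].
by apply: eq_cint => x _; rewrite funZ.
Qed.

Lemma cis_dampedE a (g : R -> R[i]) s :
  (fun u => cis (- (s * u)) * damped a g u) =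
  (fun u => (\1_(`[0, +oo[%classic : set R) u)%:C%C * (cexp (- ((a +i* s)%C * u%:C%C)) * g u)).
Proof.
apply/funext => u; rewrite /damped /damp.
have -> : cexp (- ((a +i* s)%C * u%:C%C)) = (expR (- (a * u)))%:C%C * cis (- (s * u)).
  rewrite /cis /cexp; apply: complexP; rewrite !(cReM, cImM)/= expR0 !mulr0 !mul0r !mul1r ?subr0 ?addr0 ?mul0r ?oppr0;
  by rewrite ?subr0 ?add0r ?addr0.
rewrite rmorphM; ring.
Qed.

Lemma cintegrable_cexp a s : 0 < a ->
  cintegrable (`[0, +oo[%classic : set TR) (fun u => cexp (- ((a +i* s)%C * u%:C%C))).
Proof.
move=> a0; apply/cintegrable_mkcond; first exact: measurable_itv.
have := cis_dampedE a (fun=> 1) s => e.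
apply: (eq_cintegrable measurableT (g := fun u => cis (- (s * u)) * damped a (fun=> 1) u)).
  by move=> x _; rewrite [LHS](congr1 (@^~ x) e) mulr1.
apply: cintegrable_cisM; first by apply: (@measurable_eq_affine _ (- s) 0) => u; ring.
have m1 : cmeas (setT : set TR) (fun=> 1 : R[i]) by exact: cmeas_cst.
apply: (@cintegrable_damped _ _ _ 1) => //.
by move=> v _; rewrite cn_real normr1.
Qed.

Lemma laplace_functional a s L : 0 < a -> functional L ->
  L (laplace f (a +i* s)%C) = fourier (damped a (fun x => L (f x))) s.
Proof.
move=> a0 fL; rewrite /laplace -Bint_weight_functional//; last exact: cintegrable_cexp.
by rewrite fourierE cis_dampedE -cint_mkcond.
Qed.

(** The substitution [s -> t - s] gives the shape of the right-hand side of
    [fourier_inversion_conv]. *)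
Lemma conv_functional (phi : R -> R[i]) t L : cintegrable setT phi -> functional L ->
  L (Defs.conv f phi t) =
  cint setT (fun v => phi v * ((\1_(`[0, +oo[%classic : set R) (t - v))%:C%C * L (f (t - v)))).
Proof.
move=> ip fL.
have n1 : (-1 : R) != 0 by rewrite oppr_eq0 oner_eq0.
have ip' : cintegrable setT (fun s : TR => phi (t - s)).
  have := cintegrable_affine t n1 ip; apply: eq_cintegrable => // s _; by rewrite mulN1r addrC.
rewrite /Defs.conv -Bint_weight_functional//; last first.
  apply: (cintegrable_mkcond _ _).2; first exact: measurable_itv.
  apply: (@cintegrable_bndM _ _ _ _ 1) => //.
    by apply: cmeas_real; apply: measurable_indic; exact: measurable_itv.
  by move=> x _; rewrite cn_real indicE; case: (_ \in _); rewrite ?normr1 ?normr0.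
pose G v := phi v * ((\1_(`[0, +oo[%classic : set R) (t - v))%:C%C * L (f (t - v))).
have iG : cintegrable setT G.
  apply: (eq_cintegrable measurableT (g := fun v => ((\1_(`[0, +oo[%classic : set R) (t - v))%:C%C * L (f (t - v))) * phi v)).
    by move=> x _; rewrite mulrC.
  have maff : measurable_fun setT (fun v : TR => t - v : TR).
    by apply: (@measurable_eq_affine _ (-1) t) => x; ring.
  apply: (@cintegrable_bndM _ _ _ _ (2 * B)) => //.
    apply: cmeasM.
      apply: (@cmeas_comp _ _ TR TR R setT (fun v => t - v) (fun x => (\1_(`[0, +oo[%classic : set R) x)%:C%C)) => //.
      by apply: cmeas_real; apply: measurable_indic; exact: measurable_itv.
    by apply: (@cmeas_comp _ _ TR TR R setT (fun v => t - v) (fun x => L (f x))) => //; exact: cmeas_functional.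
  move=> x _; rewrite cnM cn_real indicE.
  have := functional_bounded (t - x) fL.
  by have := cn_ge0 (L (f (t - x))); case: (_ \in _); rewrite ?normr1 ?normr0/=; lra.
have := cint_affine t n1 iG; rewrite normrN1 invr1 mul1r => <-.
rewrite cint_mkcond; apply: eq_cint => x _; rewrite /G mulN1r addrC.
by rewrite (_ : t - (- x + t) = x); [ring|ring].
Qed.

Lemma prim_functional t L : functional L ->
  prim (fun x => L (f x)) t = L (Bint `[0, t]%classic f).
Proof.
move=> fL; rewrite /prim.
have i1 : cintegrable (`[0, t]%classic : set TR) (fun=> 1 : R[i]).
  by apply: cintegrable_itv; exact: ccontinuous_cst.
have := Bint_weight_functional (measurable_itv `[0, t]%R) i1 fL.
rewrite (@eq_cint _ _ _ (fun x => L (f x))); last by move=> x _; rewrite mul1r.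
by move=> ->; congr L; apply: eq_Bint => x _; rewrite scale1r.
Qed.

(** The factor [|u|] from [cis_lip] is absorbed by [damp_mulr]. The resulting continuity on the line
    Re z = a makes the left side of [boundary_function] a genuine Bochner integral. *)
Lemma laplace_lip a : 0 < a -> exists2 K, 0 <= K & forall s s',
  nrm (laplace f (a +i* s)%C - laplace f (a +i* s')%C) <= K * `|s - s'|.
Proof.
move=> a0; have a20 : 0 < a / 2 by rewrite divr_gt0.
have B0 : 0 <= B by apply: le_trans (fB 0); exact: nrm_ge0.
pose I := (\int[mu]_(u in setT) damp (a / 2) u)%R.
have I0 : 0 <= I by apply: Rintegral_ge0 => x _; exact: damp_ge0.
exists (2 * (2 * (2 * B) * (2 / a)) * I).
  by rewrite !mulr_ge0// invr_ge0 ltW.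
move=> s s'; apply: nrm_le_functional => L fL.
rewrite funB// !laplace_functional//.
have ih : cintegrable setT (damped a (fun x => L (f x))).
  apply: (@cintegrable_damped _ _ _ (2 * B)) => //; first exact: cmeas_functional.
  by move=> v _; exact: functional_bounded.
have im s0 : cintegrable setT (fun u => cis (- (s0 * u)) * damped a (fun x => L (f x)) u).
  apply: cintegrable_cisM => //.
  by apply: (@measurable_eq_affine _ (- s0) 0) => u; ring.
rewrite !fourierE -cintB//.
pose k := 2 * (2 * B) * (2 / a) * `|s - s'|.
apply: (le_trans (@cn_cint_le R setT _ (fun u => k * damp (a / 2) u) _ _ _ _)) => //.
- by apply: cmeasB; exact: cintegrable_meas.
- by apply: RintegralZl_le => //; exact: integrable_damp.
- move=> u _; rewrite -mulrBl cnM.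
  have h1 := cis_lip (- (s * u)) (- (s' * u)).
  have h2 := cn_damped_le a u (fun v (_ : 0 <= v) => functional_bounded v fL).
  rewrite (le_trans (ler_pM (cn_ge0 _) (cn_ge0 _) h1 h2))//.
  have -> : - (s * u) - - (s' * u) = - (s - s') * u by ring.
  rewrite normrM normrN /k.
  have h3 := damp_mulr u a0.
  have -> : 2 * (`|s - s'| * `|u|) * (2 * B * damp a u) =
     (2 * (2 * B) * `|s - s'|) * (damp a u * `|u|) by ring.
  have -> : 2 * (2 * B) * (2 / a) * `|s - s'| * damp (a / 2) u =
     (2 * (2 * B) * `|s - s'|) * (2 / a * damp (a / 2) u) by ring.
  by rewrite ler_wpM2l// !mulr_ge0.
rewrite RintegralZl//; last exact: integrable_damp.
by rewrite /k -/I le_eqVlt; apply/orP; left; apply/eqP; ring.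
Qed.

Lemma laplace_bounded a : 0 < a -> exists2 K, 0 <= K & forall s,
  nrm (laplace f (a +i* s)%C) <= K.
Proof.
move=> a0.
have B0 : 0 <= B by apply: le_trans (fB 0); exact: nrm_ge0.
pose I := (\int[mu]_(u in setT) damp a u)%R.
have I0 : 0 <= I by apply: Rintegral_ge0 => x _; exact: damp_ge0.
exists (2 * (2 * B) * I); first by rewrite !mulr_ge0.
move=> s; apply: nrm_le_functional => L fL.
have mL : cmeas (setT : set TR) (damped a (fun x => L (f x))).
  by apply: cmeas_damped; exact: cmeas_functional.
rewrite laplace_functional// fourierE.
apply: (le_trans (@cn_cint_le R setT _ (fun u => 2 * B * damp a u) _ _ _ _)) => //.
- by apply: cmeasM => //; exact: cmeas_cisN.
- by apply: RintegralZl_le => //; exact: integrable_damp.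
- move=> u _; rewrite cnM cn_cis mul1r.
  exact: (cn_damped_le a u (fun v (_ : 0 <= v) => functional_bounded v fL)).
rewrite RintegralZl//; last exact: integrable_damp.
by rewrite /I !mulrA.
Qed.

Lemma boundary_functional (psi : R -> R[i]) a L : 0 < a -> ccontinuous psi ->
  cintegrable setT psi -> functional L ->
  L (Bint setT (fun s => psi s *: laplace f (a +i* s)%C)) =
  cint setT (fun s => psi s * fourier (damped a (fun x => L (f x))) s).
Proof.
move=> a0 cpsi ipsi fL.
have [K K0 HK] := laplace_lip a0; have [M M0 HM] := laplace_bounded a0.
have lc x (e : R) : 0 < e -> \forall y \near x, nrm (laplace f (a +i* x)%C - laplace f (a +i* y)%C) < e.
  move=> e0; have K1 : 0 < K + 1 by rewrite ltr_wpDl.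
  have : \forall y \near x, `|x - y| < e / (K + 1).
    by exists (e / (K + 1)) => //=; rewrite divr_gt0.
  apply: filterS => y; rewrite ltr_pdivlMr// => h.
  rewrite (le_lt_trans (HK _ _))// (le_lt_trans _ h)// mulrC ler_wpM2l// lerDl//.
have ap : approximable setT (fun s => psi s *: laplace f (a +i* s)%C).
  exact: (approx_cintM measurableT ipsi lc HM).
have [|_ <-] := Bint_functional_approx measurableT ap fL.
  under eq_fun do rewrite funZ//.
  apply: cmeasM; first exact: ccontinuous_cmeas.
  by apply: ccontinuous_cmeas; exact: functional_ccontinuous lc fL.
by apply: eq_cint => s _; rewrite funZ// laplace_functional.
Qed.

End BoundedContinuous.
End Transforms.

(** * Passage to the boundary *)

Section Supports.
Context {R : realType}.
Local Notation TR := (measurableTypeR R).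
Implicit Types (g : R -> R[i]).

Lemma csupport_bounded g : compact (csupport g) ->
  exists2 A : R, 0 < A & forall x, A <= `|x| -> g x = 0.
Proof.
move=> /compact_bounded [M [Mr HM]].
pose A := Num.max M 0 + 2; have A0 : 0 < A by rewrite ltr_wpDl// le_max lexx orbT.
exists A => // x Ax; apply/eqP; apply/negP => /negP gx.
have : `|x| <= Num.max M 0 + 1.
  apply: HM; first by rewrite (le_lt_trans (y := Num.max M 0)) ?le_max ?lexx// ltrDl.
  by apply: subset_closure.
by move/(le_trans Ax); rewrite /A; lra.
Qed.

Lemma csupport_out g x : ~ csupport g x -> g x = 0.
Proof. by move=> nx; apply/eqP/negP => /negP gx; apply: nx; exact: subset_closure. Qed.

Lemma compact_closure_support {V : zmodType} (w : R -> V) (A : R) :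
  (forall x, A <= `|x| -> w x = 0) -> compact (closure [set x | w x != 0]).
Proof.
move=> w0; apply: (@subclosed_compact _ _ `[- A, A]%classic).
- exact: closed_closure.
- exact: segment_compact.
- have /closure_id -> : closed (`[- A, A]%classic : set R) by exact: itv_closed.
  apply: closure_subset => x /= wx; rewrite in_itv/= -ler_norml leNgt.
  by apply/negP => /ltW/w0 wx0; rewrite wx0 eqxx in wx.
Qed.

Lemma csupport_avoid0 g (d : R) : 0 < d -> (forall x, `|x| < d -> g x = 0) ->
  ~ csupport g 0.
Proof.
move=> d0 g0 /(_ (ball 0 d)) []; first exact: nbhsx_ballx.
by move=> x [/= gx]; rewrite /ball/= sub0r normrN => /g0 gx0; rewrite gx0 eqxx in gx.
Qed.

Lemma ccontinuous_seq g (u : nat -> R) x : ccontinuous g -> u @ \oo --> x ->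
  cn (g (u n) - g x) @[n --> \oo] --> (0 : R).
Proof.
move=> [c1 c2] ux.
have aux (h : R -> R) : continuous h -> `|h (u n) - h x| @[n --> \oo] --> (0 : R).
  move=> ch; have : h (u n) @[n --> \oo] --> h x by apply: continuous_cvg => //; exact: ch.
  by move=> /cvgB/(_ (cvg_cst (h x)))/cvg_norm; rewrite subrr normr0.
apply: (norm_le_cvg0 (v := fun n => `|complex.Re (g (u n)) - complex.Re (g x)| + `|complex.Im (g (u n)) - complex.Im (g x)|)).
  by move=> n; rewrite ger0_norm ?cn_ge0// -cReB -cImB cn_le.
by rewrite -[0]addr0; apply: cvgD; [exact: (aux (fun x => complex.Re (g x)))|exact: (aux (fun x => complex.Im (g x)))].
Qed.

Lemma damped_continuous_at (a x : R) g : ccontinuous g -> x != 0 ->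
  c_continuous_at (damped a g) x.
Proof.
move=> cg x0 u ux.
have cE : ccontinuous (fun v : R => (expR (- (a * v)))%:C%C * g v).
  apply: ccontinuousM => //; apply: ccontinuous_real => v.
  apply: continuous_comp; last exact: continuous_expR.
  by apply: continuousN; apply: continuousM; [exact: cvg_cst|exact: cvg_id].
have [xp|xn] := ltP 0 x.
  apply: cvg_trans (ccontinuous_seq cE ux).
  have : \forall n \near \oo, 0 < u n by exact: cvgr_gt ux _ xp.
  move=> un; apply: near_eq_cvg; near=> n.
  have u0 : 0 < u n by near: n.
  by rewrite /damped !dampE ?ltW.
have {}xn : x < 0 by rewrite lt_neqAle x0.
have : \forall n \near \oo, u n < 0 by exact: cvgr_lt ux _ xn.
move=> un; apply: cvg_near_cst; move: un; apply: filterS => n un.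
by rewrite /damped !damp_neg// !mul0r subrr cn0.
Unshelve. all: by end_near.
Qed.

(** [Phi] and the cutoff are both 1 near 0, so the difference vanishes there and is an admissible
    test function for [boundary_function]. *)
Definition highpass (Phi : R -> R[i]) (r t s : R) : R[i] :=
  (Phi s - (cutoff 0 (r^-1 * s))%:C%C) * cis (s * t).

Section HighPass.
Context (Phi : R -> R[i]) (r t : R).
Context (cPhi : ccontinuous Phi) (kPhi : compact (csupport Phi))
  (PhiE : \forall s \near (0 : R), Phi s = 1) (r0 : 0 < r).

Lemma ccontinuous_cutoff : ccontinuous (fun s => (cutoff 0 (r^-1 * s))%:C%C).
Proof.
apply: ccontinuous_real => s; apply: continuous_comp.
  by apply: continuousM; [exact: cvg_cst|exact: cvg_id].
exact: (@smooth_family_continuous _ _ (@smooth_family_cutoff R) 0).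
Qed.

Lemma cutoff_far s : 2 * r <= `|s| -> cutoff 0 (r^-1 * s) = 0 :> R.
Proof.
move=> h; apply: cutoff_out; rewrite normrM ger0_norm ?invr_ge0 ?(ltW r0)//.
by rewrite ler_pdivlMl// mulrC.
Qed.

Lemma cutoff_near s : `|s| <= r -> cutoff 0 (r^-1 * s) = 1 :> R.
Proof.
move=> h; apply: cutoff0_in; rewrite normrM ger0_norm ?invr_ge0 ?(ltW r0)//.
by rewrite ler_pdivrMl// mulr1.
Qed.

Lemma ccontinuous_highpass : ccontinuous (highpass Phi r t).
Proof.
by apply: ccontinuousM; [apply: ccontinuousB => //; exact: ccontinuous_cutoff|exact: ccontinuous_cis].
Qed.

Lemma highpass_far : exists2 A : R, 0 < A & forall s, A <= `|s| -> highpass Phi r t s = 0.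
Proof.
have [A A0 HA] := csupport_bounded kPhi.
exists (Num.max A (2 * r)); first by rewrite lt_max A0.
by move=> s; rewrite ge_max => /andP[h1 h2]; rewrite /highpass HA// cutoff_far// subrr mul0r.
Qed.

Lemma compact_highpass : compact (csupport (highpass Phi r t)).
Proof. by have [A _ HA] := highpass_far; exact: compact_closure_support HA. Qed.

End HighPass.

Lemma highpass_near0 (Phi : R -> R[i]) (r t : R) : (\forall s \near (0 : R), Phi s = 1) -> 0 < r ->
  exists2 rho, 0 < rho & forall s, `|s| < rho -> highpass Phi r t s = 0.
Proof.
move=> [d /= d0 Hd] r0; exists (Num.min d r); first by rewrite lt_min d0.
move=> x; rewrite lt_min => /andP[xd xr].
rewrite /highpass Hd ?cutoff_near ?subrr ?mul0r ?(ltW xr)//.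
by rewrite /ball_/= sub0r normrN.
Qed.

Lemma highpass_avoid0 (Phi : R -> R[i]) (r t : R) :
  (\forall s \near (0 : R), Phi s = 1) -> 0 < r -> ~ csupport (highpass Phi r t) 0.
Proof.
move=> PhiE r0; have [rho rho0 h] := highpass_near0 t PhiE r0.
exact: csupport_avoid0 rho0 h.
Qed.

Lemma cintegrable_compact_support g : ccontinuous g -> compact (csupport g) ->
  cintegrable setT g /\ exists2 C, 0 <= C & forall x, cn (g x) <= C.
Proof.
move=> cg /csupport_bounded[A A0 HA].
have g0 x : ~~ (- A <= x <= A) -> g x = 0.
  by rewrite -ler_norml -ltNge => /ltW/HA.
split; first exact: (cintegrable_ccontinuous cg g0).
exact: (ccontinuous_bounded cg g0).
Qed.

End Supports.

(** * The limit on vertical lines tending to the imaginary axis *)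

Section MainIdentity.
Context {R : realType} {X : completeNormedModType R[i]}.
Local Notation mu := (@lebesgue_measure R).
Local Notation TR := (measurableTypeR R).
Implicit Types (a r t u s : R) (L : X -> R[i]).

Lemma approx_L1loc (F : R -> X) (psi : R -> R[i]) : L1loc_punctured F ->
  ccontinuous psi -> compact (csupport psi) -> ~ csupport psi 0 ->
  approximable setT (fun s => psi s *: F s).
Proof.
move=> lF cpsi kpsi npsi.
have [mK aK] := bochner_approx (lF _ kpsi npsi).
have [_ [C C0 HC]] := cintegrable_compact_support cpsi kpsi.
apply: (approx_extend mK); last by move=> x /csupport_out ->; rewrite scale0r.
apply: (@approx_bndM _ _ _ _ _ C) => //.
by have [m1 m2] := ccontinuous_cmeas cpsi; split; [exact: measurable_funTS m1|exact: measurable_funTS m2].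
Qed.

Section BoundedContinuous.
Context (f F : R -> X) (B B' : R).
Context (fc : forall x (e : R), 0 < e -> \forall y \near x, nrm (f x - f y) < e)
        (fB : forall x, nrm (f x) <= B)
        (PB : forall t, 0 <= t -> nrm (Bint `[0, t]%classic f) <= B')
        (bF : boundary_function f F).

Let alpha (n : nat) : R := n.+1%:R^-1.

Lemma conv_damped_cvg (phi : R -> R[i]) t L : cintegrable setT phi -> functional L ->
  cn (cint setT (fun v => phi v * damped (alpha n) (fun x => L (f x)) (t - v)) -
      L (Defs.conv f phi t)) @[n --> \oo] --> (0 : R).
Proof.
move=> ip fL; rewrite (conv_functional fc fB)//.
have mL : cmeas (setT : set TR) (fun x => L (f x)) by exact: cmeas_functional.
have maff : measurable_fun setT (fun v : TR => t - v : TR).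
  by apply: (@measurable_eq_affine _ (-1) t) => x; ring.
have B0 : 0 <= B by apply: le_trans (fB 0); exact: nrm_ge0.
have al0 n : 0 <= alpha n by rewrite /alpha invr_ge0.
apply: (@cint_cvg R setT _ _ (fun v => 2 * B * cn (phi v))) => //.
- move=> n; apply: cmeasM; first exact: cintegrable_meas.
  apply: (@cmeas_comp _ _ TR TR R setT (fun v => t - v) (damped (alpha n) (fun x => L (f x)))) => //.
  exact: cmeas_damped.
- apply: cmeasM; first exact: cintegrable_meas.
  apply: (@cmeas_comp _ _ TR TR R setT (fun v => t - v) (fun x => (\1_(`[0, +oo[%classic : set R) x)%:C%C * L (f x))) => //.
  apply: cmeasM => //.
  by apply: cmeas_real; apply: measurable_indic; exact: measurable_itv.
- by apply: RintegralZl_le => //; exact: cintegrable_cn.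
- move=> n v _; rewrite cnM mulrC ler_wpM2r ?cn_ge0//.
  have := cn_damped_le (alpha n) (t - v) (fun x (_ : 0 <= x) => functional_bounded fB x fL).
  by move=> /le_trans; apply; rewrite -[leRHS]mulr1 ler_wpM2l ?mulr_ge0// damp_le1.
apply: aeW => v _.
apply: (norm_le_cvg0 (v := fun n => cn (phi v) * cn (L (f (t - v))) * `|t - v| * n.+1%:R^-1)); last first.
  by apply: cvg0_cstM; exact: natinv_cvg0.
move=> n; rewrite ger0_norm ?cn_ge0// -mulrBr cnM /damped -mulrBl cnM -rmorphB cn_real.
rewrite -!mulrA ler_wpM2l ?cn_ge0// mulrC ler_wpM2l ?cn_ge0// [leRHS]mulrC.
have aux (w : R) : `|damp (alpha n) w - \1_(`[0, +oo[%classic : set R) w| <= n.+1%:R^-1 * `|w|.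
  have [u0|u0] := leP 0 w; last first.
    rewrite damp_neg// indicE memNset; first by rewrite subrr normr0 mulr_ge0 ?invr_ge0.
    by rewrite /= in_itv/= andbT; apply/negP; rewrite -ltNge.
  rewrite dampE// indicE mem_set; last by rewrite /= in_itv/= u0.
  have h1 := expR_ge1Dx (- (alpha n * w)).
  have h2 : expR (- (alpha n * w)) <= 1 by rewrite -expR0 ler_expR oppr_le0 mulr_ge0.
  rewrite -/(alpha n) (ger0_norm u0) ler0_norm ?subr_le0//=; lra.
exact: aux.
Qed.

Section WithPhi.
Context (phi : R -> R[i]) (r t : R).
Local Notation Phi := (fourier phi).
Context (iphi : cintegrable setT phi)
  (cPhi : ccontinuous Phi) (kPhi : compact (csupport Phi))
  (PhiE : \forall s \near (0 : R), Phi s = 1) (r0 : 0 < r).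

Lemma boundary_cvg L : functional L ->
  cn (cint setT (fun s => highpass Phi r t s * fourier (damped (alpha n) (fun x => L (f x))) s)
      - L (Bint setT (fun s => highpass Phi r t s *: F s))) @[n --> \oo] --> (0 : R).
Proof.
move=> fL.
have cp := ccontinuous_highpass r t cPhi; have kp : compact (csupport (highpass Phi r t)) by exact: compact_highpass.
have np : ~ csupport (highpass Phi r t) 0 by exact: highpass_avoid0.
have [ip _] := cintegrable_compact_support cp kp.
have bd := bF cp kp np.
have a0 : alpha n @[n --> \oo] --> (0 : R)^'+.
  move=> P [d /= d0 HP].
  have : \forall n \near \oo, `|0 - alpha n| < d by apply: cvgr_dist_lt d0; exact: natinv_cvg0.
  by apply: filterS => n nd; apply: HP => //; rewrite /alpha invr_gt0.
have bd' := @cvg_functional _ _ _ _ (at_right_proper_filter (0 : R)) _ _ _ fL bd.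
have := @cvg_comp _ _ _ alpha _ \oo _ _ a0 bd'.
rewrite (_ : (fun n => cn (cint _ _ - _)) = (fun t0 => cn (L (Bint setT (fun s => highpass Phi r t s *: laplace f (t0 +i* s)%C)) -
  L (Bint setT (fun s => highpass Phi r t s *: F s)))) \o alpha)//.
apply/funext => n /=; rewrite (boundary_functional fc fB)//.
by rewrite /alpha invr_gt0.
Qed.

(** For the damped function, inversion expresses the convolution as a low-frequency integral plus an
    integral against [highpass]. The limit replaces the latter by the integral of [F] and removes
    the [C0] term. The factor 2 before [B'] is the bound on functionals. *)
Lemma main_bound (C0 C1 : R) L :
  (forall a r t g B B', 0 < a -> 0 < r -> ccontinuous g ->
  (forall u, 0 <= u -> cn (g u) <= B) ->
  (forall u, 0 <= u -> cn (prim g u) <= B') ->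
  cn (cint setT (fun s : R => (cutoff 0 (r^-1 * s))%:C%C * (cis (s * t) * fourier (damped a g) s)))
    <= (a * C0 + r * C1) * B') ->
  functional L ->
  cn ((poisson_mass : R)%:C%C * L (Defs.conv f phi t)
      - L (Bint setT (fun s => highpass Phi r t s *: F s))) <= r * C1 * (2 * B').
Proof.
move=> low fL.
pose g x := L (f x).
have cg : ccontinuous g := functional_ccontinuous fc fL.
have gB u : 0 <= u -> cn (g u) <= 2 * B by move=> _; exact: (functional_bounded fB).
have gP u : 0 <= u -> cn (prim g u) <= 2 * B'.
  move=> u0; rewrite /g (prim_functional fc fB)// (le_trans (fun_bound fL _))//.
  by rewrite ler_wpM2l// PB.
have B0 : 0 <= B by apply: le_trans (fB 0); exact: nrm_ge0.
have al0 n : 0 < alpha n by rewrite /alpha invr_gt0.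
pose p n := damped (alpha n) g.
have ip n : cintegrable setT (p n).
  by apply: cintegrable_damped gB => //; exact: ccontinuous_cmeas.
have pB n x : cn (p n x) <= 2 * B.
  rewrite (le_trans (cn_damped_le _ _ gB))// -[leRHS]mulr1 ler_wpM2l ?mulr_ge0//.
  by rewrite damp_le1 ?ltW.
have [iPhi _] := cintegrable_compact_support cPhi kPhi.
have E1 n : cint setT (fun s => Phi s * (cis (s * t) * fourier (p n) s)) =
    (poisson_mass : R)%:C%C * cint setT (fun v => phi v * p n (t - v)).
  by apply: (fourier_inversion_conv t iphi (ip n) (pB n)) => // x x0; exact: damped_continuous_at.
have cp := ccontinuous_highpass r t cPhi; have kp : compact (csupport (highpass Phi r t)) by exact: compact_highpass.
have [ih _] := cintegrable_compact_support cp kp.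
have cut0 x : 2 * r <= `|x| -> (cutoff 0 (r^-1 * x))%:C%C = 0 :> R[i].
  by move=> h; rewrite cutoff_far.
have [ic _] := cintegrable_compact_support (ccontinuous_cutoff r) (compact_closure_support cut0).
have bnd n (w : R -> R[i]) : cintegrable setT w ->
    cintegrable setT (fun s => w s * fourier (p n) s).
  move=> iw.
  apply: (eq_cintegrable measurableT (g := fun s => fourier (p n) s * w s)).
    by move=> x _; rewrite mulrC.
  apply: (@cintegrable_bndM _ _ _ _ (2 * (\int[mu]_(u in setT) cn (p n u))%R)) => //.
    by apply: ccontinuous_cmeas; exact: ccontinuous_fourier.
  by move=> x _; exact: cn_fourier_le.
have mt : measurable_fun setT (fun s : TR => s * t : R).
  by apply: (@measurable_eq_affine _ t 0) => x; ring.
have E2 n : cint setT (fun s => Phi s * (cis (s * t) * fourier (p n) s)) =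
    cint setT (fun s : R => (cutoff 0 (r^-1 * s))%:C%C * (cis (s * t) * fourier (p n) s)) +
    cint setT (fun s => highpass Phi r t s * fourier (p n) s).
  rewrite -cintD//.
  - by apply: eq_cint => s _; rewrite /highpass; ring.
  - apply: (eq_cintegrable measurableT (g := fun s : R => (cutoff 0 (r^-1 * s))%:C%C * cis (s * t) * fourier (p n) s)).
      by move=> x _; rewrite mulrA.
    by apply: bnd; exact: cintegrable_Mcis.
  - exact: bnd.
pose c : R[i] := (poisson_mass : R)%:C%C.
pose z n := cint setT (fun v => phi v * p n (t - v)).
pose q n := cint setT (fun s => highpass Phi r t s * fourier (p n) s).
pose lb := L (Bint setT (fun s => highpass Phi r t s *: F s)).
have z1 : cn (c * z n - c * L (Defs.conv f phi t)) @[n --> \oo] --> (0 : R).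
  by apply: cn_cvg0M; exact: conv_damped_cvg.
have q1 : cn (q n - lb) @[n --> \oo] --> (0 : R) by exact: boundary_cvg.
have lim : cn (c * z n - c * L (Defs.conv f phi t)) +
    ((C0 * (2 * B')) * n.+1%:R^-1 + r * C1 * (2 * B')) + cn (q n - lb) @[n --> \oo] --> r * C1 * (2 * B').
  rewrite -[X in _ --> X]add0r -[X in _ --> X]addr0.
  apply: cvgD => //; apply: cvgD => //.
  rewrite -[X in _ --> X]add0r; apply: cvgD; last exact: cvg_cst.
  by apply: cvg0_cstM; exact: natinv_cvg0.
apply: (cvgr_to_ge lim); near=> n.
have -> : c * L (Defs.conv f phi t) - lb =
   - (c * z n - c * L (Defs.conv f phi t)) + (c * z n - q n) + (q n - lb) by ring.
rewrite (le_trans (cnD _ _))// lerD2r (le_trans (cnD _ _))// cnN lerD2l.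
rewrite /c -E1 E2 addrK (le_trans (low _ _ _ _ _ _ (al0 n) r0 cg gB gP))//.
by rewrite le_eqVlt; apply/orP; left; apply/eqP; rewrite /alpha; ring.
Unshelve. all: by end_near.
Qed.

End WithPhi.
End BoundedContinuous.
End MainIdentity.

(** * Riemann-Lebesgue *)

Section RiemannLebesgue.
Context {R : realType}.
Local Notation mu := (@lebesgue_measure R).
Local Notation TR := (measurableTypeR R).
Implicit Types (t : R).

Lemma measurable_mulr (t : R) : measurable_fun setT (fun s : TR => s * t : R).
Proof. by apply: (@measurable_eq_affine _ t 0) => x; ring. Qed.

(** Translation by [pi / t] changes the sign of [cis (s * t)], so averaging the integral with its
    translate leaves a difference of [U], small when [U] is uniformly continuous. *)
Lemma half_period_shift (U : TR -> R[i]) t : 0 < t -> cintegrable setT U ->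
  2 * cn (cint setT (fun s => cis (s * t) * U s)) =
  cn (cint setT (fun s => cis (s * t) * (U s - U (s + pi / t)))).
Proof.
move=> t0 iU; pose V s := cis (s * t) * U s.
have iV : cintegrable setT V by apply: cintegrable_cisM => //; exact: measurable_mulr.
have n1 : (1 : R) != 0 by exact: oner_neq0.
have iV' := cintegrable_affine (pi / t) n1 iV.
have e : cint setT (fun s => cis (s * t) * (U s - U (s + pi / t))) = 2 * cint setT V.
  rewrite (@eq_cint _ _ _ (fun s => V s + V (1 * s + pi / t))); last first.
    move=> s _; rewrite /V mul1r [(s + pi / t) * t](_ : _ = s * t + pi); last by field; rewrite gt_eqF.
    by rewrite cisNpi; ring.
  by rewrite cintD// (cint_affine (pi / t) n1 iV) normr1 invr1; ring.
by rewrite e cnM; congr (_ * _); rewrite -[2 in RHS](rmorph_nat (@real_complex R)) cn_real ger0_norm.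
Qed.

Lemma continuous_dist (h : R -> R) x (e : R) : continuous h -> 0 < e ->
  \forall y \near x, `|h x - h y| < e.
Proof. by move=> ch e0; have /cvgr_dist_lt := ch x; exact. Qed.

Lemma fourier_continuous_cvg0 (h : R -> R) (N e : R) : 0 < N -> continuous h ->
  (forall x, N <= `|x| -> h x = 0) -> 0 < e ->
  \forall t \near +oo, cn (cint setT (fun s => cis (s * t) * (h s)%:C%C)) <= e.
Proof.
(* The difference lives on [[- (N + 1), N + 1]], of length [2 (N + 1)]; the 2 of [cn_cint_box]
   cancels the 2 of [half_period_shift]. *)
move=> N0 ch h0 e0; set e1 := e / (2 * (N + 2)).
have e10 : 0 < e1 by rewrite divr_gt0// mulr_gt0// ltr_wpDl// ltW.
have [d d0 Hd] := @heine_cantor R (fun x y => `|h x - h y|) (- (N + 1)) (N + 1) e1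
  (fun x y => distrC _ _) (fun x y z => ler_distD _ _ _) (fun x e => @continuous_dist h x e ch) e10.
(* A shift of less than 1 keeps the translated support inside that window. *)
pose d' := Num.min d 1; have d'0 : 0 < d' by rewrite lt_min d0 ltr01.
near=> t.
have t0 : 0 < t by near: t; exact: nbhs_pinfty_gt.
have td : pi / t < d'.
  rewrite ltr_pdivrMr// -ltr_pdivrMl//; near: t.
  by apply: nbhs_pinfty_gt; exact: num_real.
have pt0 : 0 < pi / t by rewrite divr_gt0// pi_gt0.
move: td; rewrite lt_min => /andP[td t1].
have iU : cintegrable setT (fun s : TR => (h s)%:C%C).
  by apply: (@cintegrable_out _ _ N) => [|x /h0 ->//]; exact: ccontinuous_real.
rewrite -(ler_pM2l (x := 2))// half_period_shift//.
have mh : cmeas (setT : set TR) (fun s => (h s)%:C%C) by exact: cintegrable_meas.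
apply: (@le_trans _ _ (2 * (e1 * (N + 1 - - (N + 1))))).
  apply: cn_cint_box; first lra.
  - apply: cmeasM; first by apply: cmeas_cis; exact: measurable_mulr.
    apply: cmeasB => //.
    apply: (@cmeas_comp _ _ TR TR R setT (fun s : TR => s + pi / t : TR) (fun s => (h s)%:C%C)) => //.
    by apply: (@measurable_eq_affine _ 1 (pi / t)) => x; ring.
  - move=> s sN; rewrite cnM cn_cis mul1r -rmorphB cn_real; apply/ltW/Hd => //.
    by rewrite opprD addrA subrr sub0r normrN gtr0_norm.
  - move=> s sN; have sN1 : N + 1 < `|s| by rewrite ltNge ler_norml.
    rewrite !h0 ?subr0 ?mulr0//; last by rewrite (le_trans _ (ltW sN1))// lerDl.
    have := ler_normB (s + pi / t) (pi / t); rewrite addrK (gtr0_norm pt0); lra.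
rewrite ler_wpM2l// /e1 opprK -mulrA ler_piMr ?(ltW e0)// ler_pdivrMl; lra.
Unshelve. all: by end_near.
Qed.

Lemma cutoff0_le1 (x : R) : `|cutoff 0 x| <= 1.
Proof.
rewrite /cutoff expr0 !mul1r ler_norml.
have := step0_bounds (2 * x + 3); have := step0_bounds (2 * x - 3); lra.
Qed.

(** The indicator is approximated in L^1 by a continuous function on [[- 2 M, 2 M]]. Multiplying by
    a cutoff equal to 1 on [A] gives compact support and does not increase the error. *)
Lemma riemann_lebesgue_indic (A : set TR) (M e : R) : 0 < M -> measurable A ->
  (forall x, A x -> `|x| <= M) -> 0 < e ->
  \forall t \near +oo, cn (cint setT (fun s => cis (s * t) * (\1_A s)%:C%C)) <= e.
Proof.
move=> M0 mA AM e0.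
pose E := `[- (2 * M), 2 * M]%classic : set TR.
have mE : measurable E by exact: measurable_itv.
have AE : A `<=` E by move=> x /AM; rewrite ler_norml /E/= in_itv/=; lra.
have Efin : (mu E < +oo)%E by rewrite lebesgue_measure_itv/=; case: ifP => // _; rewrite -EFinD ltry.
have iA : mu.-integrable setT (EFin \o (\1_A : TR -> R)).
  apply: (@Rintegrable_support _ _ (- M) M 1).
  - exact: measurable_indic.
  - by move=> x; rewrite indicE; case: (_ \in _); rewrite ?normr1 ?normr0.
  - by move=> x nx; rewrite indicE memNset// => /AM; rewrite ler_norml; exact/negP.
have iAE : mu.-integrable E (EFin \o (\1_A : R -> R)) by exact: integrableS iA.
have [g [cg ig g0]] := approximation_continuous_integrable mE Efin iAE.
have e4 : 0 < e / 4 by rewrite divr_gt0.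
have [n gn] : exists n, (\int[mu]_(z in E) `|((\1_A : R -> R) z - g n z)%:E| <= (e / 4)%:E)%E.
  have /fine_cvgP[fh /cvgr0Pnorm_le/(_ _ e4) h0] := g0.
  near \oo => n; exists n.
  have fn : (\int[mu]_(z in E) `|((\1_A : R -> R) z - g n z)%:E|)%E \is a fin_num by near: n.
  by rewrite -(fineK fn) lee_fin; apply: le_trans (ler_norm _) _; near: n.
pose h x := g n x * cutoff 0 (M^-1 * x).
have ch : continuous h.
  move=> x; rewrite /h; apply: cvgM; first exact: cg.
  apply: continuous_comp; first by apply: continuousM; [exact: cvg_cst|exact: cvg_id].
  exact: (@smooth_family_continuous _ _ (@smooth_family_cutoff R) 0).
have h0 x : 2 * M <= `|x| -> h x = 0.
  by move=> xM; rewrite /h cutoff_far ?mulr0.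
have M2 : 0 < 2 * M by rewrite mulr_gt0.
have e2 : 0 < e / 2 by rewrite divr_gt0.
have := fourier_continuous_cvg0 M2 ch h0 e2; apply: filterS => t.
have ih : cintegrable setT (fun s : TR => (h s)%:C%C).
  by apply: (@cintegrable_out _ _ (2 * M)) => [|x /h0 ->//]; exact: ccontinuous_real.
have icA : cintegrable setT (fun s : TR => (\1_A s)%:C%C).
  by split => //=; exact: integrable0.
have i1 : cintegrable setT (fun s => cis (s * t) * (h s)%:C%C).
  by apply: cintegrable_cisM => //; exact: measurable_mulr.
have i2 : cintegrable setT (fun s => cis (s * t) * (\1_A s)%:C%C).
  by apply: cintegrable_cisM => //; exact: measurable_mulr.
move=> hb.
have -> : cint setT (fun s => cis (s * t) * (\1_A s)%:C%C) =
   cint setT (fun s => cis (s * t) * (h s)%:C%C) +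
   cint setT (fun s => cis (s * t) * (\1_A s)%:C%C - cis (s * t) * (h s)%:C%C).
  by rewrite cintB// addrC subrK.
rewrite (le_trans (cnD _ _))//.
have -> : e = e / 2 + 2 * (e / 4) by field.
apply: lerD => //.
have iG : mu.-integrable E (fun z => `|((\1_A : R -> R) z - g n z)%:E|%E).
  apply/integrable_abse.
  rewrite (_ : (fun x => _) = (fun x => ((\1_A : R -> R) x)%:E - (g n x)%:E)%E); last by apply/funext => x; rewrite EFinB.
  by apply: integrableB => //; exact: ig.
have iG' : mu.-integrable setT (EFin \o (fun z : TR => \1_E z * `|(\1_A : R -> R) z - g n z|)).
  have := (integrable_mkcond _ mE).1 iG.
  apply: eq_integrable => // x _; rewrite patchE /= [\1_E x]indicE.
  by case: (x \in E) => /=; rewrite ?mul1r ?mul0r.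
apply: (le_trans (@cn_cint_le R setT _ (fun z : TR => \1_E z * `|(\1_A : R -> R) z - g n z|) _ _ _ _)) => //.
- by apply: cmeasB; exact: cintegrable_meas.
- move=> s _; rewrite -mulrBr cnM cn_cis mul1r -rmorphB cn_real.
  have [sE|sE] := pselect (E s); last first.
    rewrite [\1_E _]indicE (memNset sE) mul0r.
    have -> : h s = 0.
      by apply: h0; apply/ltW; rewrite ltNge ler_norml; apply/negP => hh; apply: sE; rewrite /E/= in_itv.
    by rewrite indicE memNset ?subrr ?normr0// => /AE.
  rewrite [\1_E _]indicE (mem_set sE) mul1r.
  have [sA|sA] := pselect (A s).
    by rewrite /h cutoff_near ?mulr1//; exact: AM.
  rewrite indicE (memNset sA) !sub0r !normrN /h normrM -[leRHS]mulr1 ler_wpM2l//.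
  exact: cutoff0_le1.
- rewrite ler_wpM2l// -lee_fin /Rintegral fineK; last exact: integrable_fin_num.
  apply: le_trans gn; rewrite [leRHS]integral_mkcond.
  rewrite le_eqVlt; apply/orP; left; apply/eqP; apply: eq_integral => x _.
  rewrite patchE /= [\1_E x]indicE.
  by case: (x \in E) => /=; rewrite ?mul1r ?mul0r.
Unshelve. all: by end_near.
Qed.

End RiemannLebesgue.

Section VectorRiemannLebesgue.
Context {R : realType} {X : completeNormedModType R[i]}.
Local Notation mu := (@lebesgue_measure R).
Local Notation TR := (measurableTypeR R).
Implicit Types (t : R).

Lemma cint_sum (n : nat) (G : nat -> TR -> R[i]) :
  (forall i, (i < n)%N -> cintegrable setT (G i)) ->
  cintegrable setT (fun x => \sum_(i < n) G i x) /\
  cint setT (fun x => \sum_(i < n) G i x) = \sum_(i < n) cint setT (G i).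
Proof.
elim: n => [|n ih] H.
  have -> : (fun x => \sum_(i < 0) G i x) = fun=> 0 by apply/funext => x; rewrite big_ord0.
  have i0 : cintegrable (setT : set TR) (fun=> 0 : R[i]) by split; exact: integrable0.
  split=> //; rewrite big_ord0.
  by rewrite /cint !integral0_eq.
have [|i1 e1] := ih; first by move=> i hi; apply: H; exact: ltnW.
have i2 := H n (ltnSn n).
have -> : (fun x => \sum_(i < n.+1) G i x) = (fun x => \sum_(i < n) G i x + G n x).
  by apply/funext => x; rewrite big_ord_recr.
by split; [exact: cintegrableD|rewrite cintD// e1 big_ord_recr].
Qed.

Lemma riemann_lebesgue_bochner (G : R -> X) (K : set TR) (M e : R) : 0 < M ->
  measurable K -> (forall x, K x -> `|x| <= M) -> approximable K G ->
  (forall x, ~ K x -> G x = 0) -> 0 < e ->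
  \forall t \near +oo, nrm (Bint setT (fun s => cis (s * t) *: G s)) <= e.
Proof.
move=> M0 mK KM aK G0 e0; pose e1 := e / 10; have e10 : 0 < e1 by rewrite divr_gt0.
have [s [h sK]] := aK e1 e10; have sT := sapprox_extend mK G0 sK.
have aT := approx_extend mK aK G0.
have sfK : sf_on K s by case: sK.
(* These bounds do not involve the functional, so one threshold in [t] serves all functionals. *)
pose b t i := 2 * nrm (sf_coef s i) * cn (cint setT (fun x => cis (x * t) * (\1_(sf_set s i) x)%:C%C)).
have nb : \forall t \near +oo, forall i : 'I_(sf_n s), b t i <= e1 / (sf_n s).+1%:R.
  apply: filter_forall => i.
  have [mA AK _] := sfK i (ltn_ord i).
  have c0 : 0 < 2 * nrm (sf_coef s i) + 1 by rewrite ltr_wpDl// mulr_ge0// nrm_ge0.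
  have d0 : 0 < e1 / (sf_n s).+1%:R / (2 * nrm (sf_coef s i) + 1) by rewrite !divr_gt0.
  have := riemann_lebesgue_indic M0 mA (fun x Ax => KM x (AK x Ax)) d0.
  apply: filterS => t ht; rewrite /b.
  have : (2 * nrm (sf_coef s i) + 1) * cn (cint setT (fun x => cis (x * t) * (\1_(sf_set s i) x)%:C%C)) <= e1 / (sf_n s).+1%:R.
    by rewrite -ler_pdivlMl// mulrC.
  by apply: le_trans; rewrite ler_wpM2r ?cn_ge0// lerDl.
apply: filterS nb => t nb.
have ct : cmeas (setT : set TR) (fun x => cis (x * t)) by apply: cmeas_cis; exact: measurable_mulr.
have bt : bochner_integrable setT (fun s => cis (s * t) *: G s).
  apply: approx_bochner => //; apply: (@approx_bndM _ _ _ _ _ 1) => // x _.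
  by rewrite cn_cis.
have [s' [h' [s'P dP]]] := bochner_sapprox (BintP bt) e10.
have -> : Bint setT (fun s => cis (s * t) *: G s) =
  (Bint setT (fun s => cis (s * t) *: G s) - sf_int s') + sf_int s' by rewrite subrK.
rewrite (le_trans (nrmD _ _))//.
(* One [e1] for replacing the integral by [sf_int s'], eight for comparing [s'] with [cis (x * t)]
   times [s] (two errors, each with a factor 2 from the functional and 2 from [cint_ae_le]), one for
   the indicators. *)
have -> : e = e1 + 9 * e1 by rewrite /e1; field.
apply: lerD => //; apply: nrm_le_functional => L fL.
have [s'on mh' h'0 gh' he'] := s'P; have [son mh h0 gh he] := sT.
have [i1 <-] := sf_int_functional measurableT s'on fL.
have [i2 _] := sf_int_functional measurableT son fL.
have i3 : cintegrable setT (fun x => cis (x * t) * L (sf_eval s x)).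
  by apply: cintegrable_cisM => //; exact: measurable_mulr.
have -> : cint setT (fun x => L (sf_eval s' x)) =
    cint setT (fun x => L (sf_eval s' x) - cis (x * t) * L (sf_eval s x)) +
    cint setT (fun x => cis (x * t) * L (sf_eval s x)).
  by rewrite cintB// subrK.
rewrite (le_trans (cnD _ _))//.
have -> : 9 * e1 = 2 * (2 * (e1 + e1)) + e1 by ring.
apply: lerD.
  apply: (cint_ae_le (h := fun x => 2 * (h' x + (h \_ K) x)) measurableT _ _ _ _ _).2 => //.
  - by apply: cmeasB; exact: cintegrable_meas.
  - by apply: measurable_funM => //; exact: measurable_funD.
  - by move=> x; rewrite mulr_ge0// addr_ge0.
  - apply: filterS2 gh gh' => x gx gx' Dx.
    rewrite -(funZ fL) -(funB _ _ fL) (le_trans (fun_bound fL _))// ler_pM2l//.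
    have -> : sf_eval s' x - cis (x * t) *: sf_eval s x =
      - (cis (x * t) *: G x - sf_eval s' x) + cis (x * t) *: (G x - sf_eval s x).
      by rewrite scalerBr opprB addrA subrK.
    rewrite (le_trans (nrmD _ _))// nrmN nrmZ cn_cis mul1r lerD//; [exact: gx'|exact: gx].
  - under eq_integral do rewrite EFinM.
    rewrite ge0_integralZl//=; last 2 first.
    - by apply/measurable_EFinP; exact: measurable_funD.
    - by move=> x _; rewrite lee_fin addr_ge0.
    rewrite EFinM lee_wpmul2l//.
    under eq_integral do rewrite EFinD.
    rewrite ge0_integralD//=; [|by move=> x _; rewrite lee_fin|exact/measurable_EFinP|by move=> x _; rewrite lee_fin|exact/measurable_EFinP].
    by rewrite EFinD leeD.
have cint1 (A : set TR) : measurable A -> (mu A < +oo)%E ->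
    cintegrable setT (fun x : TR => (\1_A x)%:C%C : R[i]).
  move=> mA Afin; have [iA _] := cint_indic (1 : R[i]) measurableT mA (@subsetT _ A) Afin.
  by apply: eq_cintegrable iA => // x _; rewrite mulr1 indicE rmorph_nat.
have ind i : (i < sf_n s)%N -> cintegrable setT (fun x : TR => L (sf_coef s i) * (cis (x * t) * (\1_(sf_set s i) x)%:C%C)).
  move=> hi; have [mA AK Afin] := son i hi.
  apply: cintegrableZ => //; apply: cintegrable_cisM; first exact: measurable_mulr.
  exact: cint1.
have [_ sE] := cint_sum ind.
rewrite (@eq_cint _ _ _ (fun x => \sum_(i < sf_n s) L (sf_coef s i) * (cis (x * t) * (\1_(sf_set s i) x)%:C%C))); last first.
  move=> x _; rewrite /sf_eval (fun_sum (fun i => ((x \in sf_set s i)%:R : R[i]) *: sf_coef s i) fL) mulr_sumr.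
  by apply: eq_bigr => i _; rewrite (funZ fL) indicE rmorph_nat; ring.
rewrite sE.
have cns (m : nat) (F : 'I_m -> R[i]) : cn (\sum_(i < m) F i) <= \sum_(i < m) cn (F i).
  elim/big_ind2 : _ => [|x1 x2 y1 y2 h1 h2|//]; first by rewrite cn0.
  by rewrite (le_trans (cnD _ _))// lerD.
rewrite (le_trans (cns _ _))//.
apply: (@le_trans _ _ (\sum_(i < sf_n s) e1 / (sf_n s).+1%:R)); last first.
  rewrite sumr_const card_ord -[_ *+ _]mulr_natr -mulrA ler_piMr ?(ltW e10)//.
  by rewrite mulrC ler_pdivrMr// mul1r ler_nat.
apply: ler_sum => i _.
have [mA AK Afin] := son i (ltn_ord i).
rewrite cintZ//; last first.
  apply: cintegrable_cisM; first exact: measurable_mulr.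
  exact: cint1.
apply: le_trans (nb i); rewrite cnM /b ler_wpM2r ?cn_ge0//.
exact: fun_bound.
Qed.

End VectorRiemannLebesgue.

(** * Reduction to the high-frequency integral *)

Section Reduction.
Context {R : realType} {X : completeNormedModType R[i]}.
Local Notation TR := (measurableTypeR R).
Implicit Types (r t : R).

(** Freezing [f] at [f 0] on the negative axis gives a continuous bounded function on the line, with
    the same Laplace transform, convolutions and primitive. *)
Lemma continuous_extension (f : R -> X) : {within `[0, +oo[%classic, continuous f} ->
  forall (x e : R), 0 < e ->
    \forall y \near x, nrm (f (Num.max x 0) - f (Num.max y 0)) < e.
Proof.
move=> /subspace_continuousP cf x e e0.
have pm (y : R) : `[0, +oo[%classic (Num.max y 0) by rewrite /= in_itv/= andbT le_max lexx orbT.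
have /cvg_nrmP/cvgr0Pnorm_lt/(_ _ e0) [d /= d0 Hd] := cf _ (pm x).
exists d => // y /= xy.
have : `|Num.max x 0 - Num.max y 0| < d.
  apply: le_lt_trans xy; rewrite /Num.max.
  case: (ltP x 0) => hx; case: (ltP y 0) => hy; rewrite ?subrr ?normr0 ?sub0r ?subr0 ?normrN// .
    by rewrite ger0_norm// distrC ger0_norm; lra.
  by rewrite ger0_norm// ger0_norm; lra.
by move=> /Hd /(_ (pm y)); rewrite ger0_norm ?nrm_ge0// nrm_distC.
Qed.

(** The term [t^-1] comes from asymptotic regularity and [r] from the low frequencies. [L] norms the
    convolution at [t], while [K] depends on neither [r] nor [t]. *)
Lemma tauberian_estimate (f F : R -> X) :
  {within `[0, +oo[%classic, continuous f} ->
  (exists B : R, forall t : R, 0 <= t -> nrm (f t) <= B) ->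
  asymp_regular f ->
  (exists B : R, forall t : R, 0 <= t -> nrm (Bint `[0, t]%classic f) <= B) ->
  boundary_function f F ->
  exists (Phi : R -> R[i]) (K : R), [/\ W11 Phi /\ ccontinuous Phi,
    compact (csupport Phi), (\forall s \near (0 : R), Phi s = 1), 0 <= K &
    forall r t, 0 < r -> 0 < t -> (exists2 L : X -> R[i], functional L &
      nrm (f t) <= K * (r + t^-1) +
        K * cn (L (Bint setT (fun s => highpass Phi r t s *: F s))))].
Proof.
move=> cf [B HB] [C0 [phi [C00 iphi [WPhi [cPhi kPhi]] PhiE Hconv]]] [B' HB'] bF.
pose fe u := f (Num.max u 0).
have fe_eq t : 0 <= t -> fe t = f t by move=> t0; rewrite /fe max_l.
have fec := continuous_extension cf.
have feB x : nrm (fe x) <= B by rewrite HB// le_max lexx orbT.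
have feP t : 0 <= t -> nrm (Bint `[0, t]%classic fe) <= B'.
  move=> t0; rewrite (@eq_Bint _ _ _ _ f) ?HB'// => x /=; rewrite in_itv/= => /andP[x0 _].
  exact: fe_eq.
have lapE z : laplace fe z = laplace f z.
  apply: eq_Bint => x /=; rewrite in_itv/= andbT => x0; by rewrite fe_eq.
have febF : boundary_function fe F.
  have e : laplace fe = laplace f by apply/funext.
  by move=> psi c k n; rewrite e; exact: bF.
have convE t : Defs.conv fe phi t = Defs.conv f phi t.
  apply: eq_Bint => x /=; rewrite in_itv/= andbT => x0; by rewrite fe_eq.
have [D0 [D1 [D00 D10 low]]] := @low_frequency R.
have B'0 : 0 <= B' by apply: le_trans (HB' 0 (lexx 0)); exact: nrm_ge0.
have c0 := @poisson_mass_gt0 R.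
exists (fourier phi), (C0 + (poisson_mass : R)^-1 * (D1 * (2 * B')) + (poisson_mass : R)^-1).
have ci : 0 < (poisson_mass : R)^-1 by rewrite invr_gt0.
have p1 : 0 <= (poisson_mass : R)^-1 * (D1 * (2 * B')) by rewrite !mulr_ge0 ?(ltW ci).
split=> //; first by rewrite !addr_ge0 ?(ltW C00) ?(ltW ci).
move=> r t r0 t0.
have [L [fL nL]] := norming_functional (Defs.conv f phi t).
exists L => //.
have := main_bound fec feB feP febF t iphi cPhi kPhi PhiE r0 low fL.
rewrite convE; set lb := L (Bint _ _); set cv := L _ in nL *; move=> mb.
have h1 : (poisson_mass : R) * nrm (Defs.conv f phi t) <= r * D1 * (2 * B') + cn lb.
  apply: (@le_trans _ _ (cn ((poisson_mass : R)%:C%C * cv))).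
    rewrite cnM cn_real ger0_norm ?(ltW c0)// ler_wpM2l ?(ltW c0)//.
    by rewrite (le_trans nL)// (le_trans (ler_norm _))// Re_le_cn.
  have -> : (poisson_mass : R)%:C%C * cv = ((poisson_mass : R)%:C%C * cv - lb) + lb by rewrite subrK.
  by rewrite (le_trans (cnD _ _))// lerD2r.
have h2 : nrm (Defs.conv f phi t) <= (poisson_mass : R)^-1 * (r * D1 * (2 * B') + cn lb).
  by rewrite ler_pdivlMl.
have h3 := Hconv t t0.
have h4 : nrm (f t) <= nrm (f t - Defs.conv f phi t) + nrm (Defs.conv f phi t).
  by rewrite -{1}[f t](subrK (Defs.conv f phi t)) nrmD.
have ti : 0 < t^-1 by rewrite invr_gt0.
have lb0 := cn_ge0 lb.
apply: (le_trans h4); apply: (le_trans (lerD h3 h2)).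
set ci' := (poisson_mass : R)^-1 in p1 ci *.
have q1 : 0 <= C0 * r by rewrite mulr_ge0 ?(ltW C00) ?(ltW r0).
have q2 : 0 <= ci' * (D1 * (2 * B')) * t^-1 by apply: mulr_ge0 => //; exact: ltW.
have q3 : 0 <= ci' * (r + t^-1) by rewrite mulr_ge0 ?addr_ge0 ?(ltW ci) ?(ltW r0) ?(ltW ti).
have q4 : 0 <= (C0 + ci' * (D1 * (2 * B'))) * cn lb by rewrite mulr_ge0 ?addr_ge0 ?(ltW C00).
rewrite -subr_ge0.
have -> : (C0 + ci' * (D1 * (2 * B')) + ci') * (r + t^-1) +
 (C0 + ci' * (D1 * (2 * B')) + ci') * cn lb -
 (C0 / t + ci' * (r * D1 * (2 * B') + cn lb)) =
  C0 * r + ci' * (D1 * (2 * B')) * t^-1 + ci' * (r + t^-1) + (C0 + ci' * (D1 * (2 * B'))) * cn lb by ring.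
by rewrite !addr_ge0.
Qed.

Lemma highpass_vanish (F : R -> X) (Phi : R -> R[i]) r (e : R) : L1loc_punctured F ->
  ccontinuous Phi -> compact (csupport Phi) -> (\forall s \near (0 : R), Phi s = 1) ->
  0 < r -> 0 < e ->
  \forall t \near +oo, nrm (Bint setT (fun s => highpass Phi r t s *: F s)) <= e.
Proof.
move=> lF cPhi kPhi PhiE r0 e0.
(* For fixed [r] the parameter [t] enters [highpass] only through [cis (s * t)], so Riemann-Lebesgue
   applies to this one function. *)
pose G s := highpass Phi r 0 s *: F s.
have cp := ccontinuous_highpass r 0 cPhi.
have kp : compact (csupport (highpass Phi r 0)) by exact: compact_highpass.
have np : ~ csupport (highpass Phi r 0) 0 by exact: highpass_avoid0.
have [mK aK] := bochner_approx (lF _ kp np).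
have [_ [C C00 HC]] := cintegrable_compact_support cp kp.
have [M [Mr HM]] := compact_bounded kp.
pose M1 := Num.max M 0 + 1.
have M10 : 0 < M1 by rewrite ltr_wpDl// le_max lexx orbT.
have KM x : csupport (highpass Phi r 0) x -> `|x| <= M1.
  by move=> Kx; apply: HM Kx; rewrite (le_lt_trans (y := Num.max M 0)) ?le_max ?lexx// ltrDl.
have aG : approximable (csupport (highpass Phi r 0)) G.
  apply: (@approx_bndM _ _ _ _ _ C) => //.
  by have [m1 m2] := ccontinuous_cmeas cp; split; [exact: measurable_funTS m1|exact: measurable_funTS m2].
have G0 x : ~ csupport (highpass Phi r 0) x -> G x = 0.
  by move=> /csupport_out h; rewrite /G h scale0r.
have := riemann_lebesgue_bochner M10 mK KM aG G0 e0; apply: filterS => t.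
rewrite (_ : (fun s => highpass Phi r t s *: F s) = (fun s => cis (s * t) *: G s))//.
by apply/funext => s; rewrite /G scalerA /highpass mulr0 cis0 mulr1 mulrC.
Qed.

End Reduction.

(** * High frequencies *)

Section WeakDerivative.
Context {R : realType}.
Local Notation mu := (@lebesgue_measure R).
Local Notation TR := (measurableTypeR R).
Implicit Types (t b : R).

Lemma continuous_comp_affine (g : R -> R) (a b : R) : continuous g ->
  continuous (fun x => g (a * (x - b))).
Proof.
move=> cg x; apply: continuous_comp; last exact: cg.
by apply: cvgM; [exact: cvg_cst|apply: cvgB; [exact: cvg_id|exact: cvg_cst]].
Qed.

Lemma step1_mass : cint setT (fun y : TR => (step 1 y)%:C%C) = 1 :> R[i].
Proof.
have sf := @smooth_family_step R.
have d (x : R) : -1 <= x <= 1 -> cder x (fun y => (step 0 y)%:C%C) (step 1 x)%:C%C.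
  by move=> _; exact: cder_real.
have [|_] := cint_FTC _ d (ccontinuous_real (@smooth_family_continuous _ _ sf 1)).
  lra.
rewrite step0_hi// step0_lo// subr0 => e.
rewrite -[RHS]e; apply: cint_support => x /=; rewrite in_itv/= => /negP; rewrite -ler_norml -ltNge => /ltW h.
by rewrite stepS_out.
Qed.

Lemma step0_tail (x : R) : 1 <= `|x| -> step 0 x = \1_(`[1, +oo[%classic : set R) x.
Proof.
move=> x1; rewrite indicE; have [h|h] := leP 0 x.
  by rewrite ger0_norm// in x1; rewrite step0_hi// mem_set//= in_itv/= x1.
rewrite ltr0_norm// in x1; rewrite step0_lo; last by rewrite lerNr.
by rewrite memNset//= in_itv/= andbT; apply/negP; rewrite -ltNge; lra.
Qed.

(* The weak derivative is tested against smooth steps shrinking to [b], whose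
   other edge lies to the left of the support of [Phi]. *)
Lemma W11_primitive (Phi : R -> R[i]) : ccontinuous Phi -> compact (csupport Phi) ->
  W11 Phi -> exists2 h : TR -> R[i], cintegrable setT h &
  forall b, Phi b = cint setT (fun u => (\1_(`]-oo, b]%classic : set R) u)%:C%C * h u).
Proof.
move=> cPhi kPhi [iPhi [h [ih Hh]]]; exists h => // b.
have [A A0 HA] := csupport_bounded kPhi.
have [_ [C C0 HC]] := cintegrable_compact_support cPhi kPhi.
have sf := @smooth_family_step R.
(* A plateau rising near [- n] and falling at [b] over a width of order 1 / (n + 1), written in the
   shape of [smooth_family_affine]. *)
pose w (n i : nat) (x : R) : R :=
  1 * (1 ^+ i * step i (1 * x + n%:R)) - 1 * (n.+1%:R ^+ i * step i (n.+1%:R * x + - (n.+1%:R * b))).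
have wf n : smooth_family (w n) by apply: smooth_familyB; exact: smooth_family_affine.
have wE n i x : w n i x = step i (x + n%:R) - n.+1%:R ^+ i * step i (n.+1%:R * (x - b)).
  by rewrite /w !mul1r expr1n !mul1r mulrBr.
have ws n x : n.+1%:R + `|b| + 1 <= `|x| -> w n 0%N x = 0.
  move=> hx; rewrite wE expr0 mul1r.
  have n0 : (0 : R) <= n%:R by [].
  have bb := ler_norm b; have bb' := ler_norm (- b); rewrite normrN in bb'.
  have b0 := normr_ge0 b.
  rewrite -natr1 in hx *.
  have [x0|x0] := leP 0 x.
    rewrite (ger0_norm x0) in hx; rewrite (@step0_hi _ (x + n%:R)); last lra.
    rewrite step0_hi ?subrr//; nra.
  rewrite (ltr0_norm x0) in hx; rewrite (@step0_lo _ (x + n%:R)); last lra.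
  rewrite step0_lo ?subrr//; nra.
have tw n : test_function (w n 0%N).
  by split; [exact: smooth_familyP|exact: compact_closure_support (ws n)].
have id n : (fun x => Phi x * (derive1 (w n 0%N) x)%:C%C) = (fun x => Phi x * (w n 1%N x)%:C%C).
  by apply/funext => x; rewrite derive1E; have [_ ->] := wf n 0%N x.
(* The falling edge after rescaling: an average of [Phi] near [b], since [step 1] has mass 1. *)
pose lhs n := cint setT (fun y : TR => (step 1 y)%:C%C * Phi (n.+1%:R^-1 * y + b)).
have c1 : continuous (step 1 : R -> R) := @smooth_family_continuous _ _ sf 1.
have c0 : continuous (step 0 : R -> R) := @smooth_family_continuous _ _ sf 0.
have s1out (x : R) : 1 <= `|x| -> step 1 x = 0 by exact: stepS_out.
have is1 : cintegrable setT (fun y : TR => (step 1 y)%:C%C : R[i]).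
  by apply: (@cintegrable_out _ _ 1) => [|y /s1out ->//]; exact: ccontinuous_real.
(* For such [n] the rising edge lies in [x <= - A], where [Phi] is 0. *)
have E n : (A + 1 <= n%:R)%R -> lhs n = cint setT (fun x => h x * (w n 0%N x)%:C%C).
  move=> nA; apply: oppr_inj; rewrite -Hh// id.
  have nz : (n.+1%:R^-1 : R) != 0 by [].
  pose V (x : R) := (n.+1%:R * step 1 (n.+1%:R * (x - b)))%:C%C * Phi x.
  have iV : cintegrable setT V.
    apply: (eq_cintegrable measurableT (g := fun x => (n.+1%:R * step 1 (n.+1%:R * (x - b)))%:C%C * Phi x)) => //.
    have m11 : (-1 : R) <= 1 by lra.
    have [C1 C10 HC1] := continuous_bounded_itv m11 c1.
    apply: (@cintegrable_bndM _ _ _ _ (n.+1%:R * C1)) => //.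
      apply: ccontinuous_cmeas.
      rewrite (_ : (fun x => _) = (fun x => (n.+1%:R : R)%:C%C * (step 1 (n.+1%:R * (x - b)))%:C%C)); last first.
        by apply/funext => x; rewrite rmorphM.
      apply: ccontinuousM; first exact: ccontinuous_cst.
      by apply: ccontinuous_real; exact: continuous_comp_affine.
    move=> x _; rewrite cn_real normrM normr_nat ler_wpM2l//.
    have [h1|/ltW h1] := leP `|n.+1%:R * (x - b)| 1; first by apply: HC1; rewrite -ler_norml.
    by rewrite s1out// normr0.
  rewrite (@eq_cint _ _ _ (fun x => - V x)); last first.
    move=> x _; rewrite wE expr1 rmorphB mulrBr.
    have -> : Phi x * (step 1 (x + n%:R))%:C%C = 0.
      have [h1|/ltW h1] := leP 1 `|x + n%:R|; first by rewrite s1out// mulr0.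
      rewrite HA ?mul0r//; move: h1; rewrite ler_norml => /andP[h1 h2].
      by rewrite -normrN (le_trans _ (ler_norm _))//; lra.
    by rewrite sub0r /V mulrC.
  rewrite cintN//; congr (- _).
  have := cint_affine b nz iV; rewrite normfV normr_nat invrK => e.
  have n0 : (n.+1%:R : R) != 0 by [].
  apply: (mulfI (x := (n.+1%:R : R)%:C%C)); first by apply/eqP => /(congr1 (@complex.Re R)) /eqP; exact/negP.
  rewrite -e -cintZ//; last first.
    apply: (eq_cintegrable measurableT (g := fun y : TR => Phi (n.+1%:R^-1 * y + b) * (step 1 y)%:C%C)).
      by move=> x _; rewrite mulrC.
    apply: (@cintegrable_bndM _ _ _ _ C) => //.
    apply: (@cmeas_comp _ _ TR TR R setT (fun y => n.+1%:R^-1 * y + b) Phi).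
      exact: ccontinuous_cmeas.
    exact: measurable_eq_affine.
  apply: eq_cint => y _.
  have yE : n.+1%:R * (n.+1%:R^-1 * y + b - b) = y by rewrite addrK mulrA divff// mul1r.
  by rewrite /V yE [LHS]mulrA; congr (_ * _); apply: complexP; rewrite !(cReM, cImM)/=; ring.
apply: (@cn_cvg_unique _ lhs).
- have -> : Phi b = cint setT (fun y : TR => (step 1 y)%:C%C * Phi b).
    rewrite (@eq_cint _ _ _ (fun y : TR => Phi b * (step 1 y)%:C%C)); last by move=> y _; rewrite mulrC.
    by rewrite cintZ// step1_mass mulr1.
  apply: (@cint_cvg R setT _ _ (fun y => C * cn (step 1 y)%:C%C)) => //.
  + move=> n; apply: cmeasM; first exact: cintegrable_meas.
    apply: (@cmeas_comp _ _ TR TR R setT (fun y => n.+1%:R^-1 * y + b) Phi).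
      exact: ccontinuous_cmeas.
    exact: measurable_eq_affine.
  + by apply: cmeasM; [exact: cintegrable_meas|exact: cmeas_cst].
  + by apply: RintegralZl_le => //; exact: cintegrable_cn.
  + by move=> n y _; rewrite cnM mulrC ler_wpM2r ?cn_ge0.
  + apply: aeW => y _; apply: cn_cvg0M; apply: ccontinuous_seq => //.
    rewrite -[X in _ --> X]add0r; apply: cvgD; last exact: cvg_cst.
    rewrite -[X in _ --> X](mul0r y); apply: cvgM; last exact: cvg_cst.
    exact: natinv_cvg0.
- have : cn (cint setT (fun x => (w n 0%N x)%:C%C * h x) -
     cint setT (fun u => (\1_(`]-oo, b]%classic : set R) u)%:C%C * h u)) @[n --> \oo] --> (0 : R).
    apply: (@cint_cvg R setT _ _ (fun x => 2 * cn (h x))) => //.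
    + move=> n; apply: cmeasM; last exact: cintegrable_meas.
      by apply: ccontinuous_cmeas; apply: ccontinuous_real; exact: (@smooth_family_continuous _ _ (wf n) 0%N).
    + apply: cmeasM; last exact: cintegrable_meas.
      by apply: cmeas_real; apply: measurable_indic; exact: measurable_itv.
    + by apply: RintegralZl_le => //; exact: cintegrable_cn.
    + move=> n x _; rewrite cnM cn_real ler_wpM2r ?cn_ge0// wE expr0 mul1r ler_norml.
      have := step0_bounds (x + n%:R); have := step0_bounds (n.+1%:R * (x - b)); lra.
    + have nb : mu.-negligible [set b : TR] by apply/negligibleP => //; exact: lebesgue_measure_set1.
      apply: negligibleS nb => x /= nx; apply/eqP/negP => /negP xb; apply: nx => _.
      apply: cvg_near_cst.
      have xb0 : 0 < `|x - b| by rewrite normr_gt0 subr_eq0.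
      near=> n.
      have n1 : 1 - x <= n%:R.
        rewrite (le_trans (ler_norm _))// (le_trans (ltW (archi_boundP (normr_ge0 _))))// ler_nat.
        by near: n; exact: nbhs_infty_ge.
      have n2 : `|x - b|^-1 <= n.+1%:R.
        rewrite (le_trans (ltW (archi_boundP _)))// ?invr_ge0// ler_nat leqW//.
        by near: n; exact: nbhs_infty_ge.
      rewrite wE expr0 mul1r step0_hi; last by rewrite -lerBlDl.
      have h1 : 1 <= `|n.+1%:R * (x - b)|.
        by rewrite normrM normr_nat -ler_pdivrMr// div1r.
      suff -> : step 0 (n.+1%:R * (x - b)) = 1 - \1_(`]-oo, b]%classic : set R) x.
        by rewrite subKr subrr cn0.
      rewrite step0_tail// !indicE.
      have n0 : (0 : R) < n.+1%:R by [].
      have [xb1|xb1] := leP x b.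
        rewrite memNset ?mem_set ?subrr//= in_itv//= ?xb1// andbT; apply/negP; rewrite -ltNge.
        by rewrite (le_lt_trans (y := 0))// mulr_ge0_le0 ?subr_le0// ltW.
      rewrite (memNset (A := `]-oo, b]%classic)) ?subr0; last by rewrite /= in_itv/= leNgt xb1.
      rewrite mem_set//= in_itv/= andbT (le_trans h1)// ger0_norm//.
      by rewrite mulr_ge0 ?subr_ge0// ltW.
  apply: cvg_trans; apply: near_eq_cvg; near=> n.
  rewrite E; first by congr (cn (_ - _)); apply: eq_cint => x _; rewrite mulrC.
  rewrite (le_trans (ltW (archi_boundP _)))//; first by rewrite addr_ge0// ltW.
  by rewrite ler_nat; near: n; exact: nbhs_infty_ge.
Unshelve. all: by end_near.
Qed.

Section OscillatoryTail.
Context (G G' : R -> R[i]) (A M M' t : R).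
Context (A0 : 0 < A) (t0 : 0 < t) (dG : forall x, cder x G (G' x))
  (cG' : ccontinuous G') (GA : forall x, A <= `|x| -> G x = 0)
  (GA' : forall x, A <= `|x| -> G' x = 0)
  (GM : forall x, cn (G x) <= M) (GM' : forall x, cn (G' x) <= M').

Let W s : R[i] := cis (s * t) * G s.

Let cG : ccontinuous G := cder_ccontinuous dG.

Let cW : ccontinuous W.
Proof. by apply: ccontinuousM => //; exact: ccontinuous_cis. Qed.

Let WA x : A <= `|x| -> W x = 0.
Proof. by move=> xA; rewrite /W GA// mulr0. Qed.

Let iW : cintegrable setT W.
Proof.
by exact: cintegrable_out WA.
Qed.

Definition osc_tail u : R[i] := cint setT (fun s : R => (\1_(`[u, +oo[%classic : set R) s)%:C%C * W s).

(** One integration by parts on [[u, A]]: [M] bounds the boundary term at [u], and [4 A] is the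
    constant 2 of [cn_cint_box] times the length of [[- A, A]]. Uniformity in [u] permits
    integration against [h]. *)
Lemma osc_tail_bound u : t * cn (osc_tail u) <= M + 4 * A * M'.
Proof.
have M0 : 0 <= M by apply: le_trans (GM 0); exact: cn_ge0.
have M'0 : 0 <= M' by apply: le_trans (GM' 0); exact: cn_ge0.
have [uA|uA] := leP A u.
  rewrite /osc_tail (@eq_cint _ _ _ (fun=> 0)).
    rewrite /cint !integral0_eq// cn0 mulr0 addr_ge0// mulr_ge0// mulr_ge0// ltW//.
  move=> s _; rewrite indicE; have [us|us] := leP u s.
    by rewrite WA ?mulr0// (le_trans uA)// (le_trans us)// ler_norm.
  by rewrite memNset ?mul0r//= in_itv/= andbT; apply/negP; rewrite -ltNge.
have -> : osc_tail u = cint `[u, A]%classic W.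
  rewrite [RHS]cint_mkcond; apply: eq_cint => s _.
  have [h|h] := leP s A.
    by congr (_%:C%C * _); rewrite !indicE; congr (nat_of_bool _)%:R;
      apply/idP/idP => /set_mem/=; rewrite in_itv/= ?h ?andbT => hs; apply/mem_set; rewrite /= in_itv/= ?h ?andbT.
  by rewrite WA ?mulr0// (le_trans (ltW h))// ler_norm.
pose V' s := ('i%C * t%:C%C) * W s + cis (s * t) * G' s.
have dW x : u <= x <= A -> cder x W (V' x).
  move=> _; have := cderM (cder_cis x t) (dG x); rewrite /V' /W; congr cder; ring.
have cV : ccontinuous V'.
  by apply: ccontinuousD; apply: ccontinuousM => //; [exact: ccontinuous_cst|exact: ccontinuous_cis].
have [iV e] := cint_FTC uA dW cV.
have iWu : cintegrable `[u, A]%classic W by exact: cintegrable_itv.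
have cX : ccontinuous (fun s => cis (s * t) * G' s).
  by apply: ccontinuousM => //; exact: ccontinuous_cis.
have iX : cintegrable `[u, A]%classic (fun s => cis (s * t) * G' s) by exact: cintegrable_itv.
have {}e : ('i%C * t%:C%C) * cint `[u, A]%classic W = - W u - cint `[u, A]%classic (fun s => cis (s * t) * G' s).
  apply/eqP; rewrite eq_sym subr_eq; apply/eqP.
  have mI : measurable (`[u, A]%classic : set TR) by exact: measurable_itv.
  rewrite -(cintZ _ mI iWu) -(cintD mI (cintegrableZ _ mI iWu) iX).
  by rewrite -/V' e (WA (x := A)) ?sub0r// ler_norm.
have -> : t * cn (cint `[u, A]%classic W) = cn (('i%C * t%:C%C) * cint `[u, A]%classic W).
  rewrite !cnM cn_real gtr0_norm// (_ : cn 'i%C = 1) ?mul1r//.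
  by rewrite cnE/= expr0n/= add0r expr1n sqrtr1.
rewrite e (le_trans (cnB _ _))// cnN lerD//; first by rewrite /W cnM cn_cis mul1r.
rewrite cint_mkcond.
have AA : - A <= A by rewrite ge0_cp// ltW.
have -> : 4 * A * M' = 2 * (M' * (A - - A)) by ring.
apply: cn_cint_box => //.
- apply: cmeasM; last exact: ccontinuous_cmeas.
  by apply: cmeas_real; apply: measurable_indic; exact: measurable_itv.
- move=> x _; rewrite cnM cn_real indicE cnM cn_cis mul1r.
  by case: (_ \in _); rewrite ?normr1 ?normr0 ?mul1r ?mul0r.
- by move=> x; rewrite -ler_norml -ltNge => /ltW/GA' ->; rewrite !mulr0.
Qed.

Lemma ccontinuous_osc_tail : ccontinuous osc_tail.
Proof.
apply: ccontinuous_cvg => u x ux.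
apply: (@cint_cvg R setT _ _ (fun s => cn (W s))) => //.
- move=> n; apply: cmeasM; last exact: cintegrable_meas.
  by apply: cmeas_real; apply: measurable_indic; exact: measurable_itv.
- apply: cmeasM; last exact: cintegrable_meas.
  by apply: cmeas_real; apply: measurable_indic; exact: measurable_itv.
- exact: cintegrable_cn.
- move=> n s _; rewrite cnM cn_real indicE.
  by case: (_ \in _); rewrite ?normr1 ?normr0 ?mul1r ?mul0r// cn_ge0.
have nb : mu.-negligible [set x : TR] by apply/negligibleP => //; exact: lebesgue_measure_set1.
apply: negligibleS nb => s /= ns; apply/eqP/negP => /negP sx; apply: ns => _.
have [h|h] := ltP x s.
  have : \forall n \near \oo, u n < s by exact: cvgr_lt ux _ h.
  move=> un; apply: cvg_near_cst; move: un; apply: filterS => n un.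
  by rewrite !indicE !mem_set ?subrr ?cn0//= in_itv/= ?(ltW h) ?(ltW un).
have {}h : s < x by rewrite lt_neqAle sx.
have : \forall n \near \oo, s < u n by exact: cvgr_gt ux _ h.
move=> un; apply: cvg_near_cst; move: un; apply: filterS => n un.
by rewrite !indicE !memNset ?subrr ?cn0//= in_itv/= andbT; apply/negP; rewrite -ltNge.
Qed.

(* Writing [Phi] as the integral of [h] and exchanging integrals leaves tails
   of a smooth oscillatory integral, so no derivative falls on [Phi]. *)
Lemma primitive_fourier_bound (Phi h : TR -> R[i]) : cintegrable setT h ->
  (forall b, Phi b = cint setT (fun u => (\1_(`]-oo, b]%classic : set R) u)%:C%C * h u)) ->
  t * cn (cint setT (fun s => cis (s * t) * (Phi s * G s))) <=
  (M + 4 * A * M') * (2 * (\int[mu]_(u in setT) cn (h u))%R).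
Proof.
move=> ih PhiE.
pose k (p : TR * TR) : R[i] := W p.1 * ((\1_[set q : TR * TR | q.2 <= q.1] p)%:C%C * h p.2).
have indE s u : \1_[set q : TR * TR | q.2 <= q.1] (s, u) = \1_(`]-oo, s]%classic : set R) u :> R.
  rewrite !indicE; have [us|us] := leP u s; first by rewrite !mem_set//= in_itv.
  by rewrite !memNset//= ?in_itv/=; apply/negP; rewrite -ltNge.
have indE' s u : \1_[set q : TR * TR | q.2 <= q.1] (s, u) = \1_(`[u, +oo[%classic : set R) s :> R.
  rewrite !indicE; have [us|us] := leP u s; first by rewrite !mem_set//= in_itv/= us.
  by rewrite !memNset//= ?in_itv/= ?andbT; apply/negP; rewrite -ltNge.
have iI s : cintegrable setT (fun u : TR => (\1_(`]-oo, s]%classic : set R) u)%:C%C * h u).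
  apply: (@cintegrable_bndM _ _ _ _ 1) => //.
    by apply: cmeas_real; apply: measurable_indic; exact: measurable_itv.
  by move=> x _; rewrite cn_real indicE; case: (_ \in _); rewrite ?normr1 ?normr0.
rewrite (@eq_cint _ _ _ (fun s => cint setT (fun u => k (s, u)))); last first.
  move=> s _; rewrite PhiE.
  rewrite (@eq_cint _ _ (fun u => k (s, u)) (fun u => W s * ((\1_(`]-oo, s]%classic : set R) u)%:C%C * h u))); last first.
    by move=> u _; rewrite /k indE.
  by rewrite cintZ// /W; ring.
rewrite (@cfubini_prod R k (fun s => cn (W s)) (fun u => cn (h u))).
- rewrite (@eq_cint _ _ _ (fun u => osc_tail u * h u)); last first.
    move=> u _; rewrite mulrC /osc_tail -cintZ//; last first.
      apply: (@cintegrable_bndM _ _ _ _ 1) => //.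
        by apply: cmeas_real; apply: measurable_indic; exact: measurable_itv.
      by move=> x _; rewrite cn_real indicE; case: (_ \in _); rewrite ?normr1 ?normr0.
    by apply: eq_cint => s _; rewrite /k indE'; rewrite /=; ring.
  pose K := (M + 4 * A * M') / t.
  have ihn : mu.-integrable setT (EFin \o (fun u => cn (h u))) by exact: cintegrable_cn.
  have mh : cmeas (setT : set TR) (fun u => osc_tail u * h u).
    by apply: cmeasM; [apply: ccontinuous_cmeas; exact: ccontinuous_osc_tail|exact: cintegrable_meas].
  have hK (u : TR) : setT u -> cn (osc_tail u * h u) <= K * cn (h u).
    by move=> _; rewrite cnM ler_wpM2r ?cn_ge0// /K ler_pdivlMr// mulrC osc_tail_bound.
  have := cn_cint_le measurableT mh (RintegralZl_le K measurableT ihn) hK.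
  rewrite RintegralZl// => hb.
  have := ler_wpM2l (ltW t0) hb; move=> /le_trans; apply.
  by rewrite /K le_eqVlt; apply/orP; left; apply/eqP; field; rewrite gt_eqF.
- apply: cmeasM.
    apply: (@cmeas_comp _ _ _ TR R setT fst W); last exact: measurable_fst.
    exact: cintegrable_meas.
  apply: cmeasM.
    apply: cmeas_real; apply: measurable_indic.
    have md : measurable_fun setT (fun q : TR * TR => q.1 - q.2 : R).
      by apply: measurable_funB; [exact: measurable_fst|exact: measurable_snd].
    have := md measurableT _ (measurable_itv `[0, +oo[%R); rewrite setTI.
    congr measurable; apply/seteqP; split => q /=; by rewrite in_itv/= andbT subr_ge0.
  apply: (@cmeas_comp _ _ _ TR R setT snd h); last exact: measurable_snd.
  exact: cintegrable_meas.
- exact: cintegrable_cn.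
- exact: cintegrable_cn.
- move=> s u; rewrite /k cnM ler_wpM2l ?cn_ge0// cnM cn_real indicE.
  by case: (_ \in _); rewrite ?normr1 ?normr0 ?mul1r ?mul0r// cn_ge0.
Qed.

End OscillatoryTail.

End WeakDerivative.

(** * Repeated integration by parts *)

Section Masks.
Context {R : realType}.
Local Notation TR := (measurableTypeR R).
Local Notation Re := complex.Re.
Local Notation Im := complex.Im.
Implicit Types (g v : R -> R[i]) (w : nat -> R -> R) (s x rho a b : R).

Definition cont_at g s :=
  {for s, continuous (fun x => Re (g x))} /\ {for s, continuous (fun x => Im (g x))}.

Lemma cont_atM v g s : cont_at v s -> cont_at g s -> cont_at (fun x => v x * g x) s.
Proof.
move=> [v1 v2] [g1 g2]; split.
  rewrite (_ : (fun x => _) = (fun x => Re (v x) * Re (g x) - Im (v x) * Im (g x))); last first.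
    by apply/funext => x; rewrite cReM.
  by apply: continuousB; apply: continuousM.
rewrite (_ : (fun x => _) = (fun x => Re (v x) * Im (g x) + Im (v x) * Re (g x))); last first.
  by apply/funext => x; rewrite cImM.
by apply: continuousD; apply: continuousM.
Qed.

(** A factor vanishing near 0 masks a possible singularity of [g] at 0; away from 0 this is the
    product rule. *)
Lemma ccontinuous_mask v g rho : 0 < rho -> ccontinuous v ->
  (forall s, `|s| < rho -> v s = 0) -> (forall s, s != 0 -> cont_at g s) ->
  ccontinuous (fun s => v s * g s).
Proof.
move=> rho0 [v1 v2] v0 cg.
suff H s : cont_at (fun x => v x * g x) s by split=> s; have [] := H s.
have [->|s0] := eqVneq s 0; last by apply: cont_atM; [split; [exact: v1|exact: v2]|exact: cg].
have n0 : \forall x \near (0 : R), v x * g x = 0.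
  by exists rho => //= x /=; rewrite /ball_/= sub0r normrN => /v0 ->; rewrite mul0r.
have vz : v 0 * g 0 = 0 by rewrite v0 ?normr0// mul0r.
split.
  by apply: cvg_near_cst; rewrite vz; move: n0; apply: filterS => x ->.
by apply: cvg_near_cst; rewrite vz; move: n0; apply: filterS => x ->.
Qed.

Lemma cder_mask v v' g g' rho : 0 < rho -> (forall s, cder s v (v' s)) ->
  (forall s, `|s| < rho -> v s = 0) -> (forall s, `|s| < rho -> v' s = 0) ->
  (forall s, s != 0 -> cder s g (g' s)) ->
  forall s, cder s (fun x => v x * g x) (v' s * g s + v s * g' s).
Proof.
move=> rho0 dv v0 v'0 dg s.
have [->|s0] := eqVneq s 0; last exact: cderM (dv s) (dg s s0).
rewrite v0 ?normr0// v'0 ?normr0// !mul0r addr0.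
apply: (cder_near (U := fun=> 0)); last exact: cder_cst.
by exists rho => //= x /=; rewrite /ball_/= sub0r normrN => /v0 ->; rewrite mul0r.
Qed.

(* [band a b 0] is 1 for [2 a <= |s| <= b] and vanishes unless [a < |s| < 2 b];
   [band a b i] is its [i]-th derivative. *)
Definition band a b (i : nat) s : R :=
  1 * ((b^-1) ^+ i * cutoff i (b^-1 * s + 0)) - 1 * ((a^-1) ^+ i * cutoff i (a^-1 * s + 0)).

Lemma bandE a b i s :
  band a b i s = (b^-1) ^+ i * cutoff i (b^-1 * s) - (a^-1) ^+ i * cutoff i (a^-1 * s).
Proof. by rewrite /band !mul1r !addr0. Qed.

Lemma smooth_family_band a b : smooth_family (band a b).
Proof. by apply: smooth_familyB; apply: smooth_family_affine; exact: smooth_family_cutoff. Qed.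

Lemma norm_dilate a s : 0 < a -> `|a^-1 * s| = a^-1 * `|s|.
Proof. by move=> a0; rewrite normrM ger0_norm// invr_ge0 ltW. Qed.

Lemma band_in a b i s : 0 < a -> a <= b -> `|s| <= a -> band a b i s = 0.
Proof.
move=> a0 ab sa; have b0 : 0 < b by exact: lt_le_trans ab.
have sb : `|s| <= b by exact: le_trans ab.
have h1 : `|a^-1 * s| <= 1 by rewrite norm_dilate// ler_pdivrMl// mulr1.
have h2 : `|b^-1 * s| <= 1 by rewrite norm_dilate// ler_pdivrMl// mulr1.
rewrite bandE; case: i => [|i]; first by rewrite !cutoff0_in// !expr0 subrr.
by rewrite !cutoffS_in// !mulr0 subrr.
Qed.

Lemma band_out a b i s : 0 < a -> a <= b -> 2 * b <= `|s| -> band a b i s = 0.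
Proof.
move=> a0 ab sb; have b0 : 0 < b by exact: lt_le_trans ab.
rewrite bandE !cutoff_out ?mulr0 ?subrr//.
  by rewrite norm_dilate// ler_pdivlMl// mulrC (le_trans _ sb)// ler_wpM2l.
by rewrite norm_dilate// ler_pdivlMl// mulrC.
Qed.

Lemma band0_one a b s : 0 < a -> a <= b -> 2 * a <= `|s| -> `|s| <= b -> band a b 0 s = 1.
Proof.
move=> a0 ab sa sb; have b0 : 0 < b by exact: lt_le_trans ab.
rewrite bandE !expr0 !mul1r cutoff0_in; last by rewrite norm_dilate// ler_pdivrMl// mulr1.
by rewrite cutoff_out ?subr0// norm_dilate// ler_pdivlMl// mulrC.
Qed.

Section Oscillatory.
Context (g : nat -> R -> R[i]) (k : nat).
Context (dg : forall j, (j < k)%N -> forall s, s != 0 -> cder s (g j) (g j.+1 s))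
  (cg : forall j, (j <= k)%N -> forall s, s != 0 -> cont_at (g j) s).

Section Band.
Context (a b t : R).
Context (a0 : 0 < a) (ab : a <= b) (t0 : 0 < t).

(** [j] counts the derivatives on [g] and [i] those on the band. *)
Definition osc j i : R[i] := cint setT (fun s => cis (s * t) * ((band a b i s)%:C%C * g j s)).

Let b0 : 0 < b. Proof. exact: lt_le_trans ab. Qed.
Let b2 : 0 < 2 * b. Proof. by rewrite mulr_gt0. Qed.

Lemma ccontinuous_band_mul j i : (j <= k)%N -> ccontinuous (fun s => (band a b i s)%:C%C * g j s).
Proof.
move=> jk; apply: (ccontinuous_mask a0); last exact: cg.
  by apply: ccontinuous_real; exact: (@smooth_family_continuous _ _ (smooth_family_band a b) i).
by move=> s /ltW h; rewrite band_in.
Qed.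

Lemma band_mul_out j i s : 2 * b <= `|s| -> (band a b i s)%:C%C * g j s = 0.
Proof. by move=> h; rewrite band_out// mul0r. Qed.

Lemma cintegrable_band_mul j i : (j <= k)%N ->
  cintegrable setT (fun s : TR => (band a b i s)%:C%C * g j s).
Proof.
by move=> jk; apply: (@cintegrable_out _ _ (2 * b)) => [|x /band_mul_out//]; exact: ccontinuous_band_mul.
Qed.

Lemma cder_band_mul j i s : (j < k)%N ->
  cder s (fun x => (band a b i x)%:C%C * g j x)
    ((band a b i.+1 s)%:C%C * g j s + (band a b i s)%:C%C * g j.+1 s).
Proof.
move=> jk.
apply: (cder_mask (v' := fun x => (band a b i.+1 x)%:C%C) (g' := g j.+1) a0).
- by move=> x; apply: cder_real; exact: smooth_family_band.
- by move=> x /ltW h; rewrite band_in.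
- by move=> x /ltW h; rewrite band_in.
- exact: dg.
Qed.

Lemma osc_ibp j i : (j < k)%N -> t * cn (osc j i) <= cn (osc j.+1 i) + cn (osc j i.+1).
Proof.
move=> jk; pose U' s := (band a b i.+1 s)%:C%C * g j s + (band a b i s)%:C%C * g j.+1 s.
have cU' : ccontinuous U' by apply: ccontinuousD; apply: ccontinuous_band_mul => //; exact: ltnW.
have := @fourier_ibp R (2 * b) t _ U' b2 (fun s => cder_band_mul i s jk) cU'.
rewrite (gtr0_norm t0) => ->.
- rewrite /U' (@eq_cint _ _ _ (fun s => cis (s * t) * ((band a b i.+1 s)%:C%C * g j s) +
     cis (s * t) * ((band a b i s)%:C%C * g j.+1 s))); last by move=> s _; rewrite mulrDr.
  have mt := @measurable_mulr R t.
  rewrite cintD//; [|apply: cintegrable_cisM => //; apply: cintegrable_band_mul; exact: ltnW|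
    by apply: cintegrable_cisM => //; exact: cintegrable_band_mul].
  by rewrite addrC (le_trans (cnD _ _)).
- by move=> x; exact: band_mul_out.
- by move=> x h; rewrite /U' !band_mul_out// addr0.
Qed.

(** Each integration by parts doubles the number of terms, and after [n] of them all have total
    order [k]. The factor [2 ^ n] is harmless for a fixed order. *)
Lemma osc_iter (Bd : R) n j i :
  (forall j i, (j + i = k)%N -> cn (osc j i) <= Bd) -> (j + i + n = k)%N ->
  t ^+ n * cn (osc j i) <= 2 ^+ n * Bd.
Proof.
move=> H; elim: n j i => [|n ih] j i e; first by rewrite !expr0 !mul1r H// -e addn0.
have jk : (j < k)%N by rewrite -e addnS ltnS -addnA leq_addr.
have h1 := ih j.+1 i; have h2 := ih j i.+1.
rewrite !exprS -mulrA; apply: (@le_trans _ _ (t ^+ n * (cn (osc j.+1 i) + cn (osc j i.+1)))).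
  by rewrite mulrCA; apply: ler_wpM2l; [exact: exprn_ge0 (ltW t0)|exact: osc_ibp].
rewrite mulrDr (_ : 2 * 2 ^+ n * Bd = 2 ^+ n * Bd + 2 ^+ n * Bd); last by ring.
by apply: lerD; [apply: h1|apply: h2]; rewrite -e ?addSn ?addnS.
Qed.

(** Only the term with the derivative on [g] is integrated again, so each step leaves behind one
    term with a single derivative of the band. This avoids both [2 ^ N] and high derivatives of the
    band when [N] grows with [t]. *)
Lemma osc_sum N : (N <= k)%N ->
  cn (osc 0 0) <= \sum_(n < N) cn (osc n 1) * t^-1 ^+ n.+1 + cn (osc N 0) * t^-1 ^+ N.
Proof.
elim: N => [|N ih] Nk; first by rewrite big_ord0 add0r expr0 mulr1.
rewrite (le_trans (ih (ltnW Nk)))// big_ord_recr/= -addrA lerD2l.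
have h := osc_ibp 0 Nk.
have tN : 0 <= t^-1 ^+ N.+1 by rewrite exprn_ge0// invr_ge0 ltW.
move: (cn (osc N 0)) (cn (osc N.+1 0)) (cn (osc N 1)) h => p q w h.
have e : t * p * t^-1 ^+ N.+1 = p * t^-1 ^+ N.
  by rewrite exprS mulrACA divff ?mul1r// (gt_eqF t0).
by rewrite -e addrC -mulrDl ler_wpM2r.
Qed.

Lemma osc_box j i (C : R) : (j <= k)%N ->
  (forall s, cn ((band a b i s)%:C%C * g j s) <= C) -> cn (osc j i) <= 8 * b * C.
Proof.
move=> jk H; have bb : - (2 * b) <= 2 * b by rewrite ge0_cp// ltW.
have -> : 8 * b * C = 2 * (C * (2 * b - - (2 * b))) by ring.
apply: cn_cint_box => //.
- apply: cmeasM; first by apply: cmeas_cis; exact: measurable_mulr.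
  by apply: ccontinuous_cmeas; exact: ccontinuous_band_mul.
- by move=> x _; rewrite cnM cn_cis mul1r.
- by move=> x; rewrite -ler_norml -ltNge => /ltW/band_mul_out ->; rewrite mulr0.
Qed.

End Band.
End Oscillatory.

(* [Phi - cutoff (./r)] is split at frequency 1/2: the part beyond is
   [O(1/t)] because [Phi] is a primitive, the part below is [osc]. *)
Lemma highpass_decomposition (Phi : R -> R[i]) : W11 Phi -> ccontinuous Phi ->
  compact (csupport Phi) -> (\forall s \near (0 : R), Phi s = 1) ->
  exists delta A K : R, [/\ 0 < delta, delta <= A, 0 <= K &
  forall (g : nat -> R -> R[i]) (k : nat) (M0 M1 r t : R), (0 < k)%N ->
    (forall j, (j < k)%N -> forall s, s != 0 -> cder s (g j) (g j.+1 s)) ->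
    (forall j, (j <= k)%N -> forall s, s != 0 -> cont_at (g j) s) ->
    (forall s, cn ((band delta A 0 s)%:C%C * g 0%N s) <= M0) ->
    (forall s, cn ((band delta A 1 s)%:C%C * g 0%N s) <= M1) ->
    (forall s, cn ((band delta A 0 s)%:C%C * g 1%N s) <= M1) ->
    0 < r -> r <= 2^-1 -> 0 < t ->
    t * (cn (cint setT (fun s => highpass Phi r t s * g 0%N s) - osc g r 2^-1 t 0 0))
      <= K * (M0 + M1)].
Proof.
move=> WPhi cPhi kPhi PhiE.
have [h ih hE] := W11_primitive cPhi kPhi WPhi.
have [A1 A10 HA1] := csupport_bounded kPhi.
have [d /= d0 Hd] := PhiE.
have Phi1 s : `|s| < d -> Phi s = 1 by move=> sd; apply: Hd; rewrite /ball_/= sub0r normrN.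
have [B1 B10 HB1] := @cutoff_bounded R 1.
(* For [|s| <= 2 delta] both [Phi s] and [cutoff 0 (2 s)] are 1; for [|s| >= A] both are 0. Both
   numbers depend on [Phi] only, so [M0] and [M1] can be fixed before [r] and [t]. *)
pose delta := Num.min (d / 3) (5^-1); pose A := Num.max A1 1.
have d3 : 0 < d / 3 by rewrite divr_gt0.
have i5 : (0 : R) < 5^-1 by rewrite invr_gt0.
have de0 : 0 < delta by rewrite lt_min d3 i5.
have de1 : delta <= d / 3 by rewrite ge_min lexx.
have de2 : delta <= 5^-1 by rewrite ge_min lexx orbT.
have A1' : 1 <= A by rewrite le_max lexx orbT.
have AA1 : A1 <= A by rewrite le_max lexx.
have A0 : 0 < A by exact: lt_le_trans A1'.
have deA : delta <= A by lra.
pose H := (\int[@lebesgue_measure R]_(u in setT) cn (h u))%R.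
have H0 : 0 <= H by apply: Rintegral_ge0 => x _; exact: cn_ge0.
exists delta, A, ((1 + 16 * A) * (2 * H) + 8 * A * (2 * B1 + 2)); split => //.
  by rewrite addr_ge0// !mulr_ge0// ?addr_ge0// ?mulr_ge0// ltW.
move=> g k M0 M1 r t k0 dg cg HM0 HM1 HM1' r0 r2 t0.
have M00 : 0 <= M0 by apply: le_trans (HM0 0); exact: cn_ge0.
have M10 : 0 <= M1 by apply: le_trans (HM1 0); exact: cn_ge0.
have h0 : (0 : R) < 2^-1 by rewrite invr_gt0.
have A20 : 0 < 2 * A by rewrite mulr_gt0.
pose G s := (band delta A 0 s)%:C%C * g 0%N s.
pose G' s := (band delta A 1 s)%:C%C * g 0%N s + (band delta A 0 s)%:C%C * g 1%N s.
have dG s : cder s G (G' s) by exact: (cder_band_mul dg de0 deA 0 s k0).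
have cG : ccontinuous G := cder_ccontinuous dG.
have cG' : ccontinuous G'.
  by apply: ccontinuousD; exact: (ccontinuous_band_mul cg de0 deA).
have GA s : 2 * A <= `|s| -> G s = 0 by exact: (band_mul_out _ de0 deA).
have GA' s : 2 * A <= `|s| -> G' s = 0.
  by move=> hs; rewrite /G' !(band_mul_out _ de0 deA)// addr0.
have GM' s : cn (G' s) <= M1 + M1.
  by rewrite (le_trans (cnD _ _))// lerD.
have b1 := @primitive_fourier_bound R G G' (2 * A) M0 (M1 + M1) t A20 t0 dG cG' GA GA' HM0 GM' Phi h ih hE.
(* The cutoff at frequency 1/2: [X 0] minus the cutoff at [r] is exactly [band r 2^-1 0]. *)
pose X (i : nat) (s : R) : R := 1 * (2 ^+ i * cutoff i (2 * s + 0)).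
have sX : smooth_family X by apply: smooth_family_affine; exact: smooth_family_cutoff.
pose U s := (X 0%N s)%:C%C * G s.
pose U' s := (X 1%N s)%:C%C * G s + (X 0%N s)%:C%C * G' s.
have dU s : cder s U (U' s) by apply: cderM (dG s); apply: cder_real; exact: sX.
have cX i : ccontinuous (fun s => (X i s)%:C%C).
  by apply: ccontinuous_real; exact: (@smooth_family_continuous _ _ sX i).
have cU : ccontinuous U by exact: ccontinuousM.
have cU' : ccontinuous U' by apply: ccontinuousD; exact: ccontinuousM.
have UA s : 2 * A <= `|s| -> U s = 0 by move=> /GA; rewrite /U => ->; rewrite mulr0.
have UA' s : 2 * A <= `|s| -> U' s = 0.
  by move=> hs; rewrite /U' GA// GA'// !mulr0 addr0.
have b2 := fourier_ibp t A20 dU cU' UA UA'.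
have b3 : cn (cint setT (fun s => cis (s * t) * U' s)) <= 8 * A * (2 * B1 * M0 + (M1 + M1)).
  have -> : 8 * A * (2 * B1 * M0 + (M1 + M1)) = 2 * ((2 * B1 * M0 + (M1 + M1)) * (2 * A - - (2 * A))) by ring.
  apply: cn_cint_box.
  - by rewrite ge0_cp// ltW.
  - apply: cmeasM; last exact: ccontinuous_cmeas.
    by apply: cmeas_cis; exact: measurable_mulr.
  - move=> s _; rewrite cnM cn_cis mul1r (le_trans (cnD _ _))// (cnM _ (G s)) (cnM _ (G' s)) !cn_real lerD//.
      apply: ler_pM; [exact: normr_ge0|exact: cn_ge0| |exact: HM0].
      by rewrite /X mul1r expr1 normrM ger0_norm// ler_wpM2l// HB1.
    rewrite -[leRHS]mul1r; apply: ler_pM; [exact: normr_ge0|exact: cn_ge0| |exact: GM'].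
    by rewrite /X expr0 !mul1r cutoff0_le1.
  - by move=> s; rewrite -ler_norml -ltNge => /ltW/UA' ->; rewrite mulr0.
have mt := @measurable_mulr R t.
have i1 : cintegrable setT (fun s => cis (s * t) * (Phi s * G s)).
  apply: cintegrable_cisM => //; apply: (@cintegrable_out _ _ (2 * A)); first exact: ccontinuousM.
  by move=> s /GA ->; rewrite mulr0.
have i2 : cintegrable setT (fun s => cis (s * t) * U s).
  by apply: cintegrable_cisM => //; exact: cintegrable_out UA.
have i3 : cintegrable setT (fun s => cis (s * t) * ((band r 2^-1 0 s)%:C%C * g 0%N s)).
  by apply: cintegrable_cisM => //; exact: (cintegrable_band_mul cg r0 r2).
have -> : cint setT (fun s => highpass Phi r t s * g 0%N s) =
    cint setT (fun s => cis (s * t) * (Phi s * G s)) - cint setT (fun s => cis (s * t) * U s)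
      + osc g r 2^-1 t 0 0.
  rewrite -cintB// -cintD//; last exact: cintegrableB.
  apply: eq_cint => s _.
  (* On the support of [Phi - X 0] the band is 1, so [g 0] may be replaced there by the masked
     function [G]. *)
  have key : (Phi s - (X 0%N s)%:C%C) * (1 - (band delta A 0 s)%:C%C) = 0.
    have [s1|s1] := leP `|s| (2 * delta).
      rewrite Phi1; last by clear -s1 de1 d0; lra.
      rewrite /X expr0 !mul1r addr0 cutoff0_in ?subrr ?mul0r//.
      by rewrite normrM (ger0_norm (ler0n _ 2)); clear -s1 de2; lra.
    have [s2|s2] := leP A `|s|.
      rewrite HA1 ?(le_trans AA1)// /X expr0 !mul1r addr0 cutoff_out ?subrr ?mul0r//.
      by rewrite normrM (ger0_norm (ler0n _ 2)); clear -s2 A1'; lra.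
    by rewrite band0_one ?(ltW s1) ?(ltW s2)// subrr mulr0.
  have XE : (band r 2^-1 0 s)%:C%C = (X 0%N s)%:C%C - (cutoff 0 (r^-1 * s))%:C%C :> R[i].
    by rewrite bandE invrK /X !expr0 !mul1r addr0 rmorphB.
  rewrite /highpass XE /U /G; apply/eqP; rewrite -subr_eq0; apply/eqP.
  transitivity (cis (s * t) * g 0%N s * ((Phi s - (X 0%N s)%:C%C) * (1 - (band delta A 0 s)%:C%C))); first ring.
  by rewrite key mulr0.
rewrite addrK.
rewrite (le_trans (ler_wpM2l (ltW t0) (cnB _ _)))// mulrDr.
move: b2; rewrite gtr0_norm// => b2; rewrite b2.
rewrite (le_trans (lerD b1 b3))//.
have p1 : 0 <= H * M1 by rewrite mulr_ge0.
have p2 : 0 <= A * H * M0 by rewrite !mulr_ge0// ltW.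
have p3 : 0 <= A * B1 * M1 by rewrite !mulr_ge0// ltW.
have p4 : 0 <= A * M0 by rewrite mulr_ge0// ltW.
rewrite -/H -subr_ge0.
have -> : ((1 + 16 * A) * (2 * H) + 8 * A * (2 * B1 + 2)) * (M0 + M1) -
   ((M0 + 4 * (2 * A) * (M1 + M1)) * (2 * H) + 8 * A * (2 * B1 * M0 + (M1 + M1))) =
   2 * (H * M1) + 32 * (A * H * M0) + 16 * (A * B1 * M1) + 16 * (A * M0) by ring.
by rewrite !addr_ge0// mulr_ge0.
Qed.

End Masks.

(** * Differentiable vector-valued functions under functionals *)

Section VectorDerivatives.
Context {R : realType} {X : completeNormedModType R[i]}.
Local Notation TR := (measurableTypeR R).
Local Notation Re := complex.Re.
Local Notation Im := complex.Im.
Implicit Types (G : R -> X) (L : X -> R[i]) (s r t : R).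

Lemma cvg_cn_parts {T : Type} (Fl : set_system T) {FF : Filter Fl} (u : T -> R[i]) z :
  cn (u x - z) @[x --> Fl] --> (0 : R) ->
  Re (u x) @[x --> Fl] --> Re z /\ Im (u x) @[x --> Fl] --> Im z.
Proof.
move=> H.
have aux (p : R[i] -> R) : (forall w, `|p w - p z| <= cn (w - z)) -> p (u x) @[x --> Fl] --> p z.
  move=> pz; apply/cvgrPdist_le => e e0.
  move: (H) => /cvgr0Pnorm_le/(_ _ e0); apply: filterS => x.
  by rewrite ger0_norm ?cn_ge0//; apply: le_trans; rewrite distrC.
by split; apply: aux => w; rewrite -?cReB -?cImB ?Re_le_cn ?Im_le_cn.
Qed.

Lemma cont_at_functional G L s : functional L -> {for s, continuous G} ->
  cont_at (fun x => L (G x)) s.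
Proof. by move=> fL cG; apply: cvg_cn_parts; exact: cvg_functional. Qed.

Lemma cont_at_nrm G s : {for s, continuous G} -> cont_at (fun x => (nrm (G x))%:C%C) s.
Proof.
move=> /cvg_nrmP cG; split => /=; last exact: cvg_cst.
apply/cvgrPdist_le => e e0; move: (cG) => /cvgr0Pnorm_le/(_ _ e0); apply: filterS => x.
rewrite [X in X <= _]ger0_norm ?nrm_ge0//; apply: le_trans.
rewrite ler_norml; apply/andP; split.
  by rewrite lerBrDl lerBlDr (le_trans _ (nrmD _ _))// addrC subrK.
by rewrite lerBlDl nrm_distC addrC (le_trans _ (nrmD _ _))// subrK.
Qed.

Lemma has_deriv_cder G L s (d : X) : functional L -> has_deriv_at G s d ->
  cder s (fun x => L (G x)) (L d).
Proof.
move=> fL dG.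
have H := @cvg_functional R X _ _ (dnbhs_filter (0 : R)) _ _ _ fL dG.
have [h1 h2] := cvg_cn_parts H.
have aux (p : R -> R) (q : R) : (fun h : R => h^-1 * (p (s + h) - p s)) @ 0^' --> q ->
    is_derive s (1 : R) p q.
  move=> c.
  have c' : (fun h : R => h^-1 *: ((p \o shift s) (h *: 1) - p s)) @ 0^' --> q.
    rewrite (_ : (fun h => _) = (fun h : R => h^-1 * (p (s + h) - p s)))//.
    by apply/funext => h /=; rewrite /shift/= [h *: 1]mulr1 [h + s]addrC.
  by apply: DeriveDef; [exact: (cvgP _ c')|exact: cvg_lim].
split; apply: aux.
  rewrite (_ : (fun h => _) = (fun h : R => Re (L ((h^-1)%:C%C *: (G (s + h) - G s)))))//.
  by apply/funext => h; rewrite (funZ fL) (funB _ _ fL) cReZ cReB.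
rewrite (_ : (fun h => _) = (fun h : R => Im (L ((h^-1)%:C%C *: (G (s + h) - G s)))))//.
by apply/funext => h; rewrite (funZ fL) (funB _ _ fL) cImZ cImB.
Qed.

Lemma has_deriv_continuous G s (d : X) : has_deriv_at G s d -> {for s, continuous G}.
Proof.
move=> /cvg_nrmP/cvgr0Pnorm_le/(_ 1 ltr01) [e /= e0 He].
have D0 : 0 < nrm d + 1 by rewrite ltr_wpDl// nrm_ge0.
apply/cvg_nrmP/cvgr0Pnorm_le => e' e'0.
exists (Num.min e (e' / (nrm d + 1))); first by rewrite /= lt_min e0 divr_gt0.
move=> x /=; rewrite /ball_/= distrC lt_min => /andP[xe xe'].
rewrite ger0_norm ?nrm_ge0//.
have [->|xs] := eqVneq x s; first by rewrite subrr nrm0 ltW.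
have xs0 : x - s != 0 by rewrite subr_eq0.
have := He (x - s); rewrite /ball_/= sub0r normrN => /(_ xe xs0).
rewrite [s + _]addrC subrK ger0_norm ?nrm_ge0// => h.
have h2 : nrm (((x - s)^-1)%:C%C *: (G x - G s)) <= nrm d + 1.
  by rewrite -[_ *: _](subrK d) (le_trans (nrmD _ _))// addrC lerD2l.
move: h2; rewrite nrmZ cn_real normfV ler_pdivrMl ?normr_gt0// => /le_trans; apply.
by rewrite -ler_pdivlMr// ltW.
Qed.

(** Bounding the norm and not [L (G s)] gives a constant that serves every functional. *)
Lemma band_nrm_bounded G (a b : R) i : 0 < a -> a <= b ->
  (forall s, s != 0 -> {for s, continuous G}) ->
  exists2 M, 0 <= M & forall s, `|band a b i s| * nrm (G s) <= M.
Proof.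
move=> a0 ab cG.
have cV : ccontinuous (fun s => (band a b i s)%:C%C * (nrm (G s))%:C%C).
  apply: (ccontinuous_mask a0).
  - by apply: ccontinuous_real; exact: (@smooth_family_continuous _ _ (smooth_family_band a b) i).
  - by move=> s /ltW h; rewrite band_in.
  - by move=> s s0; apply: cont_at_nrm; exact: cG.
have [|M M0 HM] := ccontinuous_bounded (a := - (2 * b)) (b := 2 * b) cV.
  by move=> x; rewrite -ler_norml -ltNge => /ltW h; rewrite band_out// mul0r.
by exists M => // s; have := HM s; rewrite cnM !cn_real (ger0_norm (nrm_ge0 _)).
Qed.

(** [tauberian_estimate] followed by [highpass_decomposition]: the frequencies beyond 1/2 go into
    [t^-1], so either rate only requires [osc] to be [O(r + t^-1)] uniformly in [L]. *)
Lemma rate_reduction (f F : R -> X) (Fd : nat -> R -> X) :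
  {within `[0, +oo[%classic, continuous f} ->
  (exists B : R, forall t : R, 0 <= t -> nrm (f t) <= B) ->
  asymp_regular f ->
  (exists B : R, forall t : R, 0 <= t -> nrm (Bint `[0, t]%classic f) <= B) ->
  L1loc_punctured F -> boundary_function f F ->
  (forall s, s != 0 -> Fd 0%N s = F s) ->
  (forall s, s != 0 -> has_deriv_at (Fd 0%N) s (Fd 1%N s)) ->
  (forall s, s != 0 -> {for s, continuous (Fd 1%N)}) ->
  exists2 K, 0 <= K & forall r t, 0 < r -> r <= 2^-1 -> 0 < t ->
    exists2 L : X -> R[i], functional L &
      nrm (f t) <= K * (r + t^-1) + K * cn (osc (fun j s => L (Fd j s)) r 2^-1 t 0 0).
Proof.
move=> cf fB fR fP lF bF F0 F1 cF1.
have [Phi [K [[WPhi cPhi] kPhi PhiE K0 HK]]] := tauberian_estimate cf fB fR fP bF.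
have [delta [A [K' [de0 deA K'0 HK']]]] := highpass_decomposition WPhi cPhi kPhi PhiE.
have cF0 s : s != 0 -> {for s, continuous (Fd 0%N)} by move=> /F1; exact: has_deriv_continuous.
have [M0 M00 HM0] := band_nrm_bounded 0 de0 deA cF0.
have [M1 M10 HM1] := band_nrm_bounded 1 de0 deA cF0.
have [M2 M20 HM2] := band_nrm_bounded 0 de0 deA cF1.
pose E := K' * (2 * M0 + (2 * M1 + 2 * M2)).
have E0 : 0 <= E by rewrite /E mulr_ge0// !addr_ge0// mulr_ge0.
exists (K + K * E); first by rewrite addr_ge0// mulr_ge0.
move=> r t r0 r2 t0; have [L fL HL] := HK r t r0 t0; exists L => //.
have dg j : (j < 1)%N -> forall s, s != 0 -> cder s (fun s => L (Fd j s)) (L (Fd j.+1 s)).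
  by case: j => // _ s s0; apply: has_deriv_cder => //; exact: F1.
have cg j : (j <= 1)%N -> forall s, s != 0 -> cont_at (fun s => L (Fd j s)) s.
  by case: j => [|[|//]] _ s s0; apply: cont_at_functional => //; [exact: cF0|exact: cF1].
have bnd i j M : (forall s, `|band delta A i s| * nrm (Fd j s) <= M) ->
    forall s, cn ((band delta A i s)%:C%C * L (Fd j s)) <= 2 * M.
  move=> H s; rewrite cnM cn_real (le_trans _ (ler_wpM2l _ (H s)))//.
  by rewrite mulrCA ler_wpM2l// fun_bound.
have HM1' s : cn ((band delta A 1 s)%:C%C * L (Fd 0%N s)) <= 2 * M1 + 2 * M2.
  by rewrite (le_trans (bnd _ _ _ HM1 s))// lerDl mulr_ge0.
have HM2' s : cn ((band delta A 0 s)%:C%C * L (Fd 1%N s)) <= 2 * M1 + 2 * M2.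
  by rewrite (le_trans (bnd _ _ _ HM2 s))// lerDr mulr_ge0.
have key := HK' (fun j s => L (Fd j s)) 1%N _ _ r t (ltn0Sn 0) dg cg (bnd _ _ _ HM0) HM1' HM2' r0 r2 t0.
have cp := ccontinuous_highpass r t cPhi.
have kp : compact (csupport (highpass Phi r t)) by exact: compact_highpass.
have np : ~ csupport (highpass Phi r t) 0 by exact: highpass_avoid0.
have [rho rho0 Hrho] := highpass_near0 t PhiE r0.
(* [F] and [Fd 0] may differ at 0, where [highpass] vanishes. *)
have LE s : L (highpass Phi r t s *: F s) = highpass Phi r t s * L (Fd 0%N s).
  rewrite (funZ fL); have [->|s0] := eqVneq s 0; first by rewrite Hrho ?normr0// !mul0r.
  by rewrite F0.
have [|_ e] := Bint_functional_approx measurableT (approx_L1loc lF cp kp np) fL.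
  rewrite (_ : (fun x => _) = (fun s => highpass Phi r t s * L (Fd 0%N s))); last exact/funext.
  apply: ccontinuous_cmeas; apply: (ccontinuous_mask rho0) => // s s0.
  exact: (cg 0%N).
rewrite (@eq_cint _ _ _ (fun s => highpass Phi r t s * L (Fd 0%N s))) in e; last by move=> s _.
rewrite -e in HL; apply: (le_trans HL).
set z := cint _ _ in HL key *; set o := osc _ _ _ _ _ _ in key *.
have h1 : cn z <= cn (z - o) + cn o by rewrite -{1}[z](subrK o) cnD.
have h2 : cn (z - o) <= E * t^-1 by rewrite ler_pdivlMr// mulrC.
have ti : 0 <= t^-1 by rewrite invr_ge0 ltW.
have h3 : K * cn z <= K * (E * t^-1 + cn o) by rewrite ler_wpM2l// (le_trans h1)// lerD2r.
apply: (le_trans (lerD (lexx _) h3)).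
have q1 : 0 <= K * E * r by rewrite mulr_ge0 ?(ltW r0)// mulr_ge0.
have q2 : 0 <= K * E * cn o by rewrite mulr_ge0 ?cn_ge0// mulr_ge0.
rewrite -subr_ge0.
have -> : (K + K * E) * (r + t^-1) + (K + K * E) * cn o - (K * (r + t^-1) + K * (E * t^-1 + cn o)) =
  K * E * r + K * E * cn o by ring.
exact: addr_ge0.
Qed.

End VectorDerivatives.

(** * Rates *)

Section Stirling.
Context {R : realType}.
Implicit Types (x y t : R) (n N : nat).

(** The inequality [1 - 1 / (N + 1) <= exp (- 1 / (N + 1))] raised to the power [N + 1]; it is the
    induction step of [fact_expR_le]. *)
Lemma expR1_pow_le N : expR 1 * N%:R ^+ N.+1 <= N.+1%:R ^+ N.+1 :> R.
Proof.
have N0 : (0 : R) < N.+1%:R by [].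
have h1 : 1 - N.+1%:R^-1 <= expR (- N.+1%:R^-1) :> R by exact: expR_ge1Dx.
have e : N%:R = N.+1%:R * (1 - N.+1%:R^-1) :> R.
  by rewrite mulrBr mulr1 divff// -natr1 addrK.
have h0 : 0 <= 1 - N.+1%:R^-1 :> R by rewrite subr_ge0 invf_le1// ler1n.
rewrite e exprMn mulrCA ler_piMr ?exprn_ge0//.
have h2 : (1 - N.+1%:R^-1) ^+ N.+1 <= expR (- N.+1%:R^-1) ^+ N.+1 :> R by rewrite lerXn2r ?nnegrE ?expR_ge0.
rewrite (le_trans (ler_wpM2l (expR_ge0 _) h2))// -expRM_natl mulrN divff// -expRD subrr expR0//.
Qed.

(** A crude Stirling bound, with N in place of the square root of N; polynomial losses are absorbed
    later by an exponential. *)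
Lemma fact_expR_le N : (0 < N)%N -> N`!%:R * expR N%:R <= expR 1 * N%:R ^+ N.+1 :> R.
Proof.
case: N => // N _; elim: N => [|N ih]; first by rewrite factS fact0 muln1 mul1r expr1n mulr1.
rewrite factS natrM -[X in expR X]natr1 expRD.
have h := expR1_pow_le N.+1.
have -> : N.+2%:R * N.+1`!%:R * (expR N.+1%:R * expR 1) =
  N.+2%:R * expR 1 * (N.+1`!%:R * expR N.+1%:R) :> R by ring.
have c0 : 0 <= N.+2%:R * expR 1 :> R by rewrite mulr_ge0// expR_ge0.
apply: (le_trans (ler_wpM2l c0 ih)).
rewrite [leRHS](_ : _ = N.+2%:R * expR 1 * N.+2%:R ^+ N.+2); last by rewrite exprS; ring.
by rewrite ler_wpM2l.
Qed.

(** [n! / x ^ n] decreases until n reaches x, so the integer part of [x] is the optimal order. One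
    factor e comes from [fact_expR_le], the other from replacing [exp (- N)] by [exp (- x)]. *)
Lemma fact_pow_le x N : N%:R <= x -> x < N.+1%:R -> 0 < x ->
  N`!%:R * x^-1 ^+ N <= expR 2 * (x + 1) * expR (- x).
Proof.
move=> Nx xN x0.
have e1 : 1 <= expR 1 :> R by rewrite -expR0 ler_expR.
have e2 : expR 2 = expR 1 * expR 1 :> R by rewrite -expRD; congr expR; ring.
have eN : expR (- N%:R) <= expR 1 * expR (- x).
  by rewrite -expRD ler_expR; move: xN; rewrite -natr1; lra.
case: N Nx xN eN => [|N] Nx xN eN.
  rewrite fact0 expr0 mulr1; move: eN; rewrite oppr0 expR0 => h.
  rewrite (le_trans h)// ler_wpM2r ?expR_ge0// e2 -mulrA ler_peMr ?expR_ge0//.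
  by rewrite -[leLHS]mul1r ler_pM//; lra.
have N0 : (0 : R) < N.+1%:R by [].
have h := @fact_expR_le N.+1 (ltn0Sn N).
have h1 : N.+1`!%:R <= expR 1 * N.+1%:R ^+ N.+2 * expR (- N.+1%:R) :> R.
  by rewrite expRN ler_pdivlMr ?expR_gt0.
have h2 : x^-1 ^+ N.+1 <= (N.+1%:R ^+ N.+1)^-1.
  by rewrite -exprVn lerXn2r ?nnegrE ?invr_ge0 ?(ltW x0)// lef_pV2.
have h3 : N.+1`!%:R * x^-1 ^+ N.+1 <= expR 1 * N.+1%:R ^+ N.+2 * expR (- N.+1%:R) * (N.+1%:R ^+ N.+1)^-1.
  by apply: ler_pM => //; rewrite exprn_ge0// invr_ge0 ltW.
apply: (le_trans h3).
have -> : expR 1 * N.+1%:R ^+ N.+2 * expR (- N.+1%:R) * (N.+1%:R ^+ N.+1)^-1 = expR 1 * N.+1%:R * expR (- N.+1%:R) :> R.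
  by rewrite exprS; field; rewrite expf_neq0.
rewrite e2 -!mulrA ler_wpM2l ?expR_ge0// [leRHS]mulrCA.
apply: ler_pM; rewrite ?expR_ge0//.
by rewrite (le_trans Nx)// lerDl.
Qed.

(** Since [n! <= N ^ (n - 1)] for [1 <= n <= N], each term after the first is at most [y], and there
    are fewer than [N] of them. *)
Lemma fact_sum_le y N : 0 <= y -> y * N%:R <= 1 -> \sum_(n < N) n`!%:R * y ^+ n <= 2.
Proof.
move=> y0; case: N => [|N] yN; first by rewrite big_ord0.
have fle n : (n < N.+1)%N -> (n.+1`! <= N.+1 ^ n)%N.
  elim: n => // n ih nN; rewrite factS expnS leq_mul//; exact: ih (ltnW nN).
rewrite big_ord_recl fact0 expr0 mulr1 -[2]/(1 + 1) lerD2l.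
apply: (@le_trans _ _ (\sum_(i < N) y)).
  apply: ler_sum => i _; rewrite lift0 exprS mulrCA ler_piMr//.
  rewrite (le_trans (y := N.+1%:R ^+ i * y ^+ i))//.
    by rewrite ler_wpM2r ?exprn_ge0// -natrX ler_nat fle// ltnS ltnW.
  by rewrite -exprMn exprn_ile1// ?mulr_ge0// mulrC.
by rewrite sumr_const card_ord -mulr_natr (le_trans _ yN)// ler_wpM2l// ler_nat.
Qed.

End Stirling.

(** * Decay of the oscillatory integrals *)

Section ScalarRates.
Context {R : realType}.
Local Notation mu := (@lebesgue_measure R).
Local Notation TR := (measurableTypeR R).
Implicit Types (g : nat -> R -> R[i]) (m : R -> R) (r s t : R).

(** Scale invariance: [|s| ^ i] compensates the i-th derivative of a dilated cutoff, whatever the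
    dilation. *)
Lemma band_pow_bounded : exists2 E : nat -> R, (forall i, 0 <= E i) &
  forall a b i s, 0 < a -> a <= b -> `|s| ^+ i * `|band a b i s| <= 2 * E i.
Proof.
have [E HE] := choice (fun i => (let: ex_intro2 C p q := @cutoff_bounded R i in
  ex_intro (fun C => 0 <= C /\ forall x, `|cutoff i x| <= C) C (conj p q))).
have E0 i : 0 <= E i by have [] := HE i.
have HEc i y : `|y| ^+ i * `|cutoff i y| <= 2 ^+ i * E i.
  have [y2|y2] := leP 2 `|y|.
    by rewrite cutoff_out// normr0 mulr0 mulr_ge0// exprn_ge0.
  apply: ler_pM; rewrite ?exprn_ge0//; last by have [_] := HE i.
  by rewrite lerXn2r ?nnegrE// ltW.
exists (fun i => 2 ^+ i * E i); first by move=> i; rewrite mulr_ge0// exprn_ge0.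
move=> a b i s a0 ab; have b0 : 0 < b by exact: lt_le_trans ab.
have aux c : 0 < c -> `|s| ^+ i * `|c^-1 ^+ i * cutoff i (c^-1 * s)| <= 2 ^+ i * E i.
  move=> c0; apply: le_trans (HEc i (c^-1 * s)).
  rewrite norm_dilate// normrM normrX (ger0_norm (x := c^-1)) ?invr_ge0 ?(ltW c0)//.
  by rewrite exprMn mulrA [_ * c^-1 ^+ i]mulrC.
rewrite bandE (le_trans (ler_wpM2l _ (ler_normB _ _)))// ?exprn_ge0//.
by rewrite mulrDr mulr2n mulrDl mul1r lerD// aux.
Qed.

Section Monotone.
Context (m : R -> R).
Context (m1 : forall r, 0 < r <= 1 -> 1 <= m r)
  (mD : forall r1 r2 : R, 0 < r1 -> r1 <= r2 -> r2 <= 1 -> m r2 <= m r1).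

(** After [k] integrations by parts every term has [i + j = k]. The weight [|s| ^ (k - j)] of the
    hypothesis is then exactly what [band_pow_bounded] requires, and [m |s| <= m r] because the band
    vanishes for [|s| <= r]. *)
Lemma osc_poly_rate k (C : R) : 0 <= C -> exists2 D, 0 <= D &
  forall g r t, (forall j, (j < k)%N -> forall s, s != 0 -> cder s (g j) (g j.+1 s)) ->
    (forall j, (j <= k)%N -> forall s, s != 0 -> cont_at (g j) s) ->
    (forall j, (j <= k)%N -> forall s, 0 < `|s| <= 1 ->
      cn (g j s) <= C * `|s| ^+ (k - j) * m `|s| ^+ k.+1) ->
    0 < r -> r <= 2^-1 -> 0 < t ->
    t ^+ k * cn (osc g r 2^-1 t 0 0) <= D * m r ^+ k.+1.
Proof.
move=> C0; have [E E0 HE] := band_pow_bounded.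
pose S := \sum_(i < k.+1) E i.
have ES i : (i <= k)%N -> E i <= S.
  move=> ik; rewrite /S (bigD1 (Ordinal (ik : (i < k.+1)%N)))//= lerDl.
  exact: sumr_ge0.
have S0 : 0 <= S by exact: sumr_ge0.
exists (2 ^+ k * (8 * S * C)).
  by rewrite mulr_ge0 ?exprn_ge0// mulr_ge0// mulr_ge0.
move=> g r t dg cg gB r0 r2 t0.
have r1 : r <= 1 by lra.
have mr : 0 <= m r by rewrite (le_trans ler01)// m1// r0.
pose Bd := 2 * S * C * m r ^+ k.+1.
have Bd0 : 0 <= Bd by rewrite !mulr_ge0// exprn_ge0.
have H j i : (j + i = k)%N -> cn (osc g r 2^-1 t j i) <= 8 * 2^-1 * Bd.
  move=> e; have jk : (j <= k)%N by rewrite -e leq_addr.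
  have ik : (i <= k)%N by rewrite -e leq_addl.
  apply: (osc_box cg t r0 r2) => // s.
  have [sr|sr] := leP `|s| r; first by rewrite band_in// mul0r cn0.
  have [s1|s1] := leP 1 `|s|; first by rewrite band_out ?mul0r ?cn0// divff.
  have s0 : 0 < `|s| by exact: lt_trans sr.
  rewrite cnM cn_real.
  have := gB j jk s; rewrite s0 (ltW s1) => /(_ isT) gs.
  rewrite (le_trans (ler_wpM2l (normr_ge0 _) gs))//.
  have -> : (k - j = i)%N by rewrite -e addKn.
  have -> : `|band r 2^-1 i s| * (C * `|s| ^+ i * m `|s| ^+ k.+1) =
     (`|s| ^+ i * `|band r 2^-1 i s|) * C * m `|s| ^+ k.+1 by ring.
  have ms0 : 0 <= m `|s| by rewrite (le_trans ler01)// m1// s0 ltW.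
  rewrite /Bd; apply: ler_pM.
  - by rewrite mulr_ge0// mulr_ge0// exprn_ge0.
  - exact: exprn_ge0.
  - rewrite ler_wpM2r// (le_trans (HE _ _ _ _ r0 r2))// ler_wpM2l//; exact: ES.
  - by rewrite lerXn2r ?nnegrE// mD ?ltW.
have e0 : (0 + 0 + k)%N = k by [].
have := osc_iter dg cg r0 r2 t0 H e0.
move=> /le_trans; apply.
by rewrite /Bd le_eqVlt; apply/orP; left; apply/eqP; field.
Qed.

(* With [x = t / m r] and [N] the integer part of [x], [N] integrations by parts
   leave a remainder [m r * N! / x ^ N], of order [m r * x * exp (- x)], while
   [exp (- c x) = (1 + m r / r)^-1]. The boundary terms carry the derivative of
   [band], which lives on [|s| >= 1/2], where [m <= m (1/2)] does not depend
   on [r], and on [|s| <= 2 r]. *)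
Lemma osc_log_rate (C c : R) : 0 <= C -> 0 < c -> c < 1 -> exists2 D, 0 <= D &
  forall g r t, (forall j s, s != 0 -> cder s (g j) (g j.+1 s)) ->
    (forall j s, s != 0 -> cont_at (g j) s) ->
    (forall j s, 0 < `|s| <= 1 -> cn (g j s) <= C * j`!%:R * `|s| * m `|s| ^+ j.+1) ->
    0 < r -> r <= 2^-1 -> 0 < t -> m_log m r = c * t ->
    cn (osc g r 2^-1 t 0 0) <= D * (r + t^-1).
Proof.
move=> C0 c0 c1; have [B B0 HB] := @cutoff_bounded R 1.
pose nu := m 2^-1.
have hh0 : (0 : R) < 2^-1 by lra.
have hh1 : (2^-1 : R) <= 1 by lra.
have nu0 : 0 <= nu by rewrite (le_trans ler01)// m1// hh0 hh1.
pose e2 : R := expR 2.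
have c10 : 0 < 1 - c by rewrite subr_gt0.
pose D1 := 16 * B * C * (2 * nu) + 16 * B * C * 2.
pose D2 := 8 * C * e2 * (1 + (1 - c)^-1).
have D10 : 0 <= D1 by rewrite addr_ge0// !mulr_ge0.
have D20 : 0 <= D2 by rewrite !mulr_ge0// ?expR_ge0// addr_ge0// invr_ge0 ltW.
exists (D1 + D2); first exact: addr_ge0.
move=> g r t dg cg gB r0 r2 t0 mlog.
have r1 : r <= 1 by lra.
have mr1 : 1 <= m r by rewrite m1// r0.
have mr : 0 < m r by exact: lt_le_trans mr1.
have numr : nu <= m r by exact: mD.
pose x := t / m r; have x0 : 0 < x by rewrite divr_gt0.
pose N := Num.trunc x.
have /andP[Nx xN] : N%:R <= x < N.+1%:R by apply: truncn_itv; exact: ltW.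
have dgN j : (j < N)%N -> forall s, s != 0 -> cder s (g j) (g j.+1 s) by move=> _; exact: dg.
have cgN j : (j <= N)%N -> forall s, s != 0 -> cont_at (g j) s by move=> _; exact: cg.
pose y := x^-1; have y0 : 0 < y by rewrite invr_gt0.
have yE : y = m r / t by rewrite /y /x invf_div.
have yN : y * N%:R <= 1 by rewrite mulrC ler_pdivrMr// mul1r.
have ti0 : 0 < t^-1 by rewrite invr_gt0.
have K n : (n < N)%N -> cn (osc g r 2^-1 t n 1) <= 16 * B * C * n`!%:R * (nu ^+ n.+1 + r * m r ^+ n.+1).
  move=> nN.
  (* [d1] bounds the integrand on the outer edge of the band. On the inner edge the derivative costs
     [r^-1] and the factor [|s| <= 2 r] of the hypothesis cancels it, giving [d2]; the length [4 r]
     of that window is the gain. *)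
  pose d1 := 2 * B * (C * n`!%:R * nu ^+ n.+1); pose d2 := 2 * B * (C * n`!%:R * m r ^+ n.+1).
  have d10 : 0 <= d1 by rewrite !mulr_ge0// exprn_ge0.
  have d20 : 0 <= d2 by rewrite !mulr_ge0// exprn_ge0// ltW.
  have m11 : (-1 : R) <= 1 by lra.
  have mrr : - (2 * r) <= 2 * r by lra.
  have [i1 e1] := integral_itv_indic m11; have [i2 e2'] := integral_itv_indic mrr.
  have i1' := RintegralZl_le d1 measurableT i1.
  have i2' := RintegralZl_le d2 measurableT i2.
  have iu : mu.-integrable setT (EFin \o (fun s : TR =>
      d1 * \1_(`[-1, 1]%classic : set R) s + d2 * \1_(`[- (2 * r), 2 * r]%classic : set R) s)).
    have := integrableD measurableT i1' i2'; apply: eq_integrable => // s _.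
  apply: (le_trans (cn_cint_le measurableT _ iu _)).
  - apply: cmeasM; first by apply: cmeas_cis; exact: measurable_mulr.
    by apply: ccontinuous_cmeas; exact: (ccontinuous_band_mul cgN r0 r2 1 (ltnW nN)).
  - move=> s _; rewrite cnM cn_cis mul1r.
    have u0 : 0 <= d1 * \1_(`[-1, 1]%classic : set R) s + d2 * \1_(`[- (2 * r), 2 * r]%classic : set R) s.
      by rewrite addr_ge0// mulr_ge0.
    have [sr|sr] := leP `|s| r; first by rewrite band_in// mul0r cn0.
    have [s1|s1] := leP 1 `|s|; first by rewrite band_out ?mul0r ?cn0// divff.
    have s0 : 0 < `|s| by exact: lt_trans sr.
    have gs : cn (g n s) <= C * n`!%:R * `|s| * m `|s| ^+ n.+1 by apply: gB; rewrite s0 ltW.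
    have ms0 : 0 <= m `|s| by rewrite (le_trans ler01)// m1// s0 ltW.
    have Cn : 0 <= C * n`!%:R by rewrite mulr_ge0.
    rewrite bandE invrK !expr1 cnM cn_real (le_trans (ler_wpM2r (cn_ge0 _) (ler_normB _ _)))//.
    rewrite mulrDl lerD//.
      rewrite indicE mem_set ?mulr1; last by rewrite /= in_itv/= -ler_norml ltW.
      have [s2|s2] := leP `|s| 2^-1.
        by rewrite cutoffS_in ?mulr0 ?normr0 ?mul0r// normrM ger0_norm// -ler_pdivlMl// mulr1.
      apply: ler_pM => //; first exact: cn_ge0.
        by rewrite normrM ger0_norm// ler_wpM2l// HB.
      rewrite (le_trans gs)//; apply: ler_pM.
      - by rewrite mulr_ge0.
      - exact: exprn_ge0.
      - by rewrite ler_piMr// ltW.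
      - by rewrite lerXn2r ?nnegrE// mD ?ltW// invr_gt0.
    have [s2|s2] := leP (2 * r) `|s|.
      have hs : 2 <= `|r^-1 * s| by rewrite norm_dilate// ler_pdivlMl// mulrC.
      by rewrite (cutoff_out _ hs) mulr0 normr0 mul0r mulr_ge0.
    rewrite indicE mem_set ?mulr1; last by rewrite /= in_itv/= -ler_norml ltW.
    have -> : d2 = (r^-1 * B) * (C * n`!%:R * (2 * r) * m r ^+ n.+1).
      by rewrite /d2; field; rewrite gt_eqF.
    apply: ler_pM => //; first exact: cn_ge0.
      by rewrite norm_dilate// ler_wpM2l ?invr_ge0 ?(ltW r0)// HB.
    rewrite (le_trans gs)//; apply: ler_pM.
    - by rewrite mulr_ge0.
    - exact: exprn_ge0.
    - by rewrite ler_wpM2l// ltW.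
    - by rewrite lerXn2r ?nnegrE ?(ltW mr)// mD ?ltW.
  rewrite RintegralD// !RintegralZl// e1 e2'.
  rewrite -subr_ge0 /d1 /d2 opprK.
  have p : 0 <= B * C * n`!%:R * nu ^+ n.+1 by rewrite !mulr_ge0// exprn_ge0.
  have -> : 16 * B * C * n`!%:R * (nu ^+ n.+1 + r * m r ^+ n.+1) -
    2 * (2 * B * (C * n`!%:R * nu ^+ n.+1) * (1 + 1) + 2 * B * (C * n`!%:R * m r ^+ n.+1) * (2 * r - - (2 * r))) =
    8 * (B * C * n`!%:R * nu ^+ n.+1) by ring.
  by rewrite mulr_ge0.
have T : cn (osc g r 2^-1 t N 0) <= 8 * C * N`!%:R * m r ^+ N.+1.
  have -> : 8 * C * N`!%:R * m r ^+ N.+1 = 8 * 2^-1 * (2 * (C * N`!%:R * m r ^+ N.+1)) by field.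
  apply: (osc_box cgN t r0 r2) => // s.
  have [sr|sr] := leP `|s| r.
    by rewrite band_in// mul0r cn0 !mulr_ge0// exprn_ge0// ltW.
  have [s1|s1] := leP 1 `|s|.
    by rewrite band_out ?mul0r ?cn0 ?divff// !mulr_ge0// exprn_ge0// ltW.
  have s0 : 0 < `|s| by exact: lt_trans sr.
  have gs : cn (g N s) <= C * N`!%:R * `|s| * m `|s| ^+ N.+1 by apply: gB; rewrite s0 ltW.
  have ms0 : 0 <= m `|s| by rewrite (le_trans ler01)// m1// s0 ltW.
  rewrite cnM cn_real; apply: ler_pM => //; first exact: cn_ge0.
    rewrite bandE !expr0 !mul1r (le_trans (ler_normB _ _))//.
    by rewrite -[2]/(1 + 1) lerD// cutoff0_le1.
  rewrite (le_trans gs)//; apply: ler_pM.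
  - by rewrite !mulr_ge0.
  - exact: exprn_ge0.
  - by rewrite ler_piMr ?mulr_ge0// ltW.
  - by rewrite lerXn2r ?nnegrE ?(ltW mr)// mD ?ltW.
have S := osc_sum dgN cgN r0 r2 t0 (leqnn N).
apply: (le_trans S).
have D1P : \sum_(n < N) cn (osc g r 2^-1 t n 1) * t^-1 ^+ n.+1 <= D1 * (r + t^-1).
  apply: (@le_trans _ _ (\sum_(n < N) (16 * B * C * (nu * t^-1) * (n`!%:R * y ^+ n) +
     16 * B * C * r * y * (n`!%:R * y ^+ n)))).
    apply: ler_sum => n _.
    rewrite (le_trans (ler_wpM2r _ (K n (ltn_ord n))))//; first by rewrite exprn_ge0// ltW.
    have -> : 16 * B * C * n`!%:R * (nu ^+ n.+1 + r * m r ^+ n.+1) * t^-1 ^+ n.+1 =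
       16 * B * C * (nu * t^-1) * (n`!%:R * (nu * t^-1) ^+ n) +
       16 * B * C * r * (m r * t^-1) * (n`!%:R * (m r * t^-1) ^+ n).
      by rewrite !exprMn !exprS; ring.
    rewrite -yE lerD2r ler_wpM2l//; first by rewrite !mulr_ge0// ltW.
    rewrite ler_wpM2l// lerXn2r ?nnegrE ?(ltW y0) ?mulr_ge0 ?(ltW ti0)//.
    by rewrite yE ler_wpM2r ?(ltW ti0).
  rewrite big_split/= -!mulr_sumr.
  have s2 := fact_sum_le (ltW y0) yN.
  have s0 : 0 <= \sum_(n < N) n`!%:R * y ^+ n.
    by apply: sumr_ge0 => n _; rewrite mulr_ge0// exprn_ge0// ltW.
  (* If [N = 0] then [y] may exceed 1 but the sum is empty; otherwise [y <= y * N <= 1]. *)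
  have ys : y * (\sum_(n < N) n`!%:R * y ^+ n) <= 2.
    move: s2 s0 yN; case: N {Nx xN dgN cgN K T S} => [|N'] s2 s0 yN; first by rewrite big_ord0 mulr0.
    rewrite (le_trans _ s2)// ler_piMl//.
    by rewrite (le_trans _ yN)// ler_peMr ?(ltW y0)// ler1n.
  have p0 : 0 <= 16 * B * C by rewrite !mulr_ge0.
  have b1 : 16 * B * C * (nu / t) * (\sum_(n < N) n`!%:R * y ^+ n) <= 16 * B * C * (nu / t) * 2.
    by rewrite ler_wpM2l// mulr_ge0// mulr_ge0// ltW.
  have b2 : 16 * B * C * r * y * (\sum_(n < N) n`!%:R * y ^+ n) <= 16 * B * C * r * 2.
    by rewrite -mulrA ler_wpM2l// mulr_ge0// ltW.
  rewrite (le_trans (lerD b1 b2))// -subr_ge0.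
  have -> : D1 * (r + t^-1) - (16 * B * C * (nu / t) * 2 + 16 * B * C * r * 2) =
    16 * B * C * (2 * nu) * r + 16 * B * C * 2 * t^-1 by rewrite /D1; ring.
  by rewrite addr_ge0// mulr_ge0 ?(ltW r0) ?(ltW ti0)// mulr_ge0// mulr_ge0.
have D2P : cn (osc g r 2^-1 t N 0) * t^-1 ^+ N <= D2 * r.
  rewrite (le_trans (ler_wpM2r _ T))//; first by rewrite exprn_ge0// ltW.
  have -> : 8 * C * N`!%:R * m r ^+ N.+1 * t^-1 ^+ N = 8 * C * (m r * (N`!%:R * x^-1 ^+ N)).
    by rewrite -/y yE exprMn exprS; ring.
  have h := fact_pow_le Nx xN x0.
  have cx : c * x = ln (1 + m r / r).
    by rewrite /x mulrA -mlog /m_log; field; rewrite gt_eqF.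
  have q0 : 0 < 1 + m r / r by rewrite ltr_wpDr// divr_ge0// ltW.
  (* The equation [m_log m r = c * t] is [c * x = ln (1 + m r / r)]. *)
  have ecx : expR (- (c * x)) <= r / m r.
    rewrite cx expRN lnK ?posrE// -[r / m r]invf_div lef_pV2 ?posrE ?divr_gt0//.
    by rewrite lerDr.
  have ex : expR (- x) = expR (- (c * x)) * expR (- ((1 - c) * x)) by rewrite -expRD; congr expR; ring.
  (* What [exp (- c x)] leaves of [exp (- x)] absorbs the polynomial factor of [fact_pow_le]; the
     constant blows up as [c] tends to 1. *)
  have xe : (x + 1) * expR (- ((1 - c) * x)) <= 1 + (1 - c)^-1.
    have a1 : expR (- ((1 - c) * x)) <= 1.
      by rewrite -[leRHS]expR0 ler_expR oppr_le0; apply: mulr_ge0; exact: ltW.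
    have a2 : (1 - c) * x * expR (- ((1 - c) * x)) <= 1.
      rewrite expRN ler_pdivrMr ?expR_gt0// mul1r.
      by rewrite (le_trans _ (expR_ge1Dx _))// lerDr.
    have a3 : x * expR (- ((1 - c) * x)) <= (1 - c)^-1.
      by rewrite -[(1 - c)^-1]mulr1 ler_pdivlMl// mulrA.
    by rewrite mulrDl mul1r addrC lerD.
  have mm : m r * (N`!%:R * x^-1 ^+ N) <= e2 * (1 + (1 - c)^-1) * r.
    rewrite (le_trans (ler_wpM2l (ltW mr) h))// ex.
    have -> : m r * (expR 2 * (x + 1) * (expR (- (c * x)) * expR (- ((1 - c) * x)))) =
      e2 * ((m r * expR (- (c * x))) * ((x + 1) * expR (- ((1 - c) * x)))) by rewrite /e2; ring.
    rewrite -[leRHS]mulrA ler_wpM2l ?expR_ge0// [leRHS]mulrC.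
    apply: ler_pM => //.
    - by rewrite mulr_ge0 ?expR_ge0// ltW.
    - by rewrite mulr_ge0 ?expR_ge0// addr_ge0// ltW.
    - by rewrite mulrC -ler_pdivlMr.
  have -> : D2 * r = 8 * C * (e2 * (1 + (1 - c)^-1) * r) by rewrite /D2; ring.
  by rewrite ler_wpM2l// mulr_ge0.
rewrite (le_trans (lerD D1P D2P))// [leRHS]mulrDl lerD2l ler_wpM2l// lerDl ltW//.
Qed.

End Monotone.
End ScalarRates.

(** The k-th power of the defining equation of [r]. It turns the bound [m r ^ (k + 1) / t ^ k] of
    [osc_poly_rate] into a multiple of [r]. *)
Lemma m_k_pow {R : realType} (m : R -> R) k (r c t : R) : (0 < k)%N -> 0 < r -> 0 < m r ->
  m_k m k r = c * t -> m r ^+ k.+1 = c ^+ k * r * t ^+ k.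
Proof.
move=> k0 r0 mr /(congr1 (fun x => x ^+ k)); rewrite /m_k !exprMn.
rewrite -(powR_mulrn _ (powR_ge0 _ _)) -powRrM mulVf ?pnatr_eq0 -?lt0n// powRr1; last by rewrite divr_ge0// ltW.
by move=> e; rewrite mulrAC -e exprSr; field; rewrite gt_eqF.
Qed.

(** The value of the inverse function at [c t] is represented by any [r] in []0, 1]] solving the
    equation. The constant [M] and the threshold for [t] are chosen before [r]. *)
Theorem theorem2p9 (R : realType) (X : completeNormedModType R[i])
    (f F : R -> X) :
  {within `[0, +oo[%classic, continuous f} ->
  (exists B : R, forall t : R, 0 <= t -> nrm (f t) <= B) ->
  asymp_regular f ->
  (exists B : R, forall t : R, 0 <= t -> nrm (Bint `[0, t]%classic f) <= B) ->
  L1loc_punctured F ->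
  boundary_function f F ->
  (f x @[x --> +oo] --> 0) /\
  (forall m : R -> R,
     {within `]0, 1]%classic, continuous m} ->
     (forall r : R, 0 < r <= 1 -> 1 <= m r) ->
     (forall r1 r2 : R, 0 < r1 -> r1 <= r2 -> r2 <= 1 -> m r2 <= m r1) ->
     (* (a) *)
     (forall k : nat, (1 <= k)%N ->
        (exists (Fd : nat -> R -> X) (C : R), Ck_punctured k F Fd /\ 0 < C /\
           forall j : nat, (j <= k)%N -> forall s : R, 0 < `|s| <= 1 ->
             nrm (Fd j s) <= C * `|s| ^+ (k - j) * m `|s| ^+ k.+1) ->
        forall c : R, 0 < c ->
          exists M : R, \forall t \near +oo, forall r : R, 0 < r <= 1 ->
            m_k m k r = c * t -> nrm (f t) <= M * (r + t^-1)) /\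
     (* (b) *)
     ((exists (Fd : nat -> R -> X) (C : R), Cinf_punctured F Fd /\ 0 < C /\
         forall j : nat, forall s : R, 0 < `|s| <= 1 ->
           nrm (Fd j s) <= C * (j`!)%:R * `|s| * m `|s| ^+ j.+1) ->
      forall c : R, 0 < c < 1 ->
        exists M : R, \forall t \near +oo, forall r : R, 0 < r <= 1 ->
          m_log m r = c * t -> nrm (f t) <= M * (r + t^-1))).
Proof.
move=> cf fB fR fP lF bF.
have [B HB] := fB.
have B0 : 0 <= B by apply: le_trans (HB 0 (lexx 0)); exact: nrm_ge0.
(* The bands need [r <= 1/2]; for larger [r] the bound [B] of [f] is at most [2 B r]. *)
have rate_of (K E : R) (r t : R) : 0 <= K -> 0 <= E -> 0 < r -> 0 < t ->
    (r <= 2^-1 -> nrm (f t) <= K * (r + t^-1) + K * (E * (r + t^-1))) ->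
    nrm (f t) <= (K + K * E + 2 * B) * (r + t^-1).
  move=> K0 E0 r0 t0 H; have ti : 0 < t^-1 by rewrite invr_gt0.
  have rt : 0 <= r + t^-1 by rewrite addr_ge0 ?(ltW r0) ?(ltW ti).
  rewrite mulrDl; have [r2|r2] := leP r 2^-1.
    rewrite (le_trans (H r2))// mulrDl mulrA lerDl mulr_ge0// mulr_ge0//.
  rewrite (le_trans (HB t (ltW t0)))// (le_trans (y := 2 * B * (r + t^-1)))//.
    rewrite mulrAC ler_peMl//; lra.
  by rewrite lerDr mulr_ge0// addr_ge0// mulr_ge0.
split.
  have [Phi [K [[WPhi cPhi] kPhi PhiE K0 HK]]] := tauberian_estimate cf fB fR fP bF.
  apply/cvg_nrmP/cvgr0Pnorm_le => e e0.
  have K1 : 0 < K + 1 by rewrite ltr_wpDl.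
  (* The terms [r], [t^-1 <= r] and [2 r], the last with the factor 2 of the functional, sum to
     [4 r], and [K * (4 r) <= (K + 1) * (6 r) = e]. *)
  pose r := e / (6 * (K + 1)).
  have r0 : 0 < r by rewrite divr_gt0// mulr_gt0.
  have r0' : 0 < r^-1 by rewrite invr_gt0.
  have := highpass_vanish lF cPhi kPhi PhiE r0 r0.
  move=> hv; near=> t.
  have t0 : 0 < t by near: t; apply: nbhs_pinfty_gt; exact: num_real.
  have tr : r^-1 < t by near: t; apply: nbhs_pinfty_gt; exact: num_real.
  have hb : nrm (Bint setT (fun s => highpass Phi r t s *: F s)) <= r by near: t.
  have [L fL HL] := HK r t r0 t0.
  rewrite subr0 ger0_norm ?nrm_ge0// (le_trans HL)//.
  have ti : t^-1 <= r by rewrite -[r]invrK lef_pV2 ?posrE// ltW.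
  have h1 : cn (L (Bint setT (fun s => highpass Phi r t s *: F s))) <= 2 * r.
    by rewrite (le_trans (fun_bound fL _))// ler_wpM2l.
  rewrite -mulrDr (le_trans (ler_wpM2l K0 (_ : _ <= 4 * r)))//; first lra.
  have -> : e = (K + 1) * (6 * r) by rewrite /r; field; rewrite gt_eqF.
  apply: ler_pM => //; lra.
move=> m _ m1 mD; split.
- move=> k k0 [Fd [C [[F0 Fd1 Fk] [C0 HC]]]] c c0.
  have cF j : (j <= k)%N -> forall s, s != 0 -> {for s, continuous (Fd j)}.
    rewrite leq_eqVlt => /predU1P[->//|jk] s s0.
    by apply: has_deriv_continuous; exact: Fd1.
  have [K K0 HK] := rate_reduction cf fB fR fP lF bF F0 (Fd1 0%N k0) (cF 1%N k0).
  have C20 : 0 <= 2 * C by rewrite mulr_ge0// ltW.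
  have [D D0 HD] := osc_poly_rate m1 mD k C20.
  have E0 : 0 <= D * c ^+ k by rewrite mulr_ge0// exprn_ge0// ltW.
  exists (K + K * (D * c ^+ k) + 2 * B); near=> t => r /andP[r0 r1] mk.
  have t0 : 0 < t by near: t; apply: nbhs_pinfty_gt; exact: num_real.
  apply: rate_of => // r2.
  have [L fL HL] := HK r t r0 r2 t0.
  rewrite (le_trans HL)// lerD2l ler_wpM2l//.
  have mr : 0 < m r by rewrite (lt_le_trans ltr01)// m1// r0.
  have := HD (fun j s => L (Fd j s)) r t _ _ _ r0 r2 t0.
  rewrite (m_k_pow k0 r0 mr mk) => h.
  have {}h : t ^+ k * cn (osc (fun j s => L (Fd j s)) r 2^-1 t 0 0) <= D * (c ^+ k * r * t ^+ k).
    apply: h.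
    + by move=> j jk s s0; apply: has_deriv_cder => //; exact: Fd1.
    + by move=> j jk s s0; apply: cont_at_functional => //; exact: cF.
    + move=> j jk s s1; rewrite (le_trans (fun_bound fL _))// -!mulrA ler_wpM2l// !mulrA.
      exact: HC.
  have tk : 0 < t ^+ k by rewrite exprn_gt0.
  have {}h : cn (osc (fun j s => L (Fd j s)) r 2^-1 t 0 0) <= D * c ^+ k * r.
    by rewrite -(ler_pM2l tk) (le_trans h)// le_eqVlt; apply/orP; left; apply/eqP; ring.
  by rewrite (le_trans h)// ler_wpM2l// lerDl invr_ge0 ltW.
- move=> [Fd [C [[F0 Fd1] [C0 HC]]]] c /andP[c0 c1].
  have cF j s : s != 0 -> {for s, continuous (Fd j)}.
    by move=> s0; apply: has_deriv_continuous; exact: Fd1.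
  have [K K0 HK] := rate_reduction cf fB fR fP lF bF F0 (Fd1 0%N) (cF 1%N).
  have C20 : 0 <= 2 * C by rewrite mulr_ge0// ltW.
  have [D D0 HD] := osc_log_rate m1 mD C20 c0 c1.
  exists (K + K * D + 2 * B); near=> t => r /andP[r0 r1] mlog.
  have t0 : 0 < t by near: t; apply: nbhs_pinfty_gt; exact: num_real.
  apply: rate_of => // r2.
  have [L fL HL] := HK r t r0 r2 t0.
  rewrite (le_trans HL)// lerD2l ler_wpM2l//.
  apply: HD => //.
  + by move=> j s s0; apply: has_deriv_cder => //; exact: Fd1.
  + by move=> j s s0; apply: cont_at_functional => //; exact: cF.
  + move=> j s s1; rewrite (le_trans (fun_bound fL _))// -!mulrA ler_wpM2l// !mulrA.
    exact: HC.
Unshelve. all: by end_near.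
Qed.
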